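(* The series $$ Z(s)=\sum_{\mathbf{x}\cdot\mathbf{y}=0}(|\mathbf{x}||\mathbf{y}|)^{-2s}, $$ with summation over all pairs of primitive vectors $\mathbf{x},\mathbf{y}\in\mathbb{Z}^3$ satisfying $x_0y_0+x_1y_1+x_2y_2=0$, is absolutely convergent in $\operatorname{Re} s>1$ and admits an analytic continuation to the region $\operatorname{Re} s>7/8$, $s\ne 1$, with a double pole at $s=1$. Moreover, for any $\theta>7/8$, in the region $\operatorname{Re} s\ge\theta$, $|s-1|\ge 1$, this continuation satisfies $Z(s)=O(|s|)$ (the implied constant may depend on $\theta$).
   Context: For $\mathbf{x}=(x_0,x_1,x_2)\in\mathbb{Z}^3$ write $|\mathbf{x}|=\max(|x_0|,|x_1|,|x_2|)$. A vector in $\mathbb{Z}^3$ is primitive if the greatest common divisor of its coordinates is $1$. *)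

(* Defs.v *)
From Stdlib Require Export Reals ZArith List.
From Coquelicot Require Export Coquelicot.
Open Scope R_scope.

Definition vec3 : Type := (Z * Z * Z)%type.

Definition vnorm (x : vec3) : Z :=
  let '(x0, x1, x2) := x in Z.max (Z.max (Z.abs x0) (Z.abs x1)) (Z.abs x2).

Definition dot (x y : vec3) : Z :=
  let '(x0, x1, x2) := x in
  let '(y0, y1, y2) := y in (x0 * y0 + x1 * y1 + x2 * y2)%Z.

(* [Z.gcd] is nonnegative and [Z.gcd 0 0 = 0], so the zero vector is excluded. *)
Definition primitive (x : vec3) : Prop :=
  let '(x0, x1, x2) := x in Z.gcd (Z.gcd x0 x1) x2 = 1%Z.

Definition primitive_orthogonal (p : vec3 * vec3) : Prop :=
  primitive (fst p) /\ primitive (snd p) /\ dot (fst p) (snd p) = 0%Z.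

Definition Cexp (z : C) : C :=
  (exp (Re z) * cos (Im z), exp (Re z) * sin (Im z)).

(* [r ^ w] for a positive real base; meaningful only when [0 < r]. *)
Definition RCpower (r : R) (w : C) : C := Cexp (w * RtoC (ln r))%C.

Definition zeta_term (s : C) (p : vec3 * vec3) : C :=
  RCpower (IZR (vnorm (fst p) * vnorm (snd p))) (- (RtoC 2 * s))%C.

(* Sums over the family [{ t | P t }] without a choice of enumeration: finite
   subsets are represented by duplicate-free lists, and [has_sum] is convergence
   along the finite subsets ordered by inclusion. *)
Definition finite_subset {T : Type} (P : T -> Prop) (l : list T) : Prop :=
  NoDup l /\ List.Forall P l.

Definition absolutely_summable {T : Type} (P : T -> Prop) (f : T -> C) : Prop :=
  exists M : R, forall l : list T, finite_subset P l ->
    fold_right Rplus 0 (map (fun t => Cmod (f t)) l) <= M.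

Definition has_sum {T : Type} (P : T -> Prop) (f : T -> C) (S : C) : Prop :=
  forall eps : R, 0 < eps ->
    exists l0 : list T, finite_subset P l0 /\
      forall l : list T, finite_subset P l -> incl l0 l ->
        Cmod (fold_right Cplus (RtoC 0) (map f l) - S)%C < eps.

(* Complex differentiability at every point of [D]; used for open [D] only. *)
Definition holomorphic_on (D : C -> Prop) (f : C -> C) : Prop :=
  forall z : C, D z -> @ex_derive C_AbsRing C_NormedModule f z.

(* For [m >= 1]: [f] has a pole of order exactly [m] at [a]. *)
Definition has_pole (f : C -> C) (a : C) (m : nat) : Prop :=
  exists (r : R) (g : C -> C),
    0 < r /\
    holomorphic_on (fun z => Cmod (z - a)%C < r) g /\
    g a <> RtoC 0 /\
    forall z : C, Cmod (z - a)%C < r -> z <> a ->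
      f z = (g z / (z - a) ^ m)%C.

(* Main.v *)
Require Import Defs.
From Stdlib Require Import Lra Lia Psatz Permutation ClassicalEpsilon.

(** Put [w = 2 s], and let [N n m] be the number of pairs of orthogonal nonzero vectors
    with norms [n] and [m]. Every nonzero vector is a unique positive multiple of a
    primitive one, so the double Dirichlet series of [N n m (n m)^-w] is [zeta w ^ 2]
    times the sum over primitive pairs ([primitive_sum]). Since the terms of
    [zeta w] after the first have absolute sum below one for [Re w >= 7/4], division by
    [zeta w ^ 2] is harmless there ([zeta_lower]), and everything reduces to the
    double series.

    The integer vectors orthogonal to a fixed [x] form a plane lattice. If [v] is its
    shortest vector, the number of its points in a cube of size [m] is a multiple of
    [m^2] up to [O(m / |v|)]. The multiple is never computed: it exists because the
    count at [k m] is [k^2] times the count at [m], up to [k^2] times that error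
    ([perp_scale], [scaling_density]). Summation over [|x| = n] gives rows
    [N n 1 + ... + N n m = a_n m^2 + O(e_n m)] ([density_spec]). As [|v|] is at most
    of order [|x|^(1/2)], and few [x] share a given [v], the sum of [e_n] over
    [n <= X] is [O(X^(5/2))] ([errors_sum]). Because [N] is symmetric, the numbers
    [m^2 (a_1 + ... + a_n)] and [n^2 (a_1 + ... + a_m)] approximate the same count of
    pairs; this forces [a_1 + ... + a_n = b n^2 + O(n^(3/2))] ([symmetric_density]),
    and a pigeonhole argument gives [b > 0] ([counts_regular]).

    For the continuation, symmetry restricts the double series to [m >= n]. Abel
    summation over [m] ([dirichlet_tail]) produces [2 a_n n^(2-w) / (w - 2)] and a
    remainder that is [O(e_n n^(1-w))], up to better terms. Multiplied by [n^-w], the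
    remainders have a convergent sum for [Re w > 7/4], while a second Abel summation,
    now over [n], gives another factor [1 / (w - 2)]. Hence [(w - 2)^2] times the double
    series extends to a function [cleared] on [Re w > 7/4]. It is [O(|w|^3)] on every
    smaller closed half-plane, which leaves [O(|w|)] after division by [(w - 2)^2], and
    its value at [w = 2] is [4 b <> 0] ([box_limit], [jet_cleared], [cleared_at_pole]).

    Differentiability of the infinite sums is obtained together with their growth. A
    jet bound controls the value, the derivative and the quadratic remainder of a
    function on a disc; such bounds are explicit for powers [x^-w] and pass to sums,
    products and absolutely convergent series ([jet_mult], [jet_series]). *)

(** * Finite sums, limits and series of complex numbers *)

Definition rsum {T : Type} (l : list T) (f : T -> R) : R :=
  fold_right Rplus 0 (map f l).

Definition csum {T : Type} (l : list T) (f : T -> C) : C :=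
  fold_right Cplus (RtoC 0) (map f l).

Lemma rsum_app {T : Type} (l1 l2 : list T) (f : T -> R) :
  rsum (l1 ++ l2) f = rsum l1 f + rsum l2 f.
Proof.
  unfold rsum; induction l1 as [|a l1 IH]; simpl; [ring|]. rewrite IH; ring.
Qed.

Lemma rsum_ext {T : Type} (l : list T) (f g : T -> R) :
  (forall t, In t l -> f t = g t) -> rsum l f = rsum l g.
Proof.
  unfold rsum; induction l as [|a l IH]; simpl; intros H; [reflexivity|].
  rewrite (H a) by auto. rewrite IH by auto. reflexivity.
Qed.

Lemma rsum_le {T : Type} (l : list T) (f g : T -> R) :
  (forall t, In t l -> f t <= g t) -> rsum l f <= rsum l g.
Proof.
  unfold rsum; induction l as [|a l IH]; simpl; intros H; [lra|].
  apply Rplus_le_compat; auto.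
Qed.

Lemma rsum_plus {T : Type} (l : list T) (f g : T -> R) :
  rsum l (fun t => f t + g t) = rsum l f + rsum l g.
Proof.
  unfold rsum; induction l as [|a l IH]; simpl; [ring|]. rewrite IH; ring.
Qed.

Lemma rsum_scal {T : Type} (l : list T) (c : R) (f : T -> R) :
  rsum l (fun t => c * f t) = c * rsum l f.
Proof.
  unfold rsum; induction l as [|a l IH]; simpl; [ring|]. rewrite IH; ring.
Qed.

Lemma rsum_zero {T : Type} (l : list T) (f : T -> R) :
  (forall t, In t l -> f t = 0) -> rsum l f = 0.
Proof.
  unfold rsum; induction l as [|a l IH]; simpl; intros H; [reflexivity|].
  rewrite (H a) by auto. rewrite IH by auto. ring.
Qed.

Lemma rsum_nonneg {T : Type} (l : list T) (f : T -> R) :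
  (forall t, In t l -> 0 <= f t) -> 0 <= rsum l f.
Proof.
  intros H. rewrite <- (rsum_zero l (fun _ => 0)) by reflexivity.
  now apply rsum_le.
Qed.

Lemma rsum_const {T : Type} (l : list T) (c : R) :
  rsum l (fun _ => c) = INR (length l) * c.
Proof.
  induction l as [|a l IH]; [unfold rsum; simpl; ring|].
  change (rsum (a :: l) (fun _ => c)) with (c + rsum l (fun _ => c)).
  rewrite IH. change (length (a :: l)) with (S (length l)). rewrite S_INR. ring.
Qed.

Lemma rsum_abs {T : Type} (l : list T) (f : T -> R) :
  Rabs (rsum l f) <= rsum l (fun t => Rabs (f t)).
Proof.
  unfold rsum; induction l as [|a l IH]; simpl; [rewrite Rabs_R0; lra|].
  eapply Rle_trans; [apply Rabs_triang|]. lra.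
Qed.

Lemma rsum_swap {T U : Type} (l : list T) (l' : list U) (f : T -> U -> R) :
  rsum l (fun t => rsum l' (f t)) = rsum l' (fun u => rsum l (fun t => f t u)).
Proof.
  induction l as [|a l IH].
  - symmetry. now apply rsum_zero.
  - change (rsum (a :: l) (fun t => rsum l' (f t)))
      with (rsum l' (f a) + rsum l (fun t => rsum l' (f t))).
    rewrite IH, <- rsum_plus. reflexivity.
Qed.

Lemma rsum_flat_map {T U : Type} (l : list T) (h : T -> list U) (f : U -> R) :
  rsum (flat_map h l) f = rsum l (fun t => rsum (h t) f).
Proof.
  induction l as [|a l IH]; [reflexivity|].
  simpl. rewrite rsum_app, IH. reflexivity.
Qed.

Lemma rsum_map {T U : Type} (l : list T) (h : T -> U) (f : U -> R) :
  rsum (map h l) f = rsum l (fun t => f (h t)).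
Proof. unfold rsum. now rewrite map_map. Qed.

Lemma rsum_filter {T : Type} (l : list T) (p : T -> bool) (f : T -> R) :
  rsum (filter p l) f = rsum l (fun t => if p t then f t else 0).
Proof.
  unfold rsum; induction l as [|a l IH]; [reflexivity|].
  simpl. destruct (p a); simpl; rewrite IH; ring.
Qed.

Lemma rsum_list_prod {T U : Type} (l : list T) (l' : list U) (f : T * U -> R) :
  rsum (list_prod l l') f = rsum l (fun t => rsum l' (fun u => f (t, u))).
Proof.
  induction l as [|a l IH]; [reflexivity|].
  simpl. rewrite rsum_app, IH, rsum_map. reflexivity.
Qed.

Lemma rsum_perm {T : Type} (l l' : list T) (f : T -> R) :
  Permutation l l' -> rsum l f = rsum l' f.
Proof.
  unfold rsum; induction 1; simpl; try congruence; ring.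
Qed.

Lemma NoDup_incl_split {T : Type} (l l' : list T) :
  NoDup l -> incl l l' -> exists r, Permutation l' (l ++ r).
Proof.
  revert l'. induction l as [|a l IH]; intros l' Hn Hi.
  - exists l'. apply Permutation_refl.
  - inversion Hn as [|? ? Ha Hl]; subst.
    destruct (in_split a l') as [l1 [l2 E]]; [apply Hi; now left|]. subst l'.
    destruct (IH (l1 ++ l2) Hl) as [r Hr].
    + intros t Ht. assert (Ht' := Hi t (or_intror Ht)).
      apply in_app_or in Ht'. apply in_or_app.
      destruct Ht' as [?|[E|?]]; auto. subst; contradiction.
    + exists r. apply Permutation_trans with (a :: l1 ++ l2).
      * apply Permutation_sym, Permutation_middle.
      * simpl. now apply perm_skip.
Qed.

Lemma rsum_incl {T : Type} (l l' : list T) (f : T -> R) :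
  NoDup l -> incl l l' -> (forall t, In t l' -> 0 <= f t) ->
  rsum l f <= rsum l' f.
Proof.
  intros Hn Hi Hf. destruct (NoDup_incl_split l l' Hn Hi) as [r Hr].
  rewrite (rsum_perm _ _ f Hr), rsum_app.
  assert (0 <= rsum r f); [|lra].
  apply rsum_nonneg. intros t Ht. apply Hf.
  apply Permutation_in with (l ++ r); [now apply Permutation_sym|].
  apply in_or_app; auto.
Qed.

Lemma rsum_seq_S (n : nat) (f : nat -> R) :
  rsum (seq 0 (S n)) f = rsum (seq 0 n) f + f n.
Proof. rewrite seq_S, rsum_app. unfold rsum at 2; simpl. ring. Qed.

Lemma rsum_seq_Sl (n : nat) (f : nat -> R) :
  rsum (seq 0 (S n)) f = f 0%nat + rsum (seq 0 n) (fun i => f (S i)).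
Proof.
  simpl. rewrite <- seq_shift. unfold rsum. simpl. now rewrite map_map.
Qed.

Lemma rsum_sum_n (f : nat -> R) (n : nat) :
  sum_n f n = rsum (seq 0 (S n)) f.
Proof.
  induction n as [|n IH].
  - rewrite sum_O. unfold rsum; simpl. ring.
  - rewrite sum_Sn, IH, (rsum_seq_S (S n)). reflexivity.
Qed.

Lemma csum_pair {T : Type} (l : list T) (f : T -> C) :
  csum l f = (rsum l (fun t => Re (f t)), rsum l (fun t => Im (f t))).
Proof.
  induction l as [|a l IH]; [reflexivity|].
  change (csum (a :: l) f) with (f a + csum l f)%C.
  rewrite IH. reflexivity.
Qed.

Lemma csum_app {T : Type} (l1 l2 : list T) (f : T -> C) :
  csum (l1 ++ l2) f = (csum l1 f + csum l2 f)%C.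
Proof. rewrite !csum_pair, !rsum_app. reflexivity. Qed.

Lemma csum_ext {T : Type} (l : list T) (f g : T -> C) :
  (forall t, In t l -> f t = g t) -> csum l f = csum l g.
Proof.
  intros H. rewrite !csum_pair.
  f_equal; apply rsum_ext; intros t Ht; now rewrite H.
Qed.

Lemma csum_plus {T : Type} (l : list T) (f g : T -> C) :
  csum l (fun t => f t + g t)%C = (csum l f + csum l g)%C.
Proof. rewrite !csum_pair. simpl. rewrite !rsum_plus. reflexivity. Qed.

Lemma csum_scal {T : Type} (l : list T) (c : C) (f : T -> C) :
  csum l (fun t => c * f t)%C = (c * csum l f)%C.
Proof.
  induction l as [|a l IH]; [unfold csum; simpl; ring|].
  change (csum (a :: l) (fun t => c * f t)%C)
    with (c * f a + csum l (fun t => c * f t)%C)%C.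
  rewrite IH. change (csum (a :: l) f) with (f a + csum l f)%C. ring.
Qed.

Lemma csum_swap {T U : Type} (l : list T) (l' : list U) (f : T -> U -> C) :
  csum l (fun t => csum l' (f t)) = csum l' (fun u => csum l (fun t => f t u)).
Proof.
  rewrite !csum_pair. f_equal.
  - transitivity (rsum l (fun t => rsum l' (fun u => Re (f t u)))).
    + apply rsum_ext; intros; now rewrite csum_pair.
    + rewrite rsum_swap. apply rsum_ext; intros; now rewrite csum_pair.
  - transitivity (rsum l (fun t => rsum l' (fun u => Im (f t u)))).
    + apply rsum_ext; intros; now rewrite csum_pair.
    + rewrite rsum_swap. apply rsum_ext; intros; now rewrite csum_pair.
Qed.

Lemma csum_flat_map {T U : Type} (l : list T) (h : T -> list U) (f : U -> C) :
  csum (flat_map h l) f = csum l (fun t => csum (h t) f).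
Proof.
  induction l as [|a l IH]; [reflexivity|].
  simpl. rewrite csum_app, IH. reflexivity.
Qed.

Lemma csum_map {T U : Type} (l : list T) (h : T -> U) (f : U -> C) :
  csum (map h l) f = csum l (fun t => f (h t)).
Proof. unfold csum. now rewrite map_map. Qed.

Lemma csum_filter {T : Type} (l : list T) (p : T -> bool) (f : T -> C) :
  csum (filter p l) f = csum l (fun t => if p t then f t else RtoC 0).
Proof.
  unfold csum; induction l as [|a l IH]; [reflexivity|].
  simpl. destruct (p a); simpl; rewrite IH; ring.
Qed.

Lemma csum_list_prod {T U : Type} (l : list T) (l' : list U) (f : T * U -> C) :
  csum (list_prod l l') f = csum l (fun t => csum l' (fun u => f (t, u))).
Proof.
  induction l as [|a l IH]; [reflexivity|].
  simpl. rewrite csum_app, IH, csum_map. reflexivity.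
Qed.

Lemma csum_perm {T : Type} (l l' : list T) (f : T -> C) :
  Permutation l l' -> csum l f = csum l' f.
Proof. intros H. rewrite !csum_pair. f_equal; now apply rsum_perm. Qed.

Lemma csum_seq_S (n : nat) (f : nat -> C) :
  csum (seq 0 (S n)) f = (csum (seq 0 n) f + f n)%C.
Proof. rewrite seq_S, csum_app. unfold csum at 2; simpl. ring. Qed.

Lemma Cmod_csum {T : Type} (l : list T) (f : T -> C) :
  Cmod (csum l f) <= rsum l (fun t => Cmod (f t)).
Proof.
  induction l as [|a l IH].
  - unfold csum, rsum; simpl. rewrite Cmod_0. lra.
  - change (csum (a :: l) f) with (f a + csum l f)%C.
    eapply Rle_trans; [apply Cmod_triangle|].
    change (rsum (a :: l) (fun t => Cmod (f t)))
      with (Cmod (f a) + rsum l (fun t => Cmod (f t))). lra.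
Qed.

Lemma csum_RtoC {T : Type} (l : list T) (f : T -> R) :
  csum l (fun t => RtoC (f t)) = RtoC (rsum l f).
Proof.
  rewrite csum_pair. unfold RtoC. f_equal. now apply rsum_zero.
Qed.

Definition ctends (u : nat -> C) (l : C) : Prop :=
  is_lim_seq (fun n => Cmod (u n - l)%C) 0.

Lemma is_lim_seq_eps (u : nat -> R) (l : R) :
  is_lim_seq u l <->
  forall eps, 0 < eps -> exists N, forall n, (N <= n)%nat -> Rabs (u n - l) < eps.
Proof.
  rewrite is_lim_seq_Reals. unfold Un_cv, Rdist. split; intros H e He;
  destruct (H e He) as [N HN]; exists N; intros n Hn; apply HN; lia.
Qed.

Lemma ctends_eps (u : nat -> C) (l : C) :
  ctends u l <->
  forall eps, 0 < eps -> exists N, forall n, (N <= n)%nat -> Cmod (u n - l)%C < eps.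
Proof.
  unfold ctends. rewrite is_lim_seq_eps. split; intros H e He;
  destruct (H e He) as [N HN]; exists N; intros n Hn; specialize (HN n Hn);
  rewrite Rminus_0_r, Rabs_pos_eq in * by apply Cmod_ge_0; exact HN.
Qed.

Lemma Cmod_le_comp (z : C) : Cmod z <= Rabs (Re z) + Rabs (Im z).
Proof.
  unfold Cmod. fold (Re z) (Im z). apply Rsqr_incr_0_var.
  - rewrite Rsqr_sqrt.
    + assert (A := Rabs_pos (Re z)). assert (B := Rabs_pos (Im z)).
      rewrite <- (pow2_abs (Re z)), <- (pow2_abs (Im z)). unfold Rsqr. nra.
    + assert (A := pow2_ge_0 (Re z)). assert (B := pow2_ge_0 (Im z)). lra.
  - assert (A := Rabs_pos (Re z)). assert (B := Rabs_pos (Im z)). lra.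
Qed.

Lemma Re_le_Cmod (z : C) : Rabs (Re z) <= Cmod z.
Proof.
  eapply Rle_trans; [apply Rmax_l|apply Rmax_Cmod].
Qed.

Lemma Im_le_Cmod (z : C) : Rabs (Im z) <= Cmod z.
Proof.
  eapply Rle_trans; [apply Rmax_r|apply Rmax_Cmod].
Qed.

Lemma ctends_pair (u : nat -> C) (a b : R) :
  is_lim_seq (fun n => Re (u n)) a -> is_lim_seq (fun n => Im (u n)) b ->
  ctends u (a, b).
Proof.
  intros Ha Hb. apply ctends_eps. intros e He.
  rewrite is_lim_seq_eps in Ha, Hb.
  destruct (Ha (e/2)) as [N HN]; [lra|]. destruct (Hb (e/2)) as [M HM]; [lra|].
  exists (N + M)%nat. intros n Hn.
  eapply Rle_lt_trans; [apply Cmod_le_comp|].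
  specialize (HN n ltac:(lia)). specialize (HM n ltac:(lia)).
  unfold Re, Im in *; simpl. unfold Rminus in *. lra.
Qed.

Lemma ctends_Re (u : nat -> C) (l : C) :
  ctends u l -> is_lim_seq (fun n => Re (u n)) (Re l).
Proof.
  rewrite ctends_eps, is_lim_seq_eps. intros H e He.
  destruct (H e He) as [N HN]. exists N. intros n Hn.
  eapply Rle_lt_trans; [|apply (HN n Hn)].
  apply (Re_le_Cmod (u n - l)%C).
Qed.

Lemma ctends_plus (u v : nat -> C) (a b : C) :
  ctends u a -> ctends v b -> ctends (fun n => u n + v n)%C (a + b)%C.
Proof.
  rewrite !ctends_eps. intros Ha Hb e He.
  destruct (Ha (e/2)) as [N HN]; [lra|]. destruct (Hb (e/2)) as [M HM]; [lra|].
  exists (N + M)%nat. intros n Hn.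
  replace (u n + v n - (a + b))%C with ((u n - a) + (v n - b))%C by ring.
  eapply Rle_lt_trans; [apply Cmod_triangle|].
  specialize (HN n ltac:(lia)). specialize (HM n ltac:(lia)). lra.
Qed.

Lemma ctends_scal (c : C) (u : nat -> C) (a : C) :
  ctends u a -> ctends (fun n => c * u n)%C (c * a)%C.
Proof.
  unfold ctends. intros H.
  apply is_lim_seq_ext with (fun n => Cmod c * Cmod (u n - a)%C).
  - intros n. rewrite <- Cmod_mult. f_equal. ring.
  - replace (Finite 0) with (Rbar_mult (Cmod c) 0) by (simpl; f_equal; ring).
    now apply is_lim_seq_scal_l.
Qed.

Lemma ctends_const (c : C) : ctends (fun _ => c) c.
Proof.
  apply ctends_eps. intros e He. exists 0%nat. intros n _.
  replace (c - c)%C with (RtoC 0) by ring. rewrite Cmod_0. exact He.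
Qed.

Lemma ctends_unique (u : nat -> C) (a b : C) :
  ctends u a -> ctends u b -> a = b.
Proof.
  rewrite !ctends_eps. intros Ha Hb.
  destruct (Ceq_dec a b) as [E|E]; [exact E|exfalso].
  assert (P : 0 < Cmod (a - b)%C).
  { apply Cmod_gt_0. intros E'. apply E.
    replace a with ((a - b) + b)%C by ring. rewrite E'. ring. }
  destruct (Ha (Cmod (a - b)%C / 2)) as [N HN]; [lra|].
  destruct (Hb (Cmod (a - b)%C / 2)) as [M HM]; [lra|].
  specialize (HN (N + M)%nat ltac:(lia)). specialize (HM (N + M)%nat ltac:(lia)).
  assert (Q := Cmod_triangle (- (u (N + M)%nat - a)) (u (N + M)%nat - b)).
  rewrite Cmod_opp in Q.
  replace (- (u (N + M)%nat - a) + (u (N + M)%nat - b))%C with (a - b)%C in Q by ring.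
  lra.
Qed.

Lemma ctends_ext (u v : nat -> C) (l : C) :
  (forall n, u n = v n) -> ctends u l -> ctends v l.
Proof.
  intros E. unfold ctends. apply is_lim_seq_ext. intros n. now rewrite E.
Qed.

Lemma ctends_Cmod_le (u : nat -> C) (l : C) (M : R) :
  ctends u l -> (forall n, Cmod (u n) <= M) -> Cmod l <= M.
Proof.
  rewrite ctends_eps. intros H HM.
  apply Rnot_lt_le. intros Hlt.
  destruct (H (Cmod l - M)) as [N HN]; [lra|].
  specialize (HN N (le_n _)). specialize (HM N).
  assert (Q := Cmod_triangle (- (u N - l)) (u N)). rewrite Cmod_opp in Q.
  replace (- (u N - l) + u N)%C with l in Q by ring. lra.
Qed.

Lemma ctends_zero (u : nat -> C) (v : nat -> R) :
  (forall n, Cmod (u n) <= v n) -> is_lim_seq v 0 -> ctends u (RtoC 0).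
Proof.
  intros H Hv. unfold ctends.
  apply is_lim_seq_le_le with (fun _ => 0) v.
  - intros n. split; [apply Cmod_ge_0|].
    replace (u n - RtoC 0)%C with (u n) by ring. apply H.
  - apply is_lim_seq_const.
  - exact Hv.
Qed.

Definition csums (f : nat -> C) (S : C) : Prop :=
  ctends (fun n => csum (seq 0 n) f) S.

Definition CSeries (f : nat -> C) : C :=
  (Series (fun n => Re (f n)), Series (fun n => Im (f n))).

Lemma is_series_rsum (f : nat -> R) (l : R) :
  is_series f l <-> is_lim_seq (fun n => rsum (seq 0 n) f) l.
Proof.
  rewrite (is_lim_seq_incr_1 (fun n => rsum (seq 0 n) f)).
  unfold is_series. split; intros H.
  - apply is_lim_seq_ext with (sum_n f); [intros; apply rsum_sum_n|exact H].
  - change (is_lim_seq (sum_n f) l).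
    eapply is_lim_seq_ext; [|exact H]. intros n; simpl. symmetry; apply rsum_sum_n.
Qed.

Lemma ex_series_bound (f : nat -> R) (M : R) :
  (forall i, 0 <= f i) -> (forall n, rsum (seq 0 n) f <= M) -> ex_series f.
Proof.
  intros Hf HM.
  destruct (ex_finite_lim_seq_incr (fun n => rsum (seq 0 n) f) M) as [l Hl].
  - intros n. rewrite rsum_seq_S. specialize (Hf n). lra.
  - exact HM.
  - exists l. now apply is_series_rsum.
Qed.

Lemma rsum_le_Series (f : nat -> R) (n : nat) :
  (forall i, 0 <= f i) -> ex_series f -> rsum (seq 0 n) f <= Series f.
Proof.
  intros Hf Hs. apply Series_correct in Hs. apply is_series_rsum in Hs.
  apply (is_lim_seq_incr_compare (fun n => rsum (seq 0 n) f)); [exact Hs|].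
  intros k. rewrite rsum_seq_S. specialize (Hf k). lra.
Qed.

Lemma Series_le_bound (f : nat -> R) (M : R) :
  (forall i, 0 <= f i) -> (forall n, rsum (seq 0 n) f <= M) -> Series f <= M.
Proof.
  intros Hf HM. assert (Hs := ex_series_bound f M Hf HM).
  apply Series_correct in Hs. apply is_series_rsum in Hs.
  apply (is_lim_seq_le (fun n => rsum (seq 0 n) f) (fun _ => M) (Series f) M);
    auto using is_lim_seq_const.
Qed.

Lemma ex_series_dominated (f g : nat -> R) :
  (forall i, 0 <= f i <= g i) -> ex_series g -> ex_series f.
Proof.
  intros H Hg. apply (@ex_series_le R_AbsRing R_CompleteNormedModule f g); [|exact Hg].
  intros n. change (norm (f n)) with (Rabs (f n)).
  rewrite Rabs_pos_eq; apply H.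
Qed.

Lemma CSeries_correct (f : nat -> C) :
  ex_series (fun n => Cmod (f n)) -> csums f (CSeries f).
Proof.
  intros H. unfold csums, CSeries.
  assert (HR : ex_series (fun n => Re (f n))).
  { apply ex_series_Rabs. eapply ex_series_dominated; [|exact H].
    intros i; split; [apply Rabs_pos|apply Re_le_Cmod]. }
  assert (HI : ex_series (fun n => Im (f n))).
  { apply ex_series_Rabs. eapply ex_series_dominated; [|exact H].
    intros i; split; [apply Rabs_pos|apply Im_le_Cmod]. }
  apply ctends_pair.
  - apply Series_correct, is_series_rsum in HR.
    eapply is_lim_seq_ext; [|exact HR]. intros n. simpl. now rewrite csum_pair.
  - apply Series_correct, is_series_rsum in HI.
    eapply is_lim_seq_ext; [|exact HI]. intros n. simpl. now rewrite csum_pair.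
Qed.

Lemma Cmod_CSeries (f : nat -> C) (M : nat -> R) :
  (forall i, Cmod (f i) <= M i) -> ex_series M -> Cmod (CSeries f) <= Series M.
Proof.
  intros H HM.
  assert (HM0 : forall i, 0 <= M i).
  { intros i. eapply Rle_trans; [apply Cmod_ge_0|apply H]. }
  assert (Hf : ex_series (fun n => Cmod (f n))).
  { eapply ex_series_dominated; [|exact HM].
    intros i; split; [apply Cmod_ge_0|apply H]. }
  apply (ctends_Cmod_le _ _ _ (CSeries_correct f Hf)).
  intros n. eapply Rle_trans; [apply Cmod_csum|].
  eapply Rle_trans; [apply (rsum_le _ _ M); intros; apply H|].
  now apply rsum_le_Series.
Qed.

Lemma csums_unique (f : nat -> C) (a b : C) : csums f a -> csums f b -> a = b.
Proof. apply ctends_unique. Qed.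

Lemma csums_plus (f g : nat -> C) (a b : C) :
  csums f a -> csums g b -> csums (fun n => f n + g n)%C (a + b)%C.
Proof.
  intros Ha Hb. unfold csums. eapply ctends_ext; [|apply ctends_plus; [exact Ha|exact Hb]].
  intros n; simpl. now rewrite csum_plus.
Qed.

Lemma csums_scal (c : C) (f : nat -> C) (a : C) :
  csums f a -> csums (fun n => c * f n)%C (c * a)%C.
Proof.
  intros Ha. unfold csums. eapply ctends_ext; [|apply ctends_scal; exact Ha].
  intros n; simpl. now rewrite csum_scal.
Qed.

Lemma csums_ext (f g : nat -> C) (a : C) :
  (forall n, f n = g n) -> csums f a -> csums g a.
Proof.
  intros E. unfold csums. apply ctends_ext. intros n. now apply csum_ext.
Qed.

(** Beyond a fixed index, the sums of [c X] and of the limits are both controlled by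
    the tail of [b]. *)
Lemma tannery (c : nat -> nat -> C) (c' : nat -> C) (b : nat -> R) :
  (forall X n, Cmod (c X n) <= b n) -> ex_series b ->
  (forall n, ctends (fun X => c X n) (c' n)) ->
  ctends (fun X => csum (seq 0 X) (c X)) (CSeries c').
Proof.
  intros Hb Hs Hc. apply ctends_eps. intros e He.
  assert (Hb0 : forall n, 0 <= b n).
  { intros n. eapply Rle_trans; [apply Cmod_ge_0|apply (Hb 0%nat)]. }
  assert (Hb' : forall n, Cmod (c' n) <= b n).
  { intros n. apply (ctends_Cmod_le _ _ _ (Hc n)). intros X. apply Hb. }
  assert (Hs' : ex_series (fun n => Cmod (c' n))).
  { eapply ex_series_dominated; [|exact Hs]. intros i; split; [apply Cmod_ge_0|auto]. }
  assert (HC := CSeries_correct c' Hs').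
  assert (HB := proj1 (is_series_rsum b _) (Series_correct b Hs)).
  rewrite is_lim_seq_eps in HB. destruct (HB (e/5)) as [N HN]; [lra|].
  unfold csums in HC. rewrite ctends_eps in HC. destruct (HC (e/5)) as [N2 HN2]; [lra|].
  (* uniform convergence on the first N indices *)
  assert (HU : exists N3, forall X, (N3 <= X)%nat ->
     Cmod (csum (seq 0 N) (c X) - csum (seq 0 N) c')%C < e/5).
  { assert (HT : ctends (fun X => csum (seq 0 N) (c X)) (csum (seq 0 N) c')).
    { clear HN. induction N as [|N IH].
      - exact (ctends_const (RtoC 0)).
      - rewrite csum_seq_S. eapply ctends_ext; [|apply ctends_plus; [exact IH|apply (Hc N)]].
        intros X; cbv beta. now rewrite csum_seq_S. }
    rewrite ctends_eps in HT. apply HT. lra. }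
  destruct HU as [N3 HN3].
  exists (N + N2 + N3)%nat. intros X HX.
  assert (Htail : forall f, (forall n, Cmod (f n) <= b n) ->
    Cmod (csum (seq 0 X) f - csum (seq 0 N) f)%C <= 2 * (e / 5)).
  { intros f Hf. replace X with (N + (X - N))%nat by lia.
    rewrite seq_app, csum_app.
    replace (csum (seq 0 N) f + csum (seq (0 + N) (X - N)) f - csum (seq 0 N) f)%C
      with (csum (seq (0 + N) (X - N)) f) by ring.
    eapply Rle_trans; [apply Cmod_csum|].
    eapply Rle_trans; [apply (rsum_le _ _ b); intros; apply Hf|].
    assert (A := HN N (le_n _)). assert (B := HN (N + (X - N))%nat ltac:(lia)).
    rewrite seq_app, rsum_app in B.
    apply Rabs_def2 in A. apply Rabs_def2 in B. lra. }
  assert (T1 := Htail (c X) (Hb X)).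
  assert (T2 := HN3 X ltac:(lia)).
  assert (T5 : Cmod (csum (seq 0 N) c' - CSeries c')%C <= e / 5 + e/5).
  { (* the limits obey the same bounds, hence so does their tail *)
    assert (T3 := Htail c' Hb').
    apply Rle_trans with (Series b - rsum (seq 0 N) b).
    2:{ assert (A := HN N (le_n _)). apply Rabs_def2 in A. lra. }
    apply ctends_Cmod_le with (fun k => csum (seq 0 N) c' - csum (seq 0 (N + k)) c')%C.
    - apply (ctends_plus (fun _ => csum (seq 0 N) c')
        (fun k => - csum (seq 0 (N + k)) c')%C _ (- CSeries c')%C); [apply ctends_const|].
      rewrite ctends_eps. intros d Hd. destruct (proj1 (ctends_eps _ _) (CSeries_correct c' Hs') d Hd) as [M HM].
      exists M. intros n Hn. specialize (HM (N + n)%nat ltac:(lia)).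
      replace (- csum (seq 0 (N + n)) c' - - CSeries c')%C
        with (- (csum (seq 0 (N + n)) c' - CSeries c'))%C by ring.
      now rewrite Cmod_opp.
    - intros k. rewrite seq_app, csum_app.
      replace (csum (seq 0 N) c' - (csum (seq 0 N) c' + csum (seq (0 + N) k) c'))%C
        with (- csum (seq (0 + N) k) c')%C by ring.
      rewrite Cmod_opp. eapply Rle_trans; [apply Cmod_csum|].
      eapply Rle_trans; [apply (rsum_le _ _ b); intros; apply Hb'|].
      assert (B := rsum_le_Series b (N + k) Hb0 Hs).
      rewrite seq_app, rsum_app in B. lra. }
  replace (csum (seq 0 X) (c X) - CSeries c')%C with
    ((csum (seq 0 X) (c X) - csum (seq 0 N) (c X)) +
     ((csum (seq 0 N) (c X) - csum (seq 0 N) c') + (csum (seq 0 N) c' - CSeries c')))%C by ring.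
  eapply Rle_lt_trans; [apply Cmod_triangle|].
  assert (Q := Cmod_triangle (csum (seq 0 N) (c X) - csum (seq 0 N) c')
                             (csum (seq 0 N) c' - CSeries c')).
  lra.
Qed.

Lemma ex_series_Rscal (c : R) (f : nat -> R) :
  ex_series f -> ex_series (fun i => c * f i).
Proof. exact (@ex_series_scal_l R_AbsRing R_NormedModule c f). Qed.

Lemma ctends_mult (u v : nat -> C) (a b : C) :
  ctends u a -> ctends v b -> ctends (fun n => u n * v n)%C (a * b)%C.
Proof.
  intros Ha Hb.
  assert (H1 : ctends (fun n => (u n - a) * (v n - b))%C (RtoC 0)).
  { unfold ctends in *. apply is_lim_seq_ext with (fun n => Cmod (u n - a)%C * Cmod (v n - b)%C).
    - intros n. rewrite <- Cmod_mult. f_equal. ring.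
    - replace (Finite 0) with (Rbar_mult 0 0) by (simpl; f_equal; ring).
      now apply is_lim_seq_mult'. }
  eapply ctends_ext with (fun n => (u n - a) * (v n - b) + (b * u n + (a * v n + - (a * b))))%C.
  { intros n. ring. }
  replace (a * b)%C with (RtoC 0 + (b * a + (a * b + - (a * b))))%C at 1 by ring.
  apply ctends_plus; [exact H1|]. apply ctends_plus; [now apply ctends_scal|].
  apply ctends_plus; [now apply ctends_scal|apply ctends_const].
Qed.

(** * Exponentials and powers *)

Lemma exp_sub1_le (a : R) : exp a - 1 <= a * exp a.
Proof.
  assert (H := exp_ineq1_le (- a)). assert (P := exp_pos a).
  assert (E : exp a * exp (- a) = 1) by (rewrite <- exp_plus, Rplus_opp_r; apply exp_0).
  nra.
Qed.

Lemma exp_Rmax_ge1 (a : R) : 1 <= exp (Rmax a 0).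
Proof.
  rewrite <- exp_0 at 1. assert (H := Rmax_r a 0).
  destruct (Rle_lt_or_eq_dec _ _ H) as [L|L].
  - left; now apply exp_increasing.
  - rewrite <- L. lra.
Qed.

Lemma exp_le (a b : R) : a <= b -> exp a <= exp b.
Proof.
  intros [H|H]; [left; now apply exp_increasing|rewrite H; lra].
Qed.

Lemma Rabs_exp_sub1 (a : R) : Rabs (exp a - 1) <= Rabs a * exp (Rmax a 0).
Proof.
  assert (H1 := exp_ineq1_le a). assert (H2 := exp_sub1_le a).
  destruct (Rle_dec 0 a) as [H|H].
  - rewrite Rmax_left by lra. rewrite !Rabs_pos_eq by lra. exact H2.
  - rewrite Rmax_right by lra. rewrite exp_0.
    assert (exp a <= 1) by nra.
    rewrite !Rabs_left1 by lra. lra.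
Qed.

Lemma Rabs_exp_sub1_sub (a : R) :
  Rabs (exp a - 1 - a) <= a ^ 2 * exp (Rmax a 0).
Proof.
  assert (H1 := exp_ineq1_le a). assert (H2 := exp_sub1_le a).
  assert (H3 := Rabs_exp_sub1 a).
  rewrite Rabs_pos_eq by lra.
  apply Rle_trans with (Rabs a * Rabs (exp a - 1)).
  - rewrite <- Rabs_mult. eapply Rle_trans; [|apply Rle_abs]. lra.
  - rewrite <- pow2_abs. assert (A := Rabs_pos a). nra.
Qed.

Lemma Rabs_sin_le (b : R) : Rabs (sin b) <= Rabs b.
Proof.
  assert (P : forall x, 0 < x -> Rabs (sin x) <= x).
  { intros x Hx. apply Rabs_le. split.
    - destruct (Rle_dec x 1) as [H|H].
      + assert (0 <= sin x); [|lra]. apply sin_ge_0; [lra|].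
        assert (Q2 := PI2_1). lra.
      + assert (Q := SIN_bound x). lra.
    - left; now apply sin_lt_x. }
  destruct (Rtotal_order b 0) as [H|[H|H]].
  - assert (Q := P (- b) ltac:(lra)). rewrite sin_neg, Rabs_Ropp in Q.
    rewrite (Rabs_left b) by lra. exact Q.
  - subst. rewrite sin_0. lra.
  - rewrite (Rabs_pos_eq b) by lra. now apply P.
Qed.

Lemma one_sub_cos (b : R) : 1 - cos b = 2 * (sin (b / 2)) ^ 2.
Proof.
  replace (cos b) with (cos (2 * (b / 2))) by (f_equal; field).
  rewrite cos_2a_sin. ring.
Qed.

Lemma Rabs_cos_sub1 (b : R) : Rabs (cos b - 1) <= b ^ 2.
Proof.
  rewrite Rabs_minus_sym, one_sub_cos.
  assert (H := Rabs_sin_le (b / 2)).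
  rewrite Rabs_pos_eq by (assert (Q := pow2_ge_0 (sin (b / 2))); lra).
  rewrite <- (pow2_abs (sin (b/2))).
  assert (Q : (Rabs (sin (b / 2))) ^ 2 <= (Rabs (b / 2)) ^ 2).
  { apply pow_incr. split; [apply Rabs_pos|exact H]. }
  rewrite (pow2_abs (b/2)) in Q. nra.
Qed.

Lemma Rabs_cos_sub1_lin (b : R) : Rabs (cos b - 1) <= Rabs b.
Proof.
  rewrite Rabs_minus_sym, one_sub_cos.
  assert (H := Rabs_sin_le (b / 2)).
  rewrite Rabs_pos_eq by (assert (Q := pow2_ge_0 (sin (b / 2))); lra).
  rewrite <- (pow2_abs (sin (b/2))).
  assert (B : Rabs (sin (b/2)) <= 1) by (apply Rabs_le; assert (Q := SIN_bound (b/2)); lra).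
  replace (Rabs (b / 2)) with (Rabs b / 2) in H
    by (unfold Rdiv; rewrite Rabs_mult, (Rabs_pos_eq (/2)) by lra; lra).
  assert (A := Rabs_pos (sin (b/2))). nra.
Qed.

Lemma Rabs_sin_sub (b : R) : Rabs (sin b - b) <= b ^ 2.
Proof.
  destruct (MVT_gen (fun x => sin x - x) 0 b (fun x => cos x - 1)) as [c [Hc E]].
  - intros x _. auto_derive; [exact I|]. lra.
  - intros x _. apply continuity_pt_filterlim.
    apply (ex_derive_continuous (fun x => sin x - x)). auto_derive. exact I.
  - rewrite sin_0 in E. replace (sin b - b) with ((cos c - 1) * (b - 0)) by lra.
    rewrite Rabs_mult, Rminus_0_r, <- pow2_abs. simpl. rewrite Rmult_1_r.
    apply Rmult_le_compat_r; [apply Rabs_pos|].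
    eapply Rle_trans; [apply Rabs_cos_sub1_lin|].
    destruct (Rle_dec 0 b).
    + rewrite Rmin_left, Rmax_right in Hc by lra. rewrite !Rabs_pos_eq; lra.
    + rewrite Rmin_right, Rmax_left in Hc by lra. rewrite !Rabs_left1; lra.
Qed.

Lemma Cexp_plus (a b : C) : Cexp (a + b) = (Cexp a * Cexp b)%C.
Proof.
  destruct a as [a1 a2], b as [b1 b2]. unfold Cexp, Cmult, Re, Im. simpl.
  rewrite exp_plus, cos_plus, sin_plus.
  f_equal; ring.
Qed.

Lemma Cmod_Cexp (z : C) : Cmod (Cexp z) = exp (Re z).
Proof.
  unfold Cmod, Cexp. simpl.
  replace (exp (Re z) * cos (Im z) * (exp (Re z) * cos (Im z) * 1) +
           exp (Re z) * sin (Im z) * (exp (Re z) * sin (Im z) * 1))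
    with ((exp (Re z)) ^ 2 * (Rsqr (sin (Im z)) + Rsqr (cos (Im z))))
    by (unfold Rsqr; ring).
  rewrite sin2_cos2, Rmult_1_r. apply sqrt_pow2. left; apply exp_pos.
Qed.

Lemma Cexp_RtoC (x : R) : Cexp (RtoC x) = RtoC (exp x).
Proof.
  unfold Cexp, RtoC. simpl. rewrite cos_0, sin_0. f_equal; ring.
Qed.

Lemma Cexp_0 : Cexp (RtoC 0) = RtoC 1.
Proof. now rewrite Cexp_RtoC, exp_0. Qed.

(** Modulus and direction are estimated separately below. *)
Lemma Cexp_split (z : C) :
  Cexp z = (RtoC (exp (Re z)) * Cexp (0, Im z))%C.
Proof.
  unfold Cexp, RtoC, Cmult. simpl. rewrite exp_0. f_equal; ring.
Qed.

Lemma Cexp_imag1 (b : R) : Cmod (Cexp (0, b) - 1)%C <= 2 * Rabs b.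
Proof.
  eapply Rle_trans; [apply Cmod_le_comp|]. unfold Cexp; simpl. rewrite exp_0.
  assert (H1 := Rabs_cos_sub1_lin b). assert (H2 := Rabs_sin_le b).
  replace (1 * cos b + - (1)) with (cos b - 1) by ring.
  replace (1 * sin b + - 0) with (sin b) by ring. lra.
Qed.

Lemma Cexp_imag2 (b : R) : Cmod (Cexp (0, b) - 1 - (0, b))%C <= 2 * b ^ 2.
Proof.
  eapply Rle_trans; [apply Cmod_le_comp|]. unfold Cexp; simpl Re; simpl Im. rewrite exp_0.
  assert (H1 := Rabs_cos_sub1 b). assert (H2 := Rabs_sin_sub b).
  replace (1 * cos b + - (1) + - 0) with (cos b - 1) by ring.
  replace (1 * sin b + - 0 + - b) with (sin b - b) by ring. lra.
Qed.

Lemma Cexp_sub1 (z : C) :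
  Cmod (Cexp z - 1)%C <= 3 * Cmod z * exp (Rmax (Re z) 0).
Proof.
  rewrite Cexp_split. set (a := Re z). set (b := Im z).
  replace (RtoC (exp a) * Cexp (0, b) - 1)%C with
    (RtoC (exp a - 1) * Cexp (0, b) + (Cexp (0, b) - 1))%C
    by (rewrite RtoC_minus; ring).
  eapply Rle_trans; [apply Cmod_triangle|].
  rewrite Cmod_mult, Cmod_R, Cmod_Cexp. simpl Re. rewrite exp_0, Rmult_1_r.
  assert (H1 := Rabs_exp_sub1 a). assert (H2 := Cexp_imag1 b).
  assert (H3 := Re_le_Cmod z). assert (H4 := Im_le_Cmod z).
  fold a in H3. fold b in H4. assert (H5 := exp_Rmax_ge1 a).
  assert (H6 := Rabs_pos a).
  nra.
Qed.

Lemma Cexp_sub1_sub (z : C) :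
  Cmod (Cexp z - 1 - z)%C <= 5 * Cmod z ^ 2 * exp (Rmax (Re z) 0).
Proof.
  rewrite Cexp_split. set (a := Re z). set (b := Im z).
  replace (RtoC (exp a) * Cexp (0, b) - 1 - z)%C with
    (RtoC (exp a - 1 - a) + (RtoC (exp a - 1) * (Cexp (0, b) - 1)
      + (Cexp (0, b) - 1 - (0, b))))%C.
  2:{ replace z with (RtoC a + (0, b))%C.
      - rewrite !RtoC_minus. ring.
      - unfold a, b, RtoC. destruct z; unfold Cplus; simpl. f_equal; ring. }
  eapply Rle_trans; [apply Cmod_triangle|].
  assert (Q := Cmod_triangle (RtoC (exp a - 1) * (Cexp (0, b) - 1))
                             (Cexp (0, b) - 1 - (0, b))).
  rewrite Cmod_mult, Cmod_R in Q. rewrite Cmod_R.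
  assert (H1 := Rabs_exp_sub1 a). assert (H2 := Cexp_imag1 b).
  assert (H8 := Rabs_exp_sub1_sub a). assert (H9 := Cexp_imag2 b).
  assert (H3 := Re_le_Cmod z). assert (H4 := Im_le_Cmod z).
  fold a in H3. fold b in H4. assert (H5 := exp_Rmax_ge1 a).
  assert (H6 := Rabs_pos a). assert (H6' := Rabs_pos b).
  set (M := exp (Rmax a 0)) in *. set (Z := Cmod z) in *.
  assert (A2 : a ^ 2 <= Z ^ 2) by (rewrite <- pow2_abs; apply pow_incr; lra).
  assert (B2 : b ^ 2 <= Z ^ 2) by (rewrite <- (pow2_abs b); apply pow_incr; lra).
  assert (AB : Rabs (exp a - 1) * Cmod (Cexp (0, b) - 1)%C <= (Rabs a * M) * (2 * Rabs b)).
  { apply Rmult_le_compat; auto using Rabs_pos, Cmod_ge_0. }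
  assert (AB2 : Rabs a * Rabs b <= Z ^ 2) by nra.
  nra.
Qed.

Definition pw (x : R) (w : C) : C := RCpower x (- w)%C.

Lemma pw_exp (x : R) (w : C) : pw x w = Cexp (- (RtoC (ln x) * w))%C.
Proof. unfold pw, RCpower. f_equal. ring. Qed.

Lemma Cmod_pw (x : R) (w : C) : Cmod (pw x w) = Rpower x (- Re w).
Proof.
  rewrite pw_exp, Cmod_Cexp. unfold Rpower. f_equal.
  destruct w; simpl. ring.
Qed.

Lemma pw_RtoC (x y : R) : pw x (RtoC y) = RtoC (Rpower x (- y)).
Proof.
  rewrite pw_exp. unfold Rpower. rewrite <- RtoC_mult, <- RtoC_opp, Cexp_RtoC.
  do 2 f_equal. ring.
Qed.

Lemma pw_mult (x y : R) (w : C) :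
  0 < x -> 0 < y -> pw (x * y) w = (pw x w * pw y w)%C.
Proof.
  intros Hx Hy. rewrite !pw_exp, <- Cexp_plus, ln_mult, RtoC_plus by assumption.
  f_equal. ring.
Qed.

Lemma pw_plus (x : R) (a b : C) : pw x (a + b) = (pw x a * pw x b)%C.
Proof.
  rewrite !pw_exp, <- Cexp_plus. f_equal. ring.
Qed.

(** The step [d] of the logarithm turns [(x + 1)^-w] into [x^-w e^(-d w)]; all
    comparisons of consecutive powers rest on its size. *)
Lemma ln_succ (x : R) : 1 <= x ->
  exists d, ln (x + 1) = ln x + d /\ / (x + 1) <= d <= / x.
Proof.
  intros Hx. exists (ln (x + 1) - ln x). split; [ring|].
  assert (E : forall y, 0 < y -> ln y <= y - 1).
  { intros y Hy. destruct (Req_dec y 1) as [->|Hn]; [rewrite ln_1; lra|].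
    assert (Q := exp_ineq1_le (ln y)). rewrite exp_ln in Q; lra. }
  split.
  - assert (Q := E (x / (x + 1)) ltac:(apply Rdiv_lt_0_compat; lra)).
    unfold Rdiv in Q. rewrite ln_mult in Q; [|lra|apply Rinv_0_lt_compat; lra].
    rewrite ln_Rinv in Q by lra.
    replace (x * / (x + 1)) with (1 - / (x + 1)) in Q by (field; lra). lra.
  - assert (Q := E ((x + 1) / x) ltac:(apply Rdiv_lt_0_compat; lra)).
    unfold Rdiv in Q. rewrite ln_mult in Q; [|lra|apply Rinv_0_lt_compat; lra].
    rewrite ln_Rinv in Q by lra.
    replace ((x + 1) * / x) with (1 + / x) in Q by (field; lra). lra.
Qed.

Lemma Rpower_pos (x t : R) : 0 < Rpower x t.
Proof. unfold Rpower. apply exp_pos. Qed.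

Lemma Rpower_step_le (x t : R) : 1 <= x -> 0 <= t ->
  0 <= Rpower x (- t) - Rpower (x + 1) (- t) <= t * Rpower x (- t - 1).
Proof.
  intros Hx Ht. destruct (ln_succ x Hx) as [d [Ed [Hd1 Hd2]]].
  assert (Hd0 : 0 <= d) by (assert (0 < / (x + 1)) by (apply Rinv_0_lt_compat; lra); lra).
  unfold Rpower. rewrite Ed.
  replace (- t * (ln x + d)) with (- t * ln x + - (t * d)) by ring.
  replace ((- t - 1) * ln x) with (- t * ln x + - ln x) by ring.
  rewrite !exp_plus. rewrite (exp_Ropp (ln x)), exp_ln by lra.
  assert (P := exp_pos (- t * ln x)).
  assert (Q := exp_ineq1_le (- (t * d))).
  assert (Q2 : exp (- (t * d)) <= 1) by (rewrite <- exp_0; apply exp_le; nra).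
  split; [nra|].
  assert (t * d <= t * / x) by nra. nra.
Qed.

Lemma Rpower_step_ge (x t : R) : 1 <= x -> 0 <= t ->
  t * Rpower (x + 1) (- t - 1) <= Rpower x (- t) - Rpower (x + 1) (- t).
Proof.
  intros Hx Ht. destruct (ln_succ x Hx) as [d [Ed [Hd1 Hd2]]].
  unfold Rpower.
  replace (- t * ln x) with (- t * ln (x + 1) + t * d) by (rewrite Ed; ring).
  replace ((- t - 1) * ln (x + 1)) with (- t * ln (x + 1) + - ln (x + 1)) by ring.
  rewrite !exp_plus. rewrite (exp_Ropp (ln (x + 1))), exp_ln by lra.
  assert (P := exp_pos (- t * ln (x + 1))).
  assert (Q := exp_ineq1_le (t * d)).
  assert (t * / (x + 1) <= t * d) by nra. nra.
Qed.

Lemma INR_S_ge1 (n : nat) : 1 <= INR (S n).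
Proof. rewrite S_INR. assert (H := pos_INR n). lra. Qed.

(** The integral test, with the first term kept apart so that it can be used with
    explicit numbers. *)
Lemma Rpower_tail_sharp (t : R) (n N : nat) : 1 < t -> (1 <= n)%nat ->
  rsum (seq 0 N) (fun i => Rpower (INR (n + i)) (- t))
    <= Rpower (INR n) (- t) + / (t - 1) * Rpower (INR n) (1 - t).
Proof.
  intros Ht Hn.
  assert (Hn1 : 1 <= INR n) by (destruct n; [lia|apply INR_S_ge1]).
  assert (Hi : 0 < / (t - 1)) by (apply Rinv_0_lt_compat; lra).
  assert (P0 := Rpower_pos (INR n) (1 - t)). assert (P2 := Rpower_pos (INR n) (- t)).
  destruct N as [|N]; [unfold rsum; simpl; nra|].
  assert (H : rsum (seq 0 (S N)) (fun i => Rpower (INR (n + i)) (- t)) <=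
     Rpower (INR n) (- t)
       + / (t - 1) * (Rpower (INR n) (1 - t) - Rpower (INR (n + N)) (1 - t))).
  { induction N as [|N IH].
    - unfold rsum; simpl. rewrite Nat.add_0_r. lra.
    - rewrite rsum_seq_S.
      assert (Hx : 1 <= INR (n + N)).
      { rewrite plus_INR. assert (Q := pos_INR N). lra. }
      assert (Q := Rpower_step_ge (INR (n + N)) (t - 1) Hx ltac:(lra)).
      replace (INR (n + S N)) with (INR (n + N) + 1)
        by (rewrite <- S_INR; f_equal; lia).
      replace (- (t - 1) - 1) with (- t) in Q by ring.
      replace (- (t - 1)) with (1 - t) in Q by ring.
      assert (Q' : Rpower (INR (n + N) + 1) (- t) <=
        / (t - 1) * (Rpower (INR (n + N)) (1 - t) - Rpower (INR (n + N) + 1) (1 - t))).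
      { apply Rmult_le_reg_l with (t - 1); [lra|].
        rewrite <- Rmult_assoc, Rinv_r, Rmult_1_l by lra. exact Q. }
      lra. }
  assert (P1 := Rpower_pos (INR (n + N)) (1 - t)). nra.
Qed.

Lemma Rpower_tail (t : R) (n N : nat) : 1 < t -> (1 <= n)%nat ->
  rsum (seq 0 N) (fun i => Rpower (INR (n + i)) (- t))
    <= (1 + / (t - 1)) * Rpower (INR n) (1 - t).
Proof.
  intros Ht Hn. eapply Rle_trans; [now apply Rpower_tail_sharp|].
  assert (Hn1 : 1 <= INR n) by (destruct n; [lia|apply INR_S_ge1]).
  assert (Rpower (INR n) (- t) <= Rpower (INR n) (1 - t)) by (apply Rle_Rpower; lra).
  lra.
Qed.

Lemma ex_series_Rpower (t : R) (n : nat) : 1 < t -> (1 <= n)%nat ->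
  ex_series (fun i => Rpower (INR (n + i)) (- t)).
Proof.
  intros Ht Hn. eapply ex_series_bound.
  - intros i. left; apply Rpower_pos.
  - intros N. apply Rpower_tail; assumption.
Qed.

Lemma Series_Rpower (t : R) (n : nat) : 1 < t -> (1 <= n)%nat ->
  Series (fun i => Rpower (INR (n + i)) (- t)) <= (1 + / (t - 1)) * Rpower (INR n) (1 - t).
Proof.
  intros Ht Hn. apply Series_le_bound.
  - intros i. left; apply Rpower_pos.
  - intros N. apply Rpower_tail; assumption.
Qed.

Lemma is_lim_Rpower_0 (t : R) (n : nat) : 0 < t ->
  is_lim_seq (fun X => Rpower (INR (n + X)) (- t)) 0.
Proof.
  intros Ht. apply is_lim_seq_eps. intros e He.
  (* x^(-t) < e as soon as x > e^(-1/t) *)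
  destruct (INR_unbounded (Rmax 1 (exp (- ln e / t)))) as [N HN].
  exists N. intros k Hk. rewrite Rminus_0_r, Rabs_pos_eq by (left; apply Rpower_pos).
  assert (H : Rmax 1 (exp (- ln e / t)) < INR (n + k)).
  { eapply Rlt_le_trans; [exact HN|]. apply le_INR. lia. }
    assert (H2 := Rmax_r 1 (exp (- ln e / t))).
  unfold Rpower. rewrite <- (exp_ln e He) at 1. apply exp_increasing.
  assert (H3 : - ln e / t < ln (INR (n + k))).
  { rewrite <- (ln_exp (- ln e / t)). apply ln_increasing; [apply exp_pos|lra]. }
  assert (H4 : - ln e < t * ln (INR (n + k))).
  { apply Rmult_lt_compat_l with (r := t) in H3; [|exact Ht].
    replace (t * (- ln e / t)) with (- ln e) in H3 by (field; lra). exact H3. }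
  lra.
Qed.

(** Abel summation trades [u] for its partial sums, at the price of one derivative of
    the power; the bound is stated at [S X] so that it also makes sense for [X = 0]. *)
Lemma abel_ex_series (u : nat -> R) (C0 k t : R) :
  (forall n, 0 <= u n) -> 0 <= k -> k < t ->
  (forall X, rsum (seq 0 X) (fun i => u (S i)) <= C0 * Rpower (INR (S X)) k) ->
  ex_series (fun i => u (S i) * Rpower (INR (S i)) (- t)).
Proof.
  intros Hu Hk Ht HU.
  assert (HC : 0 <= C0).
  { specialize (HU 0%nat). unfold rsum in HU. simpl in HU.
    assert (P := Rpower_pos 1 k). nra. }
  set (U := fun X => rsum (seq 0 X) (fun i => u (S i))) in *.
  assert (HU0 : forall X, 0 <= U X) by (intros; apply rsum_nonneg; auto).
  apply ex_series_bound with
    (C0 * Rpower 2 k * t * ((1 + / (t - k)) * Rpower (INR 1) (1 - (t - k + 1))) + C0).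
  { intros i. apply Rmult_le_pos; [apply Hu|left; apply Rpower_pos]. }
  intros X.
  assert (E : rsum (seq 0 X) (fun i => u (S i) * Rpower (INR (S i)) (- t)) =
    rsum (seq 0 X) (fun i => U (S i) * (Rpower (INR (S i)) (- t) - Rpower (INR (S i) + 1) (- t)))
    + U X * Rpower (INR (S X)) (- t)).
  { induction X as [|X IH]; [unfold U, rsum; simpl; ring|].
    rewrite !rsum_seq_S, IH.
    assert (HS : U (S X) = U X + u (S X)) by (unfold U; now rewrite rsum_seq_S).
    rewrite HS, (S_INR (S X)). ring. }
  rewrite E. clear E.
  assert (H1 : rsum (seq 0 X) (fun i => U (S i) * (Rpower (INR (S i)) (- t) - Rpower (INR (S i) + 1) (- t)))
    <= rsum (seq 0 X) (fun i => C0 * Rpower 2 k * t * Rpower (INR (1 + i)) (- (t - k + 1)))).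
  { apply rsum_le. intros i _. assert (Hi := INR_S_ge1 i).
    destruct (Rpower_step_le (INR (S i)) t Hi ltac:(lra)) as [S1 S2].
    assert (Hb : U (S i) <= C0 * (Rpower 2 k * Rpower (INR (S i)) k)).
    { eapply Rle_trans; [apply HU|]. apply Rmult_le_compat_l; [exact HC|].
      rewrite Rpower_mult_distr by lra. apply Rle_Rpower_l; [exact Hk|].
      rewrite (S_INR (S i)). lra. }
    change (1 + i)%nat with (S i).
    replace (- (t - k + 1)) with (k + (- t - 1)) by ring. rewrite Rpower_plus.
    apply Rle_trans with ((C0 * (Rpower 2 k * Rpower (INR (S i)) k)) *
      (t * Rpower (INR (S i)) (- t - 1))).
    - apply Rmult_le_compat; auto.
    - right; ring. }
  rewrite rsum_scal in H1.
  assert (H2 := Rpower_tail (t - k + 1) 1 X ltac:(lra) (le_n _)).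
  replace (t - k + 1 - 1) with (t - k) in H2 by ring.
  assert (H3 : U X * Rpower (INR (S X)) (- t) <= C0).
  { apply Rle_trans with (C0 * Rpower (INR (S X)) k * Rpower (INR (S X)) (- t)).
    - apply Rmult_le_compat_r; [left; apply Rpower_pos|apply HU].
    - rewrite Rmult_assoc, <- Rpower_plus.
      assert (Rpower (INR (S X)) (k + - t) <= 1).
      { rewrite <- (Rpower_O (INR (S X))) by (assert (Q := INR_S_ge1 X); lra).
        apply Rle_Rpower; [apply INR_S_ge1|lra]. }
      nra. }
  assert (0 <= C0 * Rpower 2 k * t).
  { assert (P := Rpower_pos 2 k). apply Rmult_le_pos; [apply Rmult_le_pos|]; lra. }
  nra.
Qed.

Lemma Rpower_2 (x : R) : 0 < x -> Rpower x 2 = x ^ 2.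
Proof. intros Hx. replace 2 with (INR 2) at 1 by (simpl; ring). now apply Rpower_pow. Qed.

(** * Second-order jets and complex differentiability *)

(** Bounds for the value, the derivative and the quadratic remainder of [f] at [z0], scaled
    to the radius [r]. Up to constants these are the Cauchy estimates of a function
    bounded by [A] on the disc of radius [r]. *)
Definition jet (f : C -> C) (z0 : C) (r A : R) : Prop :=
  Cmod (f z0) <= A /\
  exists c : C, Cmod c * r <= A /\
    forall h : C, Cmod h <= r ->
      Cmod (f (z0 + h) - f z0 - c * h)%C * r ^ 2 <= A * Cmod h ^ 2.

Lemma jet_ge0 (f : C -> C) (z0 : C) (r A : R) : jet f z0 r A -> 0 <= A.
Proof. intros [H _]. eapply Rle_trans; [apply Cmod_ge_0|exact H]. Qed.

Lemma jet_le (f : C -> C) (z0 : C) (r A B : R) :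
  A <= B -> jet f z0 r A -> jet f z0 r B.
Proof.
  intros HAB [H0 [c [H1 H2]]]. split; [lra|]. exists c. split; [lra|].
  intros h Hh. eapply Rle_trans; [apply H2; exact Hh|].
  nra.
Qed.

Lemma jet_ext (f g : C -> C) (z0 : C) (r A : R) :
  (forall z, f z = g z) -> jet f z0 r A -> jet g z0 r A.
Proof.
  intros E [H0 [c [H1 H2]]]. split; [now rewrite <- E|].
  exists c. split; [exact H1|]. intros h Hh. rewrite <- !E. auto.
Qed.

Lemma jet_const (a z0 : C) (r : R) : 0 < r -> jet (fun _ => a) z0 r (Cmod a).
Proof.
  intros Hr. split; [lra|]. exists (RtoC 0). split.
  - rewrite Cmod_0. assert (Q := Cmod_ge_0 a). lra.
  - intros h _. replace (a - a - 0 * h)%C with (RtoC 0) by ring.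
    rewrite Cmod_0. assert (Q := Cmod_ge_0 a). assert (Q2 := pow2_ge_0 (Cmod h)). nra.
Qed.

Lemma jet_id (z0 : C) (r : R) : 0 < r -> jet (fun z => z) z0 r (Cmod z0 + r).
Proof.
  intros Hr. assert (Q := Cmod_ge_0 z0). split; [lra|]. exists (RtoC 1). split.
  - rewrite Cmod_1. lra.
  - intros h _. replace (z0 + h - z0 - 1 * h)%C with (RtoC 0) by ring.
    rewrite Cmod_0. assert (Q2 := pow2_ge_0 (Cmod h)). nra.
Qed.

Lemma jet_plus (f g : C -> C) (z0 : C) (r A B : R) :
  jet f z0 r A -> jet g z0 r B -> jet (fun z => f z + g z)%C z0 r (A + B).
Proof.
  intros [H0 [c [H1 H2]]] [K0 [d [K1 K2]]]. split.
  - eapply Rle_trans; [apply Cmod_triangle|]. lra.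
  - exists (c + d)%C. split.
    + destruct (Rle_dec 0 r) as [Hr|Hr].
      * assert (Q := Cmod_triangle c d). nra.
      * assert (Q0 := Cmod_ge_0 (c + d)). assert (Q1 := Cmod_ge_0 (f z0)).
        assert (Q2 := Cmod_ge_0 (g z0)). nra.
    + intros h Hh. specialize (H2 h Hh). specialize (K2 h Hh).
      replace (f (z0 + h) + g (z0 + h) - (f z0 + g z0) - (c + d) * h)%C with
        ((f (z0 + h) - f z0 - c * h) + (g (z0 + h) - g z0 - d * h))%C by ring.
      assert (Q := Cmod_triangle (f (z0 + h) - f z0 - c * h)%C (g (z0 + h) - g z0 - d * h)%C).
      nra.
Qed.

Lemma jet_mult (f g : C -> C) (z0 : C) (r A B : R) : 0 < r ->
  jet f z0 r A -> jet g z0 r B -> jet (fun z => f z * g z)%C z0 r (6 * A * B).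
Proof.
  intros Hr Hf Hg. assert (HA := jet_ge0 _ _ _ _ Hf). assert (HB := jet_ge0 _ _ _ _ Hg).
  assert (HAB : 0 <= A * B) by nra.
  destruct Hf as [H0 [c [H1 H2]]], Hg as [K0 [d [K1 K2]]].
  assert (F0 := Cmod_ge_0 (f z0)). assert (G0 := Cmod_ge_0 (g z0)).
  split.
  { rewrite Cmod_mult. assert (Cmod (f z0) * Cmod (g z0) <= A * B) by nra. lra. }
  exists (c * g z0 + f z0 * d)%C. split.
  { eapply Rle_trans with ((Cmod c * r) * Cmod (g z0) + Cmod (f z0) * (Cmod d * r)).
    - assert (Q := Cmod_triangle (c * g z0)%C (f z0 * d)%C). rewrite !Cmod_mult in Q. nra.
    - assert (Cmod c * r * Cmod (g z0) <= A * B) by nra.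
      assert (Cmod (f z0) * (Cmod d * r) <= A * B) by nra.
      lra. }
  intros h Hh. specialize (H2 h Hh). specialize (K2 h Hh).
  set (F := (f (z0 + h) - f z0 - c * h)%C) in *.
  set (G := (g (z0 + h) - g z0 - d * h)%C) in *.
  replace (f (z0 + h) * g (z0 + h) - f z0 * g z0 - (c * g z0 + f z0 * d) * h)%C
    with (f z0 * G + g z0 * F + (c * h + F) * (d * h + G))%C by (unfold F, G; ring).
  assert (Hh0 := Cmod_ge_0 h).
  (* increments are at most [2 A |h| / r] *)
  assert (I1 : Cmod (c * h + F)%C * r <= 2 * A * Cmod h).
  { assert (Q := Cmod_triangle (c * h)%C F). rewrite Cmod_mult in Q.
    assert (Q1 : Cmod F * r <= A * Cmod h).
    { apply Rmult_le_reg_r with r; [exact Hr|].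
      assert (A * Cmod h * Cmod h <= A * Cmod h * r) by (apply Rmult_le_compat_l; [nra|exact Hh]).
      nra. }
    nra. }
  assert (I2 : Cmod (d * h + G)%C * r <= 2 * B * Cmod h).
  { assert (Q := Cmod_triangle (d * h)%C G). rewrite Cmod_mult in Q.
    assert (Q1 : Cmod G * r <= B * Cmod h).
    { apply Rmult_le_reg_r with r; [exact Hr|].
      assert (B * Cmod h * Cmod h <= B * Cmod h * r) by (apply Rmult_le_compat_l; [nra|exact Hh]).
      nra. }
    nra. }
  assert (I3 : (Cmod (c * h + F)%C * r) * (Cmod (d * h + G)%C * r) <=
               (2 * A * Cmod h) * (2 * B * Cmod h)).
  { apply Rmult_le_compat; auto; apply Rmult_le_pos; try apply Cmod_ge_0; lra. }
  assert (I4 : Cmod (f z0) * (Cmod G * r ^ 2) <= A * (B * Cmod h ^ 2)).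
  { apply Rmult_le_compat; auto. apply Rmult_le_pos; [apply Cmod_ge_0|apply pow2_ge_0]. }
  assert (I5 : Cmod (g z0) * (Cmod F * r ^ 2) <= B * (A * Cmod h ^ 2)).
  { apply Rmult_le_compat; auto. apply Rmult_le_pos; [apply Cmod_ge_0|apply pow2_ge_0]. }
  assert (T1 := Cmod_triangle (f z0 * G + g z0 * F)%C ((c * h + F) * (d * h + G))%C).
  assert (T2 := Cmod_triangle (f z0 * G)%C (g z0 * F)%C). rewrite !Cmod_mult in *.
  assert (R2 := pow2_ge_0 r).
  apply Rle_trans with ((Cmod (f z0) * Cmod G + Cmod (g z0) * Cmod F
    + Cmod (c * h + F)%C * Cmod (d * h + G)%C) * r ^ 2).
  { apply Rmult_le_compat_r; [exact R2|lra]. }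
  nra.
Qed.

Lemma jet_scal (a : C) (f : C -> C) (z0 : C) (r A : R) :
  jet f z0 r A -> jet (fun z => a * f z)%C z0 r (Cmod a * A).
Proof.
  intros [H0 [c [H1 H2]]]. assert (Q := Cmod_ge_0 a). split.
  - rewrite Cmod_mult. nra.
  - exists (a * c)%C. split; [rewrite Cmod_mult; nra|].
    intros h Hh. specialize (H2 h Hh).
    replace (a * f (z0 + h) - a * f z0 - a * c * h)%C with
      (a * (f (z0 + h) - f z0 - c * h))%C by ring.
    rewrite Cmod_mult. nra.
Qed.

Lemma jet_opp (f : C -> C) (z0 : C) (r A : R) :
  jet f z0 r A -> jet (fun z => - f z)%C z0 r A.
Proof.
  intros H. apply (jet_scal (- RtoC 1)%C) in H.
  rewrite Cmod_opp, Cmod_1, Rmult_1_l in H.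
  eapply jet_ext; [|exact H]. intros z. simpl. ring.
Qed.

Lemma jet_affine (a b : C) (f : C -> C) (z0 : C) (r A : R) :
  jet f (a * z0 + b)%C (Cmod a * r) A -> 0 < Cmod a ->
  jet (fun z => f (a * z + b))%C z0 r A.
Proof.
  intros [H0 [c [H1 H2]]] Ha. split; [exact H0|].
  exists (c * a)%C. split; [rewrite Cmod_mult; lra|].
  intros h Hh.
  assert (Hah : Cmod (a * h) <= Cmod a * r) by (rewrite Cmod_mult; nra).
  specialize (H2 (a * h)%C Hah).
  replace (a * (z0 + h) + b)%C with (a * z0 + b + a * h)%C by ring.
  replace (c * a * h)%C with (c * (a * h))%C by ring.
  rewrite Cmod_mult in H2.
  assert (P : 0 < Cmod a ^ 2) by nra.
  apply Rmult_le_reg_l with (Cmod a ^ 2); [exact P|].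
  replace (Cmod a ^ 2 * (A * Cmod h ^ 2)) with (A * (Cmod a * Cmod h) ^ 2) by ring.
  eapply Rle_trans; [|exact H2]. right; ring.
Qed.

(** The derivatives are summable by their bounds, and the remainder of the sum is the
    sum of the remainders. *)
Lemma jet_series (f : nat -> C -> C) (z0 : C) (r : R) (A : nat -> R) : 0 < r ->
  (forall i, jet (f i) z0 r (A i)) -> ex_series A ->
  jet (fun z => CSeries (fun i => f i z)) z0 r (Series A).
Proof.
  intros Hr Hf HA.
  pose (c := fun i => proj1_sig (constructive_indefinite_description _ (proj2 (Hf i)))).
  assert (Hc : forall i, Cmod (c i) * r <= A i /\ forall h : C, Cmod h <= r ->
      Cmod (f i (z0 + h) - f i z0 - c i * h)%C * r ^ 2 <= A i * Cmod h ^ 2).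
  { intros i. unfold c.
    destruct (constructive_indefinite_description _ (proj2 (Hf i))) as [d Hd]. exact Hd. }
  clearbody c.
  assert (Hr2 : 0 < r ^ 2) by nra.
  assert (Hscal : forall k, ex_series (fun i => A i * k)) by (intros k; now apply ex_series_scal_r).
  assert (Hc' : forall i, Cmod (c i) <= A i * / r).
  { intros i. apply Rmult_le_reg_r with r; [exact Hr|].
    rewrite Rmult_assoc, Rinv_l, Rmult_1_r by lra. apply Hc. }
  assert (Hrem : forall h, Cmod h <= r -> forall i,
     Cmod (f i (z0 + h) - f i z0 - c i * h)%C <= A i * (Cmod h ^ 2 * / r ^ 2)).
  { intros h Hh i. apply Rmult_le_reg_r with (r ^ 2); [exact Hr2|].
    replace (A i * (Cmod h ^ 2 * / r ^ 2) * r ^ 2) with (A i * Cmod h ^ 2) by (field; lra).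
    now apply Hc. }
  split.
  { apply Cmod_CSeries; [intros i; apply Hf|exact HA]. }
  exists (CSeries c). split.
  { apply Rmult_le_reg_r with (/ r); [now apply Rinv_0_lt_compat|].
    rewrite Rmult_assoc, Rinv_r, Rmult_1_r by lra.
    rewrite <- Series_scal_r. now apply Cmod_CSeries. }
  intros h Hh.
  assert (E : (CSeries (fun i => f i (z0 + h)) - CSeries (fun i => f i z0) - CSeries c * h)%C
     = CSeries (fun i => f i (z0 + h) - f i z0 - c i * h)%C).
  { assert (S0 : csums (fun i => f i z0) (CSeries (fun i => f i z0))).
    { apply CSeries_correct. eapply ex_series_dominated; [|exact HA].
      intros i; split; [apply Cmod_ge_0|apply Hf]. }
    assert (S1 : csums c (CSeries c)).
    { apply CSeries_correct. eapply ex_series_dominated; [|apply (Hscal (/ r))].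
      intros i; split; [apply Cmod_ge_0|apply Hc']. }
    assert (S2 : csums (fun i => f i (z0 + h) - f i z0 - c i * h)%C
       (CSeries (fun i => f i (z0 + h) - f i z0 - c i * h)%C)).
    { apply CSeries_correct. eapply ex_series_dominated; [|apply (Hscal (Cmod h ^ 2 * / r ^ 2))].
      intros i; split; [apply Cmod_ge_0|now apply Hrem]. }
    assert (S3 : csums (fun i => f i (z0 + h)%C) (CSeries (fun i => f i (z0 + h)%C))).
    { apply CSeries_correct.
      apply ex_series_dominated with
        (fun i => A i * (Cmod h ^ 2 * / r ^ 2) + (A i + A i * / r * Cmod h)).
      - intros i; split; [apply Cmod_ge_0|].
        replace (f i (z0 + h)%C) with ((f i (z0 + h) - f i z0 - c i * h) + (f i z0 + c i * h))%C by ring.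
        eapply Rle_trans; [apply Cmod_triangle|]. apply Rplus_le_compat; [now apply Hrem|].
        eapply Rle_trans; [apply Cmod_triangle|]. apply Rplus_le_compat; [apply Hf|].
        rewrite Cmod_mult. apply Rmult_le_compat_r; [apply Cmod_ge_0|apply Hc'].
      - apply (ex_series_plus (fun i => A i * (Cmod h ^ 2 * / r ^ 2))); [apply Hscal|].
        apply (ex_series_plus A); [exact HA|].
        apply (ex_series_scal_r (Cmod h)). apply Hscal. }
    assert (S4 := csums_plus _ _ _ _ S2 (csums_plus _ _ _ _ S0 (csums_scal h _ _ S1))).
    apply (csums_ext _ (fun i => f i (z0 + h)%C)) in S4; [|intros i; cbv beta; ring].
    assert (S5 := csums_unique _ _ _ S3 S4).
    rewrite S5. ring. }
  rewrite E.
  apply Rle_trans with (Series (fun i => A i * (Cmod h ^ 2 * / r ^ 2)) * r ^ 2).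
  - apply Rmult_le_compat_r; [lra|]. apply Cmod_CSeries; auto.
  - rewrite Series_scal_r. right. field. lra.
Qed.

(** The qualitative form of a jet: no relation between the constants is kept, which makes
    inverses easy. *)
Definition quad (f : C -> C) (z0 : C) : Prop :=
  exists (c : C) (M d : R), 0 < d /\ 0 <= M /\
    forall h, Cmod h < d -> Cmod (f (z0 + h) - f z0 - c * h)%C <= M * Cmod h ^ 2.

Lemma jet_quad (f : C -> C) (z0 : C) (r A : R) : 0 < r -> jet f z0 r A -> quad f z0.
Proof.
  intros Hr Hj. assert (HA := jet_ge0 _ _ _ _ Hj). destruct Hj as [_ [c [_ H]]].
  assert (Hr2 : 0 < r ^ 2) by nra.
  exists c, (A / r ^ 2), r. split; [exact Hr|]. split.
  { apply Rmult_le_pos; [exact HA|]. left; now apply Rinv_0_lt_compat. }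
  intros h Hh. apply Rmult_le_reg_r with (r ^ 2); [exact Hr2|].
  replace (A / r ^ 2 * Cmod h ^ 2 * r ^ 2) with (A * Cmod h ^ 2) by (field; lra).
  apply H. lra.
Qed.

Lemma quad_ex_derive (f : C -> C) (z0 : C) :
  quad f z0 -> @ex_derive C_AbsRing C_NormedModule f z0.
Proof.
  intros [c [M [d [Hd [HM H]]]]]. exists c. split; [apply is_linear_scal_l|].
  intros x Hx.
  apply (@is_filter_lim_locally_unique C_AbsRing (AbsRing_NormedModule C_AbsRing)) in Hx.
  subst x.
  intros eps.
  assert (He : 0 < Rmin d (eps / (M + 1))).
  { apply Rmin_pos; [exact Hd|]. apply Rdiv_lt_0_compat; [apply cond_pos|lra]. }
  exists (mkposreal _ He).
  change (forall y : C, Cmod (y - z0)%C < Rmin d (eps / (M + 1)) ->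
    Cmod (f y - f z0 - (y - z0) * c)%C <= eps * Cmod (y - z0)%C).
  intros y Hy.
  assert (H1 := Rmin_l d (eps / (M + 1))). assert (H2 := Rmin_r d (eps / (M + 1))).
  assert (H3 := H (y - z0)%C ltac:(lra)).
  replace (z0 + (y - z0))%C with y in H3 by ring.
  replace ((y - z0) * c)%C with (c * (y - z0))%C by ring.
  eapply Rle_trans; [exact H3|].
  assert (Q := Cmod_ge_0 (y - z0)%C).
  assert (Cmod (y - z0)%C * (M + 1) <= eps).
  { apply Rmult_le_reg_r with (/ (M + 1)); [apply Rinv_0_lt_compat; lra|].
    rewrite Rmult_assoc, Rinv_r, Rmult_1_r by lra. unfold Rdiv in H2. lra. }
  nra.
Qed.

Lemma quad_mult (f g : C -> C) (z0 : C) :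
  quad f z0 -> quad g z0 -> quad (fun z => f z * g z)%C z0.
Proof.
  intros [c [M [d [Hd [HM H]]]]] [c' [M' [d' [Hd' [HM' H']]]]].
  (* any common radius turns both expansions into jets *)
  set (r := Rmin d d' / 2).
  assert (Hr : 0 < r) by (unfold r; assert (0 < Rmin d d') by (now apply Rmin_pos); lra).
  assert (Hrd : r < d) by (unfold r; assert (Q := Rmin_l d d'); assert (0 < Rmin d d') by (now apply Rmin_pos); lra).
  assert (Hrd' : r < d') by (unfold r; assert (Q := Rmin_r d d'); assert (0 < Rmin d d') by (now apply Rmin_pos); lra).
  assert (mk : forall f c M, 0 <= M ->
     (forall h, Cmod h <= r -> Cmod (f (z0 + h) - f z0 - c * h)%C <= M * Cmod h ^ 2) ->
     exists A, jet f z0 r A).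
  { clear - Hr. intros f c M HM H. exists (Cmod (f z0) + Cmod c * r + M * r ^ 2).
    assert (Q1 := Cmod_ge_0 (f z0)). assert (Q2 := Cmod_ge_0 c).
    assert (Q3 : 0 <= Cmod c * r) by nra. assert (Q4 : 0 <= M * r ^ 2) by nra.
    split; [lra|]. exists c. split; [lra|]. intros h Hh. specialize (H h Hh).
    apply Rle_trans with (M * Cmod h ^ 2 * r ^ 2); nra. }
  destruct (mk f c M HM) as [A HA]; [intros; apply H; lra|].
  destruct (mk g c' M' HM') as [B HB]; [intros; apply H'; lra|].
  apply (jet_quad _ _ r (6 * A * B)); [exact Hr|]. now apply jet_mult.
Qed.

Lemma quad_inv (f : C -> C) (z0 : C) :
  f z0 <> RtoC 0 -> quad f z0 -> quad (fun z => / f z)%C z0.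
Proof.
  intros Hf0 [c [M [d [Hd [HM H]]]]].
  assert (P : 0 < Cmod (f z0)) by now apply Cmod_gt_0.
  (* [L] bounds the difference quotients of [f], so on radius [r] the values of [f] keep
     at least half of their size *)
  set (L := Cmod c + M + 1).
  assert (Hc0 := Cmod_ge_0 c).
  assert (HL : 0 < L) by (unfold L; lra).
  set (r := Rmin (Rmin d 1) (Cmod (f z0) / (2 * L))).
  assert (Hr : 0 < r).
  { repeat apply Rmin_pos; try lra. apply Rdiv_lt_0_compat; lra. }
  assert (Hr1 : r <= d) by (eapply Rle_trans; [apply Rmin_l|apply Rmin_l]).
  assert (Hr2 : r <= 1) by (eapply Rle_trans; [apply Rmin_l|apply Rmin_r]).
  assert (Hr3 : r * L <= Cmod (f z0) / 2).
  { apply Rle_trans with (Cmod (f z0) / (2 * L) * L).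
    - apply Rmult_le_compat_r; [lra|apply Rmin_r].
    - right; field; lra. }
  exists (- c / (f z0 * f z0))%C,
    ((Cmod (f z0) * M + Cmod c ^ 2 + Cmod c * M) * (2 / Cmod (f z0) ^ 3)), r.
  split; [exact Hr|]. split.
  { apply Rmult_le_pos.
    - assert (0 <= Cmod (f z0) * M) by nra. assert (0 <= Cmod c * M) by nra.
      assert (Q := pow2_ge_0 (Cmod c)). lra.
    - apply Rmult_le_pos; [lra|]. left. apply Rinv_0_lt_compat. now apply pow_lt. }
  intros h Hh. specialize (H h ltac:(lra)).
  set (R0 := (f (z0 + h) - f z0 - c * h)%C) in *.
  assert (Hh0 := Cmod_ge_0 h).
  assert (Hh2 : Cmod h ^ 2 <= Cmod h) by nra.
  assert (Hlow : Cmod (f z0) / 2 <= Cmod (f (z0 + h)%C)).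
  { assert (T := Cmod_triangle (f (z0 + h))%C (- (c * h + R0))%C).
    replace (f (z0 + h) + - (c * h + R0))%C with (f z0) in T by (unfold R0; ring).
    rewrite Cmod_opp in T. assert (T2 := Cmod_triangle (c * h)%C R0). rewrite Cmod_mult in T2.
    assert (Cmod c * Cmod h + Cmod R0 <= L * Cmod h) by (unfold L; nra).
    assert (L * Cmod h <= L * r) by nra. lra. }
  assert (Hfh : f (z0 + h)%C <> RtoC 0) by (apply Cmod_gt_0; lra).
  replace (/ f (z0 + h) - / f z0 - - c / (f z0 * f z0) * h)%C with
    ((- (f z0 * R0) + (c * c * (h * h) + c * h * R0)) * / (f z0 * f z0 * f (z0 + h)))%C.
  2:{ unfold R0. field. split; assumption. }
  rewrite Cmod_mult, Cmod_inv by (repeat apply Cmult_neq_0; assumption).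
  rewrite !Cmod_mult.
  assert (Hnum : Cmod (- (f z0 * R0) + (c * c * (h * h) + c * h * R0))%C <=
     (Cmod (f z0) * M + Cmod c ^ 2 + Cmod c * M) * Cmod h ^ 2).
  { eapply Rle_trans; [apply Cmod_triangle|].
    assert (T2 := Cmod_triangle (c * c * (h * h))%C (c * h * R0)%C).
    rewrite Cmod_opp. rewrite !Cmod_mult in T2. rewrite Cmod_mult.
    assert (N2 : Cmod c * Cmod h * Cmod R0 <= Cmod c * 1 * (M * Cmod h ^ 2)).
    { apply Rmult_le_compat; [nra|apply Cmod_ge_0| |exact H].
      apply Rmult_le_compat_l; [exact Hc0|lra]. }
    nra. }
  assert (Hden : / (Cmod (f z0) * Cmod (f z0) * Cmod (f (z0 + h)%C)) <= 2 / Cmod (f z0) ^ 3).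
  { replace (2 / Cmod (f z0) ^ 3) with (/ (Cmod (f z0) * Cmod (f z0) * (Cmod (f z0) / 2))).
    - apply Rinv_le_contravar; [repeat apply Rmult_lt_0_compat; lra|]. apply Rmult_le_compat_l; [nra|exact Hlow].
    - field. lra. }
  apply Rle_trans with ((Cmod (f z0) * M + Cmod c ^ 2 + Cmod c * M) * Cmod h ^ 2 * (2 / Cmod (f z0) ^ 3)).
  - apply Rmult_le_compat; [apply Cmod_ge_0| |exact Hnum|exact Hden].
    left. apply Rinv_0_lt_compat. apply Rmult_lt_0_compat; [nra|]. lra.
  - right; ring.
Qed.

Lemma quad_affine (f : C -> C) (a b z0 : C) :
  quad f (a * z0 + b)%C -> quad (fun z => f (a * z + b)%C) z0.
Proof.
  intros [c [M [d [Hd [HM H]]]]].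
  assert (Ha := Cmod_ge_0 a).
  exists (c * a)%C, (M * Cmod a ^ 2), (d / (Cmod a + 1)). split; [|split].
  - apply Rdiv_lt_0_compat; lra.
  - apply Rmult_le_pos; [lra|apply pow2_ge_0].
  - intros h Hh.
    assert (Hah : Cmod (a * h) < d).
    { rewrite Cmod_mult. apply Rmult_lt_compat_r with (r := Cmod a + 1) in Hh; [|lra].
      replace (d / (Cmod a + 1) * (Cmod a + 1)) with d in Hh by (field; lra). nra. }
    specialize (H _ Hah).
    replace (a * (z0 + h) + b)%C with (a * z0 + b + a * h)%C by ring.
    replace (c * a * h)%C with (c * (a * h))%C by ring.
    rewrite Cmod_mult in H. eapply Rle_trans; [exact H|]. right; ring.
Qed.

(** * Tails of Dirichlet series *)

Lemma Cexp_sub1_le (z : C) (M : R) : Re z <= M -> 0 <= M ->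
  Cmod (Cexp z - 1)%C <= 3 * Cmod z * exp M.
Proof.
  intros H1 H2. eapply Rle_trans; [apply Cexp_sub1|].
  apply Rmult_le_compat_l; [assert (Q := Cmod_ge_0 z); lra|].
  apply exp_le. now apply Rmax_lub.
Qed.

Lemma Cexp_sub1_sub_le (z : C) (M : R) : Re z <= M -> 0 <= M ->
  Cmod (Cexp z - 1 - z)%C <= 5 * Cmod z ^ 2 * exp M.
Proof.
  intros H1 H2. eapply Rle_trans; [apply Cexp_sub1_sub|].
  apply Rmult_le_compat_l; [assert (Q := pow2_ge_0 (Cmod z)); lra|].
  apply exp_le. now apply Rmax_lub.
Qed.

Lemma Re_opp_scal_le (d : R) (h : C) : 0 <= d -> Re (- (RtoC d * h))%C <= d * Cmod h.
Proof.
  intros Hd. assert (H := Re_le_Cmod h).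
  assert (H2 := Rle_abs (- Re h)). rewrite Rabs_Ropp in H2.
  replace (Re (- (RtoC d * h))%C) with (d * (- Re h)) by (destruct h; simpl; ring).
  apply Rmult_le_compat_l; lra.
Qed.

Lemma Re_opp_scal (d : R) (z : C) : Re (- (RtoC d * z))%C = - (d * Re z).
Proof. destruct z; simpl; ring. Qed.

Lemma Cmod_opp_scal (d : R) (h : C) : 0 <= d -> Cmod (- (RtoC d * h))%C = d * Cmod h.
Proof. intros Hd. now rewrite Cmod_opp, Cmod_mult, Cmod_R, Rabs_pos_eq. Qed.

Lemma exp_ge_sqr (y : R) : 0 <= y -> y ^ 2 <= 4 * exp y.
Proof.
  intros Hy. assert (Q := exp_ineq1_le (y / 2)).
  replace (exp y) with (exp (y / 2) * exp (y / 2)) by (rewrite <- exp_plus; f_equal; lra).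
  nra.
Qed.

Lemma ln_ge_0 (x : R) : 1 <= x -> 0 <= ln x.
Proof.
  intros [H|H]; [|rewrite <- H, ln_1; lra].
  left. rewrite <- ln_1. apply ln_increasing; lra.
Qed.

(** Derivatives of [x^-w] bring factors [ln x]; giving up [2 r] in the exponent absorbs
    them, since [y^2 e^-y] is bounded for [y = r ln x]. *)
Lemma jet_pw (x k r : R) (z0 : C) : 1 <= x -> 0 < r -> k + 2 * r <= Re z0 ->
  jet (pw x) z0 r (20 * Rpower x (- k)).
Proof.
  intros Hx Hr Hz. assert (Hl := ln_ge_0 x Hx). set (l := ln x) in *.
  assert (P := Rpower_pos x (- k)).
  assert (B : Cmod (pw x z0) <= Rpower x (- k) * exp (- (2 * (l * r)))).
  { rewrite Cmod_pw. unfold Rpower. fold l. rewrite <- exp_plus. apply exp_le. nra. }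
  assert (Y0 : 0 <= l * r) by nra. set (y := l * r) in *.
  assert (E1 : exp (- (2 * y)) = exp (- y) * exp (- y)) by (rewrite <- exp_plus; f_equal; ring).
  assert (E2 : exp y * exp (- y) = 1) by (rewrite <- exp_plus, Rplus_opp_r; apply exp_0).
  assert (E3 : exp (- y) <= 1) by (rewrite <- exp_0; apply exp_le; lra).
  assert (E6 := exp_ineq1_le y).
  assert (E7 := exp_ge_sqr y Y0).
  assert (E8 : exp (- (2 * y)) <= 1) by nra.
  split; [nra|].
  exists (- (RtoC l * pw x z0))%C. split.
  { rewrite Cmod_opp_scal by exact Hl.
    replace (l * Cmod (pw x z0) * r) with (y * Cmod (pw x z0)) by (unfold y; ring).
    apply Rle_trans with (y * (Rpower x (- k) * exp (- (2 * y)))); [nra|].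
    assert (y * exp (- (2 * y)) <= 1); [|nra]. rewrite E1.
    nra. }
  intros h Hh.
  assert (E : (pw x (z0 + h) - pw x z0 - - (RtoC l * pw x z0) * h)%C =
    (pw x z0 * (Cexp (- (RtoC l * h)) - 1 - (- (RtoC l * h))))%C).
  { rewrite pw_plus, (pw_exp x h). unfold l. ring. }
  rewrite E, Cmod_mult.
  assert (R := Cexp_sub1_sub_le (- (RtoC l * h)) y
     ltac:(eapply Rle_trans; [apply Re_opp_scal_le; exact Hl|unfold y; nra]) Y0).
  rewrite Cmod_opp_scal in R by exact Hl.
  apply Rle_trans with ((Rpower x (- k) * exp (- (2 * y))) * (5 * (l * Cmod h) ^ 2 * exp y) * r ^ 2).
  { apply Rmult_le_compat_r; [apply pow2_ge_0|]. apply Rmult_le_compat; auto using Cmod_ge_0. }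
  replace (Rpower x (- k) * exp (- (2 * y)) * (5 * (l * Cmod h) ^ 2 * exp y) * r ^ 2)
    with (Rpower x (- k) * Cmod h ^ 2 * (5 * (y ^ 2 * (exp (- y) * (exp y * exp (- y))))))
    by (rewrite E1; unfold y; ring).
  rewrite E2, Rmult_1_r.
  assert (y ^ 2 * exp (- y) <= 4) by nra.
  assert (0 <= Rpower x (- k) * Cmod h ^ 2) by nra.
  nra.
Qed.

Lemma jet_one_sub_exp (d r : R) (z0 : C) : 0 <= d <= 1 -> 0 < r <= 1 -> 0 <= Re z0 ->
  jet (fun w => 1 - Cexp (- (RtoC d * w)))%C z0 r (15 * d * (Cmod z0 + 1)).
Proof.
  intros Hd Hr Hz. assert (Z0 := Cmod_ge_0 z0).
  assert (B : Cmod (Cexp (- (RtoC d * z0))) <= 1).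
  { rewrite Cmod_Cexp, Re_opp_scal, <- exp_0. apply exp_le. nra. }
  assert (DZ : 0 <= d * Cmod z0) by nra.
  split.
  { rewrite <- Cmod_opp.
    replace (- (1 - Cexp (- (RtoC d * z0))))%C with (Cexp (- (RtoC d * z0)) - 1)%C by ring.
    assert (Q := Cexp_sub1_le (- (RtoC d * z0)) 0 ltac:(rewrite Re_opp_scal; nra) (Rle_refl 0)).
    rewrite Cmod_opp_scal, exp_0 in Q by lra. lra. }
  exists (RtoC d * Cexp (- (RtoC d * z0)))%C. split.
  { rewrite Cmod_mult, Cmod_R, Rabs_pos_eq by lra.
    assert (d * Cmod (Cexp (- (RtoC d * z0))) <= d) by nra.
    nra. }
  intros h Hh.
  replace (1 - Cexp (- (RtoC d * (z0 + h))) - (1 - Cexp (- (RtoC d * z0)))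
     - RtoC d * Cexp (- (RtoC d * z0)) * h)%C
    with (- (Cexp (- (RtoC d * z0)) * (Cexp (- (RtoC d * h)) - 1 - - (RtoC d * h))))%C.
  2:{ replace (- (RtoC d * (z0 + h)))%C with (- (RtoC d * z0) + - (RtoC d * h))%C by ring.
      rewrite Cexp_plus. ring. }
  rewrite Cmod_opp, Cmod_mult.
  assert (Q := Cexp_sub1_sub_le (- (RtoC d * h)) 1
     ltac:(eapply Rle_trans; [apply Re_opp_scal_le; lra|nra]) ltac:(lra)).
  rewrite Cmod_opp_scal in Q by lra. assert (E3 := exp_le_3).
  assert (H2 := pow2_ge_0 (Cmod h)).
  assert (Q2 : Cmod (Cexp (- (RtoC d * h)) - 1 - - (RtoC d * h))%C <= 15 * d * Cmod h ^ 2).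
  { eapply Rle_trans; [exact Q|].
    replace (5 * (d * Cmod h) ^ 2 * exp 1) with (5 * exp 1 * (d * d) * Cmod h ^ 2) by ring.
    apply Rmult_le_compat_r; [exact H2|].
    assert (0 <= d * d <= d) by nra. nra. }
  set (X := Cmod (Cexp (- (RtoC d * h)) - 1 - - (RtoC d * h))%C) in *.
  assert (X0 : 0 <= X) by apply Cmod_ge_0.
  set (Y := Cmod (Cexp (- (RtoC d * z0)))) in *.
  assert (XY : Y * X <= X) by nra.
  assert (r2 : r ^ 2 <= 1) by nra.
  nra.
Qed.

(** The difference is [x^-w (1 - e^(-d w))] with [d <= 1 / x]: one power of [x] is gained. *)
Lemma jet_pw_diff (x k r : R) (z0 : C) : 1 <= x -> 0 < r <= 1 -> 0 <= k -> k + 2 * r <= Re z0 ->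
  jet (fun w => pw x w - pw (x + 1) w)%C z0 r (1800 * (Cmod z0 + 1) * Rpower x (- k - 1)).
Proof.
  intros Hx Hr Hk Hz. destruct (ln_succ x Hx) as [d [Ed [Hd1 Hd2]]].
  assert (Hi : 0 < / (x + 1)) by (apply Rinv_0_lt_compat; lra).
  assert (Hx1 : / x <= 1) by (rewrite <- Rinv_1; apply Rinv_le_contravar; lra).
  apply jet_ext with (fun w => pw x w * (1 - Cexp (- (RtoC d * w))))%C.
  { intros w. rewrite !pw_exp, Ed, RtoC_plus.
    replace (- ((RtoC (ln x) + RtoC d) * w))%C with (- (RtoC (ln x) * w) + - (RtoC d * w))%C by ring.
    rewrite Cexp_plus. ring. }
  apply jet_le with (6 * (20 * Rpower x (- k)) * (15 * d * (Cmod z0 + 1))).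
  - replace (Rpower x (- k - 1)) with (Rpower x (- k) * / x).
    2:{ unfold Rminus. rewrite Rpower_plus, (Rpower_Ropp x 1), Rpower_1 by lra. reflexivity. }
    assert (P := Rpower_pos x (- k)). assert (Z0 := Cmod_ge_0 z0).
    assert (d * (Cmod z0 + 1) <= / x * (Cmod z0 + 1)) by nra.
    replace (6 * (20 * Rpower x (- k)) * (15 * d * (Cmod z0 + 1)))
      with (1800 * Rpower x (- k) * (d * (Cmod z0 + 1))) by ring.
    replace (1800 * (Cmod z0 + 1) * (Rpower x (- k) * / x))
      with (1800 * Rpower x (- k) * (/ x * (Cmod z0 + 1))) by ring.
    apply Rmult_le_compat_l; lra.
  - apply jet_mult; [lra|apply jet_pw; lra|]. apply jet_one_sub_exp; lra.
Qed.

(** [w - 2] times the difference between [(2 x - 1) x^-w] and the integral of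
    [2 t^(1 - w)] from [x] to [x + 1]. Written out, the pole has disappeared. *)
Definition kterm (x : R) (w : C) : C :=
  ((w - 2) * RtoC (2 * x - 1) * pw x w
   - 2 * (RtoC (x ^ 2) * pw x w - RtoC ((x + 1) ^ 2) * pw (x + 1) w))%C.

(** With [u = w - 2] and the logarithmic step [d], the factor of [x^-w] is
    [2 x^2 (e^(-d u) - 1 + d u) + (2 x - 1 - 2 x^2 d) u]; both parts stay bounded in [x]
    because [x d] is close to one. *)
Lemma jet_kterm (x k r : R) (z0 : C) : 1 <= x -> 0 < r <= 1 -> 1 <= k -> k + 2 * r <= Re z0 ->
  jet (kterm x) z0 r (12000 * (Cmod z0 + 3) ^ 2 * Rpower x (- k)).
Proof.
  intros Hx Hr Hk Hz. destruct (ln_succ x Hx) as [d [Ed [Hd1 Hd2]]].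
  assert (Hx1 : / x <= 1) by (rewrite <- Rinv_1; apply Rinv_le_contravar; lra).
  assert (Hxd : x * d <= 1).
  { apply Rmult_le_compat_l with (r := x) in Hd2; [|lra]. rewrite Rinv_r in Hd2; lra. }
  assert (Hxd' : 1 <= (x + 1) * d).
  { apply Rmult_le_compat_l with (r := x + 1) in Hd1; [|lra]. rewrite Rinv_r in Hd1; lra. }
  set (rho := 2 * x - 1 - 2 * x ^ 2 * d).
  assert (Hrho : Rabs rho <= 1).
  { unfold rho. apply Rabs_le. split; [|nra].
    nra. }
  set (f := fun w => (RtoC (2 * x ^ 2) * (Cexp (- (RtoC d * (w - 2))) - 1)
                      + RtoC (2 * x - 1) * (w - 2))%C).
  apply jet_ext with (fun w => pw x w * f w)%C.
  { intros w. unfold kterm, f.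
    assert (Ex : (pw (x + 1) w * RtoC ((x + 1) ^ 2) =
       RtoC (x ^ 2) * pw x w * Cexp (- (RtoC d * (w - 2))))%C).
    { rewrite !pw_exp, Ed, RtoC_plus.
      replace ((x + 1) ^ 2) with (x ^ 2 * exp (d * 2)).
      2:{ replace d with (ln (x + 1) - ln x) by lra.
          replace ((ln (x + 1) - ln x) * 2) with (ln (x + 1) + ln (x + 1) + (- ln x + - ln x)) by ring.
          rewrite !exp_plus, !exp_Ropp, !exp_ln by lra. field. lra. }
      rewrite RtoC_mult, <- Cexp_RtoC, RtoC_mult.
      replace (- ((RtoC (ln x) + RtoC d) * w))%C with (- (RtoC (ln x) * w) + - (RtoC d * w))%C by ring.
      replace (- (RtoC d * (w - 2)))%C with (- (RtoC d * w) + RtoC d * 2)%C by ring.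
      rewrite !Cexp_plus. ring. }
    rewrite (Cmult_comm (RtoC ((x + 1) ^ 2))), Ex, (RtoC_mult 2). ring. }
  apply jet_le with (6 * (20 * Rpower x (- k)) * (100 * (Cmod z0 + 3) ^ 2)); [right; ring|].
  apply jet_mult; [lra|apply jet_pw; lra|].
  set (u := (z0 - 2)%C).
  assert (Hu : Cmod u <= Cmod z0 + 2).
  { unfold u. eapply Rle_trans; [apply (Cmod_triangle z0 (- RtoC 2)%C)|].
    rewrite Cmod_opp, Cmod_R, Rabs_pos_eq; lra. }
  assert (Hu0 := Cmod_ge_0 u).
  assert (HRe : Re u = Re z0 - 2) by auto.
  assert (HReu : Re (- (RtoC d * u))%C <= 1) by (rewrite Re_opp_scal, HRe; nra).
  assert (E3 := exp_le_3). assert (Epos := exp_pos 1).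
  assert (Hxx : 0 <= 2 * x ^ 2) by nra.
  assert (B1 : Cmod (Cexp (- (RtoC d * u))) <= 3).
  { rewrite Cmod_Cexp. apply Rle_trans with (exp 1); [apply exp_le; lra|lra]. }
  split; [|exists (RtoC (2 * x ^ 2 * d) * (1 - Cexp (- (RtoC d * u))) + RtoC rho)%C; split].
  - unfold f. fold u.
    replace (RtoC (2 * x ^ 2) * (Cexp (- (RtoC d * u)) - 1) + RtoC (2 * x - 1) * u)%C
      with (RtoC (2 * x ^ 2) * (Cexp (- (RtoC d * u)) - 1 - - (RtoC d * u)) + RtoC rho * u)%C.
    2:{ unfold rho. rewrite (RtoC_minus (2 * x - 1)), (RtoC_mult _ d). ring. }
    eapply Rle_trans; [apply Cmod_triangle|]. rewrite !Cmod_mult, !Cmod_R.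
    rewrite (Rabs_pos_eq (2 * x ^ 2)) by lra.
    assert (Q := Cexp_sub1_sub_le _ 1 HReu ltac:(lra)).
    rewrite Cmod_opp_scal in Q by lra.
    assert (Q1 : 2 * x ^ 2 * Cmod (Cexp (- (RtoC d * u)) - 1 - - (RtoC d * u))%C
       <= 2 * x ^ 2 * (5 * (d * Cmod u) ^ 2 * exp 1)) by nra.
    replace (2 * x ^ 2 * (5 * (d * Cmod u) ^ 2 * exp 1)) with
      ((2 * x ^ 2 * d * d) * (exp 1 * (5 * Cmod u ^ 2))) in Q1 by ring.
    assert (Q2 : (2 * x ^ 2 * d * d) * (exp 1 * (5 * Cmod u ^ 2)) <= 2 * (3 * (5 * Cmod u ^ 2))).
    { apply Rmult_le_compat; try nra. }
      nra.
  - assert (T := Cmod_triangle (RtoC (2 * x ^ 2 * d) * (1 - Cexp (- (RtoC d * u))))%C (RtoC rho)).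
    rewrite Cmod_mult, !Cmod_R in T.
    rewrite (Rabs_pos_eq (2 * x ^ 2 * d)) in T by nra.
    assert (Q := Cexp_sub1_le _ 1 HReu ltac:(lra)).
    rewrite Cmod_opp_scal in Q by lra.
    rewrite <- (Cmod_opp (1 - Cexp (- (RtoC d * u)))%C) in T.
    replace (- (1 - Cexp (- (RtoC d * u))))%C with (Cexp (- (RtoC d * u)) - 1)%C in T by ring.
    assert (Q1 : 2 * x ^ 2 * d * Cmod (Cexp (- (RtoC d * u)) - 1)%C <=
                 2 * x ^ 2 * d * (3 * (d * Cmod u) * exp 1)) by (apply Rmult_le_compat_l; [nra|exact Q]).
    replace (2 * x ^ 2 * d * (3 * (d * Cmod u) * exp 1)) with
      ((2 * x ^ 2 * d * d) * (exp 1 * (3 * Cmod u))) in Q1 by ring.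
    assert (Q2 : (2 * x ^ 2 * d * d) * (exp 1 * (3 * Cmod u)) <= 2 * (3 * (3 * Cmod u))).
    { apply Rmult_le_compat; try nra. }
    set (X := Cmod (RtoC (2 * x ^ 2 * d) * (1 - Cexp (- (RtoC d * u))) + RtoC rho)%C) in *.
    nra.
  - intros h Hh.
    replace (f (z0 + h)%C - f z0 -
       (RtoC (2 * x ^ 2 * d) * (1 - Cexp (- (RtoC d * u))) + RtoC rho) * h)%C with
      (RtoC (2 * x ^ 2) * (Cexp (- (RtoC d * u)) * (Cexp (- (RtoC d * h)) - 1 - - (RtoC d * h))))%C.
    2:{ unfold f, rho.
        replace (- (RtoC d * (z0 + h - 2)))%C with (- (RtoC d * u) + - (RtoC d * h))%C
          by (unfold u; ring).
        rewrite Cexp_plus. fold u.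
        rewrite (RtoC_minus (2 * x - 1)), (RtoC_mult _ d). unfold u. ring. }
    rewrite !Cmod_mult, Cmod_R, (Rabs_pos_eq (2 * x ^ 2)) by lra.
    assert (Q := Cexp_sub1_sub_le (- (RtoC d * h)) 1
       ltac:(eapply Rle_trans; [apply Re_opp_scal_le; lra|nra]) ltac:(lra)).
    rewrite Cmod_opp_scal in Q by lra.
    set (X := Cmod (Cexp (- (RtoC d * h)) - 1 - - (RtoC d * h))%C) in *.
    assert (X0 : 0 <= X) by apply Cmod_ge_0.
    assert (H2 := pow2_ge_0 (Cmod h)).
    assert (Q1 : Cmod (Cexp (- (RtoC d * u))) * X <= 3 * (5 * (d * Cmod h) ^ 2 * exp 1)) by nra.
    assert (Q2 : 2 * x ^ 2 * (Cmod (Cexp (- (RtoC d * u))) * X) <=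
       2 * x ^ 2 * (3 * (5 * (d * Cmod h) ^ 2 * exp 1))) by nra.
    replace (2 * x ^ 2 * (3 * (5 * (d * Cmod h) ^ 2 * exp 1))) with
      ((2 * x ^ 2 * d * d) * (exp 1 * (15 * Cmod h ^ 2))) in Q2 by ring.
    assert (Q3 : (2 * x ^ 2 * d * d) * (exp 1 * (15 * Cmod h ^ 2)) <= 2 * (3 * (15 * Cmod h ^ 2))).
    { apply Rmult_le_compat; try nra. }
    set (Y := 2 * x ^ 2 * (Cmod (Cexp (- (RtoC d * u))) * X)) in *.
    assert (Y0 : 0 <= Y) by (apply Rmult_le_pos; [lra|apply Rmult_le_pos; [apply Cmod_ge_0|lra]]).
    assert (r2 : r ^ 2 <= 1) by nra.
    assert (Y * r ^ 2 <= Y * 1) by nra.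
    assert (90 * Cmod h ^ 2 <= 100 * (Cmod z0 + 3) ^ 2 * Cmod h ^ 2); [|lra].
    apply Rmult_le_compat_r; [exact H2|]. nra.
Qed.

(** [w - 2] times the error of the integral comparison for the sum of [(2 m - 1) m^-w]
    over [m >= n]. *)
Definition main_tail (n : nat) (w : C) : C := CSeries (fun i => kterm (INR (n + i)) w).

(** The sum of [(E m - E (m - 1)) m^-w] over [m >= n], rearranged by Abel summation so that
    only the size of [E] matters. *)
Definition error_tail (n : nat) (E : nat -> R) (w : C) : C :=
  (- (RtoC (E (n - 1)%nat) * pw (INR n) w)
   + CSeries (fun i => RtoC (E (n + i)%nat) * (pw (INR (n + i)) w - pw (INR (n + i) + 1) w)))%C.

Lemma INR_ge1 (n : nat) : (1 <= n)%nat -> 1 <= INR n.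
Proof. destruct n; [lia|intros _; apply INR_S_ge1]. Qed.

Lemma jet_main_tail (n : nat) (k r : R) (z0 : C) :
  (1 <= n)%nat -> 0 < r <= 1 -> 1 < k -> k + 2 * r <= Re z0 ->
  jet (main_tail n) z0 r
    (12000 * (1 + / (k - 1)) * (Cmod z0 + 3) ^ 2 * Rpower (INR n) (1 - k)).
Proof.
  intros Hn Hr Hk Hz.
  assert (Hs := ex_series_Rpower k n Hk Hn).
  apply jet_le with (Series (fun i => 12000 * (Cmod z0 + 3) ^ 2 * Rpower (INR (n + i)) (- k))).
  - rewrite Series_scal_l. assert (Q := Series_Rpower k n Hk Hn).
    assert (0 <= 12000 * (Cmod z0 + 3) ^ 2) by (assert (P := pow2_ge_0 (Cmod z0 + 3)); lra).
    apply Rmult_le_compat_l with (r := 12000 * (Cmod z0 + 3) ^ 2) in Q; [|assumption].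
    eapply Rle_trans; [exact Q|]. right; ring.
  - apply jet_series; [lra| |].
    + intros i. apply jet_kterm; try lra. apply INR_ge1; lia.
    + apply (ex_series_Rscal (12000 * (Cmod z0 + 3) ^ 2)). exact Hs.
Qed.

Lemma jet_error_tail (n : nat) (E : nat -> R) (e q k r : R) (z0 : C) :
  (1 <= n)%nat -> 0 < r <= 1 -> 0 <= q < k -> k + 2 * r <= Re z0 ->
  E 0%nat = 0 -> (forall m, (1 <= m)%nat -> Rabs (E m) <= e * Rpower (INR m) q) ->
  jet (error_tail n E) z0 r
    ((1820 + 1800 / (k - q)) * e * (Cmod z0 + 1) * Rpower (INR n) (q - k)).
Proof.
  intros Hn Hr Hk Hz E0 HE.
  assert (Hn1 := INR_ge1 n Hn).
  assert (He : 0 <= e).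
  { specialize (HE n Hn). assert (P := Rpower_pos (INR n) q). assert (Q := Rabs_pos (E n)). nra. }
  set (t := k + 1 - q).
  assert (Ht : 1 < t) by (unfold t; lra).
  assert (Hs := ex_series_Rpower t n Ht Hn).
  assert (Z0 := Cmod_ge_0 z0).
  assert (P := Rpower_pos (INR n) (q - k)).
  set (c := 1800 * (Cmod z0 + 1) * e).
  assert (c0 : 0 <= c) by (unfold c; apply Rmult_le_pos; nra).
  apply jet_le with (e * Rpower (INR n) q * (20 * Rpower (INR n) (- k))
     + Series (fun i => c * Rpower (INR (n + i)) (- t))).
  - rewrite Series_scal_l. assert (Q := Series_Rpower t n Ht Hn).
    replace (1 - t) with (q - k) in Q by (unfold t; ring).
    replace (t - 1) with (k - q) in Q by (unfold t; ring).
    replace (e * Rpower (INR n) q * (20 * Rpower (INR n) (- k)))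
      with (20 * e * Rpower (INR n) (q - k)) by (unfold Rminus; rewrite Rpower_plus; ring).
    apply Rmult_le_compat_l with (r := c) in Q; [|exact c0].
    assert (0 <= e * Cmod z0 * Rpower (INR n) (q - k)).
    { apply Rmult_le_pos; [nra|lra]. }
    replace (c * ((1 + / (k - q)) * Rpower (INR n) (q - k))) with
      ((1800 + 1800 / (k - q)) * e * (Cmod z0 + 1) * Rpower (INR n) (q - k)) in Q
      by (unfold c; field; lra).
    replace ((1820 + 1800 / (k - q)) * e * (Cmod z0 + 1) * Rpower (INR n) (q - k)) with
      ((1800 + 1800 / (k - q)) * e * (Cmod z0 + 1) * Rpower (INR n) (q - k) +
       20 * (e * Cmod z0 * Rpower (INR n) (q - k)) + 20 * e * Rpower (INR n) (q - k)) by ring.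
    lra.
  - unfold error_tail. apply jet_plus.
    + apply jet_opp.
      apply jet_le with (Cmod (RtoC (E (n - 1)%nat)) * (20 * Rpower (INR n) (- k))).
      * rewrite Cmod_R. apply Rmult_le_compat_r.
        { assert (Q := Rpower_pos (INR n) (- k)). lra. }
        assert (Q := Rpower_pos (INR n) q).
        destruct (Nat.eq_dec n 1) as [->|Hn'].
        { simpl (1 - 1)%nat. rewrite E0, Rabs_R0. nra. }
        eapply Rle_trans; [apply HE; lia|]. apply Rmult_le_compat_l; [exact He|].
        apply Rle_Rpower_l; [lra|]. split; [apply lt_0_INR; lia|apply le_INR; lia].
      * apply (jet_scal (RtoC (E (n - 1)%nat))). apply jet_pw; lra.
    + apply (jet_series (fun i w => RtoC (E (n + i)%nat) *
         (pw (INR (n + i)) w - pw (INR (n + i) + 1) w))%C); [lra| |].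
      * intros i.
        assert (Hi := INR_ge1 (n + i) ltac:(lia)).
        apply jet_le with (Cmod (RtoC (E (n + i)%nat)) *
          (1800 * (Cmod z0 + 1) * Rpower (INR (n + i)) (- k - 1))).
        { rewrite Cmod_R.
          assert (Q := Rpower_pos (INR (n + i)) (- k - 1)).
          eapply Rle_trans.
          { apply Rmult_le_compat_r; [|apply HE; lia]. apply Rmult_le_pos; nra. }
          replace (- t) with (q + (- k - 1)) by (unfold t; ring).
          rewrite Rpower_plus. right. unfold c. ring. }
        apply jet_scal. apply jet_pw_diff; lra.
      * now apply (ex_series_Rscal c).
Qed.

(** With summatory function [a m^2 + E m], a Dirichlet tail splits into the contribution
    of [a m^2], which carries the pole at [w = 2], and that of [E], which converges in a
    larger half-plane. *)
Lemma dirichlet_tail (n : nat) (c E : nat -> R) (a e q : R) (w : C) :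
  (1 <= n)%nat -> 0 <= q -> q < Re w -> 2 < Re w -> E 0%nat = 0 ->
  (forall m, (1 <= m)%nat -> Rabs (E m) <= e * Rpower (INR m) q) ->
  (forall m, (1 <= m)%nat -> c m = a * (2 * INR m - 1) + E m - E (m - 1)%nat) ->
  csums (fun i => (w - 2) * (RtoC (c (n + i)%nat) * pw (INR (n + i)) w))%C
    (RtoC a * (2 * (RtoC (INR n ^ 2) * pw (INR n) w) + main_tail n w) + (w - 2) * error_tail n E w)%C.
Proof.
  intros Hn Hq Hqw H2w E0 HE Hc.
  assert (He : 0 <= e).
  { specialize (HE n Hn). assert (P := Rpower_pos (INR n) q). assert (Q := Rabs_pos (E n)). nra. }
  (* lowering the exponent by [2 r] keeps both series absolutely convergent *)
  set (r := Rmin 1 (Rmin ((Re w - q) / 4) ((Re w - 2) / 4))).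
  assert (Hr0 : 0 < r) by (repeat apply Rmin_pos; lra).
  assert (Hr1 : r <= 1) by apply Rmin_l.
  assert (Hr2 : r <= (Re w - q) / 4) by (eapply Rle_trans; [apply Rmin_r|apply Rmin_l]).
  set (k := Re w - 2 * r).
  assert (SK : csums (fun i => kterm (INR (n + i)) w) (main_tail n w)).
  { apply CSeries_correct.
    apply ex_series_dominated with (fun i => 12000 * (Cmod w + 3) ^ 2 * Rpower (INR (n + i)) (- k)).
    - intros i; split; [apply Cmod_ge_0|].
      apply (jet_kterm (INR (n + i)) k r w); unfold k; try lra. apply INR_ge1; lia.
    - apply (ex_series_Rscal (12000 * (Cmod w + 3) ^ 2)). apply ex_series_Rpower; [unfold k; lra|lia]. }
  assert (SH : csums (fun i => RtoC (E (n + i)%nat) * (pw (INR (n + i)) w - pw (INR (n + i) + 1) w))%C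
     (error_tail n E w + RtoC (E (n - 1)%nat) * pw (INR n) w)%C).
  { unfold error_tail.
    match goal with |- csums ?f (- ?A + CSeries ?g + ?A)%C =>
      replace (- A + CSeries g + A)%C with (CSeries g) by ring end.
    apply CSeries_correct.
    apply ex_series_dominated with (fun i => 1800 * (Cmod w + 1) * e * Rpower (INR (n + i)) (- (k + 1 - q))).
    - intros i; split; [apply Cmod_ge_0|]. rewrite Cmod_mult, Cmod_R.
      assert (Hi := INR_ge1 (n + i) ltac:(lia)).
      assert (Q := proj1 (jet_pw_diff (INR (n + i)) k r w Hi ltac:(lra) ltac:(unfold k; lra) ltac:(unfold k; lra))).
      eapply Rle_trans.
      { apply Rmult_le_compat; [apply Rabs_pos|apply Cmod_ge_0|apply HE; lia|exact Q]. }
      replace (- (k + 1 - q)) with (q + (- k - 1)) by ring. rewrite Rpower_plus. right; ring.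
    - apply (ex_series_Rscal (1800 * (Cmod w + 1) * e)). apply ex_series_Rpower; [unfold k; lra|lia]. }
  assert (L1 : ctends (fun X => RtoC (INR (n + X) ^ 2) * pw (INR (n + X)) w)%C (RtoC 0)).
  { apply ctends_zero with (fun X => Rpower (INR (n + X)) (- (Re w - 2))).
    - intros X. rewrite Cmod_mult, Cmod_pw, Cmod_R.
      assert (HX := INR_ge1 (n + X) ltac:(lia)).
      rewrite Rabs_pos_eq by apply pow2_ge_0.
      replace (INR (n + X) ^ 2) with (Rpower (INR (n + X)) 2)
        by (apply Rpower_2; lra).
      rewrite <- Rpower_plus. right. f_equal. ring.
    - apply is_lim_Rpower_0. lra. }
  assert (L2 : ctends (fun X => RtoC (E (n + X - 1)%nat) * pw (INR (n + X)) w)%C (RtoC 0)).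
  { apply ctends_zero with (fun X => e * Rpower (INR (n + X)) (- (Re w - q))).
    - intros X. rewrite Cmod_mult, Cmod_pw, Cmod_R.
      assert (P := Rpower_pos (INR (n + X)) (- Re w)).
      replace (- (Re w - q)) with (q + - Re w) by ring. rewrite Rpower_plus, <- Rmult_assoc.
      apply Rmult_le_compat_r; [lra|].
      assert (Q := Rpower_pos (INR (n + X)) q).
      destruct (Nat.eq_dec (n + X) 1) as [E1|Hn'].
      { rewrite E1. simpl (1 - 1)%nat. rewrite E0, Rabs_R0. rewrite E1 in Q. nra. }
      eapply Rle_trans; [apply HE; lia|]. apply Rmult_le_compat_l; [exact He|].
      apply Rle_Rpower_l; [lra|]. split; [apply lt_0_INR; lia|apply le_INR; lia].
    - replace (Finite 0) with (Rbar_mult e 0) by (simpl; f_equal; ring).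
      apply is_lim_seq_scal_l. apply is_lim_Rpower_0. lra. }
  (* partial sums; the two terms at [n + X] vanish in the limit *)
  assert (F : forall X, csum (seq 0 X) (fun i => (w - 2) * (RtoC (c (n + i)%nat) * pw (INR (n + i)) w))%C =
    (RtoC a * (2 * (RtoC (INR n ^ 2) * pw (INR n) w)) - (w - 2) * (RtoC (E (n - 1)%nat) * pw (INR n) w)
     + (RtoC a * csum (seq 0 X) (fun i => kterm (INR (n + i)) w)
        + ((w - 2) * csum (seq 0 X)
           (fun i => RtoC (E (n + i)%nat) * (pw (INR (n + i)) w - pw (INR (n + i) + 1) w))
         + (- RtoC a * 2 * (RtoC (INR (n + X) ^ 2) * pw (INR (n + X)) w)
         + (w - 2) * (RtoC (E (n + X - 1)%nat) * pw (INR (n + X)) w)))))%C).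
  { induction X as [|X IH].
    - unfold csum; simpl map; simpl fold_right. rewrite Nat.add_0_r. ring.
    - rewrite !csum_seq_S, IH. rewrite Hc by lia.
      replace (INR (n + S X)) with (INR (n + X) + 1) by (rewrite <- S_INR; f_equal; lia).
      replace (n + S X - 1)%nat with (n + X)%nat by lia.
      unfold kterm. rewrite RtoC_minus, RtoC_plus, RtoC_mult. ring. }
  unfold csums. eapply ctends_ext; [intros X; symmetry; apply F|].
  replace (RtoC a * (2 * (RtoC (INR n ^ 2) * pw (INR n) w) + main_tail n w) + (w - 2) * error_tail n E w)%C
    with (RtoC a * (2 * (RtoC (INR n ^ 2) * pw (INR n) w)) - (w - 2) * (RtoC (E (n - 1)%nat) * pw (INR n) w)
     + (RtoC a * main_tail n w + ((w - 2) * (error_tail n E w + RtoC (E (n - 1)%nat) * pw (INR n) w)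
        + (- RtoC a * 2 * RtoC 0 + (w - 2) * RtoC 0))))%C by ring.
  apply ctends_plus; [apply ctends_const|].
  apply ctends_plus; [now apply ctends_scal|].
  apply ctends_plus; [now apply ctends_scal|].
  apply ctends_plus; now apply ctends_scal.
Qed.

(** * Double Dirichlet series: continuation *)

(** What the continuation needs to know about the counts [N n m]: row [n] grows like
    [a n m^2] with error [e n m], and the two averages satisfy power bounds. The exponent
    [5/2] of the errors is what places the boundary at [Re w = 7/4]. *)
Record regular_counts (N : nat -> nat -> R) (a e : nat -> R) (b Ce Cb : R) : Prop := {
  counts_ge0 : forall n m, 0 <= N n m;
  counts_sym : forall n m, N n m = N m n;
  density_ge0 : forall n, 0 <= a n;
  error_ge0 : forall n, 0 <= e n;
  counts_row : forall n m, (1 <= n)%nat ->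
    Rabs (rsum (seq 0 m) (fun l => N n (S l)) - a n * INR m ^ 2) <= e n * INR m;
  error_sum : forall X,
    rsum (seq 0 X) (fun i => e (S i)) <= Ce * Rpower (INR (S X)) (5 / 2);
  density_sum : forall X, (1 <= X)%nat ->
    Rabs (rsum (seq 0 X) (fun i => a (S i)) - b * INR X ^ 2) <= Cb * Rpower (INR X) (3 / 2)
}.

Definition row_error (N : nat -> nat -> R) (a : nat -> R) (n m : nat) : R :=
  rsum (seq 0 m) (fun l => N n (S l)) - a n * INR m ^ 2.

Definition density_error (a : nat -> R) (b : R) (m : nat) : R :=
  rsum (seq 0 m) (fun i => a (S i)) - b * INR m ^ 2.

Lemma INR_sqr_step (m : nat) : (1 <= m)%nat ->
  INR m ^ 2 = INR (m - 1) ^ 2 + (2 * INR m - 1).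
Proof. intros Hm. rewrite minus_INR by lia. simpl. ring. Qed.

Lemma rsum_pred_step (m : nat) (f : nat -> R) : (1 <= m)%nat ->
  f m = rsum (seq 0 m) (fun i => f (S i)) - rsum (seq 0 (m - 1)) (fun i => f (S i)).
Proof.
  intros Hm. destruct m as [|m]; [lia|].
  replace (S m - 1)%nat with m by lia. rewrite rsum_seq_S. ring.
Qed.

(** The error of the integral comparison in row [n = S i], weighted by [n^-w]. *)
Definition term_main (a : nat -> R) (i : nat) (w : C) : C :=
  (RtoC (a (S i)) * (pw (INR (S i)) w * main_tail (S i) w))%C.

Definition term_error (N : nat -> nat -> R) (a : nat -> R) (i : nat) (w : C) : C :=
  (pw (INR (S i)) w * error_tail (S i) (row_error N a (S i)) w)%C.

Definition term_diag (N : nat -> nat -> R) (i : nat) (w : C) : C :=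
  (RtoC (N (S i) (S i)) * pw (INR (S i)) (2 * w + 0))%C.

(** [v - 2] times the Dirichlet series of the densities, with [v = 2 w - 2] in the
    application. *)
Definition polar_part (a : nat -> R) (b : R) (v : C) : C :=
  (RtoC b * (2 * (RtoC (INR 1 ^ 2) * pw (INR 1) v) + main_tail 1 v)
   + (v - 2) * error_tail 1 (density_error a b) v)%C.

(** [(w - 2)^2] times the double Dirichlet series: twice the rows [m >= n] minus the
    diagonal. *)
Definition cleared (N : nat -> nat -> R) (a : nat -> R) (b : R) (w : C) : C :=
  (2 * polar_part a b (2 * w + (- RtoC 2))
   + ((w - 2) * (2 * CSeries (fun i => term_main a i w))
   + (w - 2) * ((w - 2) *
       (2 * CSeries (fun i => term_error N a i w) + - CSeries (fun i => term_diag N i w)))))%C.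

Lemma row_error_bound N a e b Ce Cb n m : regular_counts N a e b Ce Cb ->
  (1 <= n)%nat -> (1 <= m)%nat ->
  Rabs (row_error N a n m) <= e n * Rpower (INR m) 1.
Proof.
  intros H Hn Hm. rewrite Rpower_1 by (apply lt_0_INR; lia).
  now apply (counts_row _ _ _ _ _ _ H).
Qed.

Lemma row_error_0 N a n : row_error N a n 0 = 0.
Proof. unfold row_error, rsum; simpl. ring. Qed.

Lemma density_error_0 a b : density_error a b 0 = 0.
Proof. unfold density_error, rsum; simpl. ring. Qed.

Lemma row_error_step N a n m : (1 <= m)%nat ->
  N n m = a n * (2 * INR m - 1) + row_error N a n m - row_error N a n (m - 1).
Proof.
  intros Hm. unfold row_error. rewrite (INR_sqr_step m Hm).
  rewrite (rsum_pred_step m (N n) Hm). ring.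
Qed.

Lemma density_error_step a b m : (1 <= m)%nat ->
  a m = b * (2 * INR m - 1) + density_error a b m - density_error a b (m - 1).
Proof.
  intros Hm. unfold density_error. rewrite (INR_sqr_step m Hm).
  rewrite (rsum_pred_step m a Hm). ring.
Qed.

Lemma ex_series_density N a e b Ce Cb t : regular_counts N a e b Ce Cb -> 2 < t ->
  ex_series (fun i => a (S i) * Rpower (INR (S i)) (- t)).
Proof.
  intros H Ht. apply (abel_ex_series a (Rabs b + Rabs Cb) 2 t); try lra.
  - apply (density_ge0 _ _ _ _ _ _ H).
  - intros X. destruct X as [|X].
    + unfold rsum; simpl. assert (P := Rpower_pos 1 2).
      assert (Q1 := Rabs_pos b). assert (Q2 := Rabs_pos Cb). nra.
    + assert (Q := density_sum _ _ _ _ _ _ H (S X) ltac:(lia)).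
      assert (HX := INR_S_ge1 X).
      assert (P := Rpower_pos (INR (S X)) (3/2)).
      assert (E2 : INR (S X) ^ 2 = Rpower (INR (S X)) 2)
        by (rewrite Rpower_2; lra).
      assert (L1 : Rpower (INR (S X)) (3 / 2) <= Rpower (INR (S X)) 2) by (apply Rle_Rpower; lra).
      assert (L2 : Rpower (INR (S X)) 2 <= Rpower (INR (S (S X))) 2).
      { apply Rle_Rpower_l; [lra|]. rewrite (S_INR (S X)). lra. }
      assert (Q0 := Rle_abs (rsum (seq 0 (S X)) (fun i => a (S i)) - b * INR (S X) ^ 2)).
      rewrite E2 in *.
      assert (B1 := Rle_abs b). assert (B2 := Rle_abs Cb).
      assert (B3 := Rabs_pos b). assert (B4 := Rabs_pos Cb).
      assert (M1 : b * Rpower (INR (S X)) 2 <= Rabs b * Rpower (INR (S (S X))) 2) by nra.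
      assert (M2 : Cb * Rpower (INR (S X)) (3/2) <= Rabs Cb * Rpower (INR (S (S X))) 2) by nra.
      lra.
Qed.

Lemma ex_series_error N a e b Ce Cb t : regular_counts N a e b Ce Cb -> 5 / 2 < t ->
  ex_series (fun i => e (S i) * Rpower (INR (S i)) (- t)).
Proof.
  intros H Ht. apply (abel_ex_series e Ce (5/2) t); try lra.
  - apply (error_ge0 _ _ _ _ _ _ H).
  - apply (error_sum _ _ _ _ _ _ H).
Qed.

Lemma jet_term_main N a e b Ce Cb i k r z0 : regular_counts N a e b Ce Cb ->
  0 < r <= 1 -> 1 < k -> k + 2 * r <= Re z0 ->
  jet (term_main a i) z0 r
    (1440000 * (1 + / (k - 1)) * (Cmod z0 + 3) ^ 2
       * (a (S i) * Rpower (INR (S i)) (- (2 * k - 1)))).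
Proof.
  intros H Hr Hk Hz. assert (HS := INR_S_ge1 i).
  apply jet_le with (Cmod (RtoC (a (S i))) * (6 * (20 * Rpower (INR (S i)) (- k)) *
     (12000 * (1 + / (k - 1)) * (Cmod z0 + 3) ^ 2 * Rpower (INR (S i)) (1 - k)))).
  - rewrite Cmod_R, Rabs_pos_eq by apply (density_ge0 _ _ _ _ _ _ H).
    replace (- (2 * k - 1)) with (- k + (1 - k)) by ring. rewrite Rpower_plus. right; ring.
  - apply (jet_scal (RtoC (a (S i)))). apply jet_mult; [lra|apply jet_pw; lra|].
    apply jet_main_tail; [lia|lra|lra|lra].
Qed.

Lemma jet_term_error N a e b Ce Cb i k r z0 : regular_counts N a e b Ce Cb ->
  0 < r <= 1 -> 1 < k -> k + 2 * r <= Re z0 ->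
  jet (term_error N a i) z0 r
    (120 * (1820 + 1800 / (k - 1)) * (Cmod z0 + 1)
       * (e (S i) * Rpower (INR (S i)) (- (2 * k - 1)))).
Proof.
  intros H Hr Hk Hz. assert (HS := INR_S_ge1 i).
  apply jet_le with (6 * (20 * Rpower (INR (S i)) (- k)) *
     ((1820 + 1800 / (k - 1)) * e (S i) * (Cmod z0 + 1) * Rpower (INR (S i)) (1 - k))).
  - replace (- (2 * k - 1)) with (- k + (1 - k)) by ring. rewrite Rpower_plus. right; ring.
  - apply jet_mult; [lra|apply jet_pw; lra|].
    apply jet_error_tail; try lra; try lia.
    + apply row_error_0.
    + intros m Hm. apply (row_error_bound N a e b Ce Cb); auto; lia.
Qed.

(** A diagonal count is a difference of two consecutive row sums. *)
Lemma jet_term_diag N a e b Ce Cb i k r z0 : regular_counts N a e b Ce Cb ->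
  0 < r <= 1 / 2 -> 1 < k -> k + 2 * r <= Re z0 ->
  jet (term_diag N i) z0 r
    (40 * (a (S i) * Rpower (INR (S i)) (- (2 * k - 1))
           + e (S i) * Rpower (INR (S i)) (- (2 * k - 1)))).
Proof.
  intros H Hr Hk Hz. assert (HS := INR_S_ge1 i).
  assert (A0 := density_ge0 _ _ _ _ _ _ H (S i)).
  assert (HN : N (S i) (S i) <= 2 * INR (S i) * (a (S i) + e (S i))).
  { rewrite (row_error_step N a (S i) (S i)) by lia.
    replace (S i - 1)%nat with i by lia.
    assert (Q1 := counts_row _ _ _ _ _ _ H (S i) (S i) ltac:(lia)).
    assert (Q2 := counts_row _ _ _ _ _ _ H (S i) i ltac:(lia)).
    fold (row_error N a (S i) (S i)) in Q1. fold (row_error N a (S i) i) in Q2.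
    apply Rabs_le_between in Q1. apply Rabs_le_between in Q2.
    assert (INR i <= INR (S i)) by (rewrite S_INR; lra). nra. }
  apply jet_le with (Cmod (RtoC (N (S i) (S i))) * (20 * Rpower (INR (S i)) (- (2 * k)))).
  - rewrite Cmod_R, Rabs_pos_eq by apply (counts_ge0 _ _ _ _ _ _ H).
    replace (- (2 * k - 1)) with (1 + - (2 * k)) by ring.
    rewrite Rpower_plus, Rpower_1 by lra. assert (P := Rpower_pos (INR (S i)) (- (2 * k))).
    apply Rle_trans with (2 * INR (S i) * (a (S i) + e (S i)) * (20 * Rpower (INR (S i)) (- (2 * k)))).
    + apply Rmult_le_compat_r; lra.
    + right; ring.
  - apply (jet_scal (RtoC (N (S i) (S i)))).
    assert (E2 : Cmod (RtoC 2) = 2) by (rewrite Cmod_R, Rabs_pos_eq; lra).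
    apply (jet_affine (RtoC 2) (RtoC 0) (pw (INR (S i)))).
    + rewrite E2. apply jet_pw; try lra. destruct z0; simpl in *; lra.
    + rewrite E2. lra.
Qed.

Lemma Cmod_affine2 (z0 : C) : Cmod (2 * z0 + - RtoC 2)%C <= 2 * Cmod z0 + 2.
Proof.
  eapply Rle_trans; [apply Cmod_triangle|].
  rewrite Cmod_opp, Cmod_mult, Cmod_R, Rabs_pos_eq; lra.
Qed.

Lemma jet_sub2 (z0 : C) (r : R) : 0 < r -> jet (fun w => w - 2)%C z0 r (Cmod z0 + r + 2).
Proof.
  intros Hr. apply jet_plus; [now apply jet_id|].
  apply jet_le with (Cmod (- RtoC 2)%C); [|now apply jet_const].
  rewrite Cmod_opp, Cmod_R, Rabs_pos_eq; lra.
Qed.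

Lemma jet_polar_part N a e b Ce Cb k r : regular_counts N a e b Ce Cb ->
  0 < r <= 1 -> 3 / 2 < k -> exists A, 0 <= A /\ forall z0, k + 2 * r <= Re z0 ->
  jet (polar_part a b) z0 r (A * (Cmod z0 + 3) ^ 2).
Proof.
  intros H Hr Hk.
  assert (Hk1 : 0 < / (k - 1)) by (apply Rinv_0_lt_compat; lra).
  assert (Hk2 : 0 < / (k - 3/2)) by (apply Rinv_0_lt_compat; lra).
  assert (Cb0 : 0 <= Cb).
  { assert (Q := density_sum _ _ _ _ _ _ H 1 (le_n _)).
    assert (Q2 := Rabs_pos (rsum (seq 0 1) (fun i => a (S i)) - b * INR 1 ^ 2)).
    assert (P := Rpower_pos (INR 1) (3/2)). nra. }
  set (CH := (1820 + 1800 / (k - 3 / 2)) * Cb).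
  assert (CH0 : 0 <= CH).
  { unfold CH. apply Rmult_le_pos; [|exact Cb0]. unfold Rdiv. lra. }
  set (CK := 12000 * (1 + / (k - 1))).
  assert (P1 : forall t, Rpower (INR 1) t = 1).
  { intros t. unfold Rpower. simpl INR. rewrite ln_1, Rmult_0_r. apply exp_0. }
  exists (Rabs b * (2 * 20 + CK) + 6 * CH).
  assert (B0 := Rabs_pos b).
  assert (CK0 : 0 <= CK) by (unfold CK; lra).
  split; [assert (0 <= Rabs b * (2 * 20 + CK)) by (apply Rmult_le_pos; lra); lra|].
  intros z0 Hz. set (Z := Cmod z0 + 3).
  assert (Z0 := Cmod_ge_0 z0). assert (HZ : 3 <= Z) by (unfold Z; lra).
  assert (JK := jet_main_tail 1 k r z0 (le_n _) Hr ltac:(lra) Hz).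
  assert (JP := jet_pw (INR 1) k r z0 ltac:(simpl; lra) ltac:(lra) Hz).
  assert (JH := jet_error_tail 1 (density_error a b) Cb (3/2) k r z0 (le_n _) Hr ltac:(lra) Hz
    (density_error_0 a b) (density_sum _ _ _ _ _ _ H)).
  rewrite P1, Rmult_1_r in JK, JP, JH.
  assert (J2 := jet_sub2 z0 r ltac:(lra)).
  assert (JT := jet_plus _ _ _ _ _ _
     (jet_scal (RtoC b) _ _ _ _ (jet_plus _ _ _ _ _ _
        (jet_scal (RtoC 2) _ _ _ _ (jet_scal (RtoC (INR 1 ^ 2)) _ _ _ _ JP)) JK))
     (jet_mult _ _ _ _ _ _ (proj1 Hr) J2 JH)).
  eapply jet_le; [|exact JT].
  rewrite !Cmod_R. simpl INR. rewrite pow1, Rabs_R1, (Rabs_pos_eq 2) by lra.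
  fold CK. fold CH. fold Z.
  assert (ZZ : 1 <= Z ^ 2) by nra.
  assert (T2 : (Cmod z0 + r + 2) * (CH * (Cmod z0 + 1)) <= Z * (CH * Z)).
  { apply Rmult_le_compat; [lra|apply Rmult_le_pos; lra|unfold Z; lra|].
    apply Rmult_le_compat_l; [exact CH0|unfold Z; lra]. }
  nra.
Qed.

(** The series converge because [2 k - 1 > 5/2]. The third power of [|z0|] comes from the
    factor [(w - 2)^2] and the one power of [|w|] in the Abel-summed errors. *)
Lemma jet_cleared N a e b Ce Cb k r : regular_counts N a e b Ce Cb ->
  0 < r <= 1 / 2 -> 7 / 4 < k -> exists A, 0 <= A /\ forall z0, k + 2 * r <= Re z0 ->
  jet (cleared N a b) z0 r (A * (Cmod z0 + 3) ^ 3).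
Proof.
  intros H Hr Hk.
  destruct (jet_polar_part N a e b Ce Cb (2 * k - 2) (2 * r) H ltac:(lra) ltac:(lra))
    as [A1 [HA1 J1]].
  assert (SA := ex_series_density N a e b Ce Cb (2 * k - 1) H ltac:(lra)).
  assert (SE := ex_series_error N a e b Ce Cb (2 * k - 1) H ltac:(lra)).
  set (sa := fun i => a (S i) * Rpower (INR (S i)) (- (2 * k - 1))) in *.
  set (se := fun i => e (S i) * Rpower (INR (S i)) (- (2 * k - 1))) in *.
  assert (Hsa : 0 <= Series sa).
  { rewrite <- (Rmult_0_l (Series sa)), <- Series_scal_l. apply Series_le; [|exact SA].
    intros i. rewrite Rmult_0_l. split; [lra|]. apply Rmult_le_pos; [|left; apply Rpower_pos].
    apply (density_ge0 _ _ _ _ _ _ H). }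
  assert (Hse : 0 <= Series se).
  { rewrite <- (Rmult_0_l (Series se)), <- Series_scal_l. apply Series_le; [|exact SE].
    intros i. rewrite Rmult_0_l. split; [lra|]. apply Rmult_le_pos; [|left; apply Rpower_pos].
    apply (error_ge0 _ _ _ _ _ _ H). }
  assert (Hk1 : 0 < / (k - 1)) by (apply Rinv_0_lt_compat; lra).
  set (CK := 1440000 * (1 + / (k - 1)) * Series sa).
  set (CH := 120 * (1820 + 1800 / (k - 1)) * Series se).
  set (CD := 40 * (Series sa + Series se)).
  assert (CK0 : 0 <= CK) by (unfold CK; apply Rmult_le_pos; lra).
  assert (CH0 : 0 <= CH) by (unfold CH, Rdiv; apply Rmult_le_pos; lra).
  assert (CD0 : 0 <= CD) by (unfold CD; lra).
  exists (8 * A1 + 12 * CK + 36 * (2 * CH + CD)). split; [lra|].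
  intros z0 Hz.
  set (Z := Cmod z0 + 3).
  assert (Z0 := Cmod_ge_0 z0). assert (HZ : 3 <= Z) by (unfold Z; lra).
  assert (E2 : Cmod (RtoC 2) = 2) by (rewrite Cmod_R, Rabs_pos_eq; lra).
  assert (JP : jet (fun w => polar_part a b (2 * w + - RtoC 2)%C) z0 r
     (A1 * (Cmod (2 * z0 + - RtoC 2)%C + 3) ^ 2)).
  { apply (jet_affine (RtoC 2) (- RtoC 2)%C (polar_part a b)); rewrite E2; [|lra].
    apply J1. destruct z0; simpl in *; lra. }
  assert (JK : jet (fun w => CSeries (fun i => term_main a i w)) z0 r (CK * Z ^ 2)).
  { eapply jet_le; [|apply (jet_series (term_main a) z0 r
       (fun i => 1440000 * (1 + / (k - 1)) * Z ^ 2 * sa i))].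
    - rewrite Series_scal_l. right; unfold CK; ring.
    - lra.
    - intros i. apply (jet_term_main N a e b Ce Cb); try lra; exact H.
    - now apply ex_series_Rscal. }
  assert (JH : jet (fun w => CSeries (fun i => term_error N a i w)) z0 r (CH * (Cmod z0 + 1))).
  { eapply jet_le; [|apply (jet_series (term_error N a) z0 r
       (fun i => 120 * (1820 + 1800 / (k - 1)) * (Cmod z0 + 1) * se i))].
    - rewrite Series_scal_l. right; unfold CH; ring.
    - lra.
    - intros i. apply (jet_term_error N a e b Ce Cb); try lra; exact H.
    - now apply ex_series_Rscal. }
  assert (JD : jet (fun w => CSeries (fun i => term_diag N i w)) z0 r CD).
  { eapply jet_le; [|apply (jet_series (term_diag N) z0 r (fun i => 40 * (sa i + se i)))].
    - rewrite Series_scal_l, Series_plus by assumption. right; unfold CD; ring.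
    - lra.
    - intros i. apply (jet_term_diag N a e b Ce Cb); try lra; exact H.
    - apply ex_series_Rscal. now apply (ex_series_plus sa se). }
  assert (J2 := jet_sub2 z0 r ltac:(lra)).
  apply (jet_le _ _ _ (Cmod z0 + r + 2) Z) in J2; [|unfold Z; lra].
  assert (HR : 0 < r) by lra.
  assert (JT := jet_plus _ _ _ _ _ _ (jet_scal (RtoC 2) _ _ _ _ JP)
    (jet_plus _ _ _ _ _ _
      (jet_mult _ _ _ _ _ _ HR J2 (jet_scal (RtoC 2) _ _ _ _ JK))
      (jet_mult _ _ _ _ _ _ HR J2 (jet_mult _ _ _ _ _ _ HR J2
        (jet_plus _ _ _ _ _ _ (jet_scal (RtoC 2) _ _ _ _ JH) (jet_opp _ _ _ _ JD)))))).
  eapply jet_le; [|exact JT].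
  rewrite E2. fold Z.
  assert (HV := Cmod_affine2 z0). assert (V0 := Cmod_ge_0 (2 * z0 + - RtoC 2)%C).
  set (V := Cmod (2 * z0 + - RtoC 2)%C) in *.
  assert (T1 : A1 * (V + 3) ^ 2 <= A1 * (4 * Z ^ 2)).
  { apply Rmult_le_compat_l; [exact HA1|].
    replace (4 * Z ^ 2) with ((2 * Z) ^ 2) by ring. apply pow_incr. unfold Z; lra. }
  assert (ZZ : Z ^ 2 <= Z ^ 3) by nra.
  assert (T3 : CH * (Cmod z0 + 1) <= CH * Z) by (apply Rmult_le_compat_l; [lra|unfold Z; lra]).
  assert (T4 : CD <= CD * Z) by nra.
  assert (T5 : 6 * Z * (6 * Z * (2 * (CH * (Cmod z0 + 1)) + CD)) <=
    6 * Z * (6 * Z * (2 * (CH * Z) + CD * Z))) by nra.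
  apply Rle_trans with (2 * (A1 * (4 * Z ^ 2)) + (6 * Z * (2 * (CK * Z ^ 2))
     + 6 * Z * (6 * Z * (2 * (CH * Z) + CD * Z)))).
  - lra.
  -nra.
Qed.

(** At [w = 2] each [kterm] vanishes and every other contribution carries a factor
    [w - 2]. *)
Lemma cleared_at_pole N a b : cleared N a b (RtoC 2) = RtoC (4 * b).
Proof.
  assert (K0 : main_tail 1 (RtoC 2) = RtoC 0).
  { unfold main_tail, CSeries.
    assert (E : forall i, kterm (INR (1 + i)) (RtoC 2) = RtoC 0).
    { intros i. unfold kterm.
      assert (E : forall x, 1 <= x -> (RtoC (x ^ 2) * pw x (RtoC 2))%C = RtoC 1).
      { intros x Hx. rewrite pw_RtoC, <- RtoC_mult. f_equal.
        replace (x ^ 2) with (Rpower x 2)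
          by (apply Rpower_2; lra).
        rewrite <- Rpower_plus, Rplus_opp_r. apply Rpower_O. lra. }
      assert (Hi := INR_S_ge1 i). change (1 + i)%nat with (S i).
      rewrite !E by lra. ring. }
    rewrite (Series_ext _ (fun _ => 0 * 0)) by (intros i; rewrite E; simpl; ring).
    rewrite (Series_ext (fun n => Im _) (fun _ => 0 * 0)) by (intros i; rewrite E; simpl; ring).
    rewrite Series_scal_l, Rmult_0_l. reflexivity. }
  unfold cleared. replace (2 * RtoC 2 + - RtoC 2)%C with (RtoC 2) by ring.
  unfold polar_part. rewrite K0, pw_RtoC. simpl INR.
  assert (P1 : Rpower 1 (- (2)) = 1).
  { unfold Rpower. rewrite ln_1, Rmult_0_r. apply exp_0. }
  rewrite P1, pow1, RtoC_mult.
  replace (RtoC 4) with (RtoC 2 * RtoC 2)%C by (rewrite <- RtoC_mult; f_equal; ring). ring.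
Qed.

(** * Double Dirichlet series: convergence *)

Lemma abs_convergent_terms N a e b Ce Cb w : regular_counts N a e b Ce Cb -> 7 / 4 < Re w ->
  ex_series (fun i => Cmod (term_main a i w)) /\
  ex_series (fun i => Cmod (term_error N a i w)) /\
  ex_series (fun i => Cmod (term_diag N i w)).
Proof.
  intros H Hw.
  set (r := Rmin (1/2) ((Re w - 7/4) / 4)).
  assert (Hr0 : 0 < r) by (apply Rmin_pos; lra).
  assert (Hr1 : r <= 1/2) by apply Rmin_l.
  assert (Hr2 : r <= (Re w - 7/4) / 4) by apply Rmin_r.
  set (k := Re w - 2 * r).
  assert (Hk : 7/4 < k) by (unfold k; lra). assert (Hkr : k + 2 * r <= Re w) by (unfold k; lra).
  clearbody k.
  assert (SA := ex_series_density N a e b Ce Cb (2 * k - 1) H ltac:(lra)).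
  assert (SE := ex_series_error N a e b Ce Cb (2 * k - 1) H ltac:(lra)).
  set (sa := fun i => a (S i) * Rpower (INR (S i)) (- (2 * k - 1))) in *.
  set (se := fun i => e (S i) * Rpower (INR (S i)) (- (2 * k - 1))) in *.
  split; [|split].
  - eapply ex_series_dominated; [|exact (ex_series_Rscal
      (1440000 * (1 + / (k - 1)) * (Cmod w + 3) ^ 2) _ SA)].
    intros i; split; [apply Cmod_ge_0|].
    apply (jet_term_main N a e b Ce Cb i k r w H); lra.
  - eapply ex_series_dominated; [|exact (ex_series_Rscal
      (120 * (1820 + 1800 / (k - 1)) * (Cmod w + 1)) _ SE)].
    intros i; split; [apply Cmod_ge_0|].
    apply (jet_term_error N a e b Ce Cb i k r w H); lra.
  - eapply ex_series_dominated;
      [|exact (ex_series_Rscal 40 _ (ex_series_plus sa se SA SE))].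
    intros i; split; [apply Cmod_ge_0|].
    apply (jet_term_diag N a e b Ce Cb i k r w H); lra.
Qed.

(** Symmetry restricts a double sum to [m >= n], the range in which the row errors are
    summable. *)
Lemma csum_square_sym (f : nat -> nat -> C) (X : nat) :
  (forall i j, f i j = f j i) ->
  csum (seq 0 X) (fun i => csum (seq 0 X) (f i)) =
  (2 * csum (seq 0 X) (fun i => csum (seq 0 (X - i)) (fun j => f i (i + j)%nat))
   - csum (seq 0 X) (fun i => f i i))%C.
Proof.
  intros Hf. induction X as [|X IH]; [unfold csum; simpl; ring|].
  rewrite !(csum_seq_S X).
  assert (E1 : csum (seq 0 X) (fun i => csum (seq 0 (S X)) (f i)) =
    (csum (seq 0 X) (fun i => csum (seq 0 X) (f i)) + csum (seq 0 X) (f X))%C).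
  { rewrite <- csum_plus. apply csum_ext. intros i _. rewrite csum_seq_S, (Hf i X). reflexivity. }
  assert (E2 : csum (seq 0 X) (fun i => csum (seq 0 (S X - i)) (fun j => f i (i + j)%nat)) =
    (csum (seq 0 X) (fun i => csum (seq 0 (X - i)) (fun j => f i (i + j)%nat)) + csum (seq 0 X) (f X))%C).
  { rewrite <- csum_plus. apply csum_ext. intros i Hi. apply in_seq in Hi.
    replace (S X - i)%nat with (S (X - i)) by lia. rewrite csum_seq_S.
    replace (i + (X - i))%nat with X by lia. now rewrite (Hf i X). }
  rewrite E1, E2, IH. replace (S X - X)%nat with 1%nat by lia.
  unfold csum at 9; simpl map; simpl fold_right. rewrite Nat.add_0_r. ring.
Qed.

(** [w - 2] times the sum of row [n = S i] over [m >= n]. *)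
Definition row_value (N : nat -> nat -> R) (a : nat -> R) (i : nat) (w : C) : C :=
  (RtoC (a (S i)) * (2 * (RtoC (INR (S i) ^ 2) * pw (INR (S i)) w) + main_tail (S i) w)
   + (w - 2) * error_tail (S i) (row_error N a (S i)) w)%C.

Lemma row_tail N a e b Ce Cb i w : regular_counts N a e b Ce Cb -> 2 < Re w ->
  csums (fun j => (w - 2) * (RtoC (N (S i) (S i + j)%nat) * pw (INR (S i + j)) w))%C
    (row_value N a i w).
Proof.
  intros H Hw. apply (dirichlet_tail (S i) (N (S i)) (row_error N a (S i)) (a (S i)) (e (S i)) 1 w);
    try lra; try lia.
  - apply row_error_0.
  - intros m Hm. apply (row_error_bound N a e b Ce Cb); auto; lia.
  - intros m Hm. now apply row_error_step.
Qed.

Lemma row_value_split N a i w :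
  (pw (INR (S i)) w * row_value N a i w)%C =
  (2 * (RtoC (a (S i)) * pw (INR (S i)) (2 * w + - RtoC 2)) + (term_main a i w + (w - 2) * term_error N a i w))%C.
Proof.
  assert (E : pw (INR (S i)) (2 * w + - RtoC 2)%C =
     (RtoC (INR (S i) ^ 2) * (pw (INR (S i)) w * pw (INR (S i)) w))%C).
  { assert (HS := INR_S_ge1 i).
    replace (2 * w + - RtoC 2)%C with (w + w + RtoC (- (2)))%C by (rewrite RtoC_opp; ring).
    rewrite !pw_plus, pw_RtoC, Ropp_involutive, Rpower_2 by lra. ring. }
  rewrite E. unfold row_value, term_main, term_error. ring.
Qed.

Lemma ex_series_row N a e b Ce Cb w : regular_counts N a e b Ce Cb -> 2 < Re w ->
  ex_series (fun i => Cmod (pw (INR (S i)) w * row_value N a i w)%C).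
Proof.
  intros H Hw. destruct (abs_convergent_terms N a e b Ce Cb w H ltac:(lra)) as [SK [SH _]].
  assert (SA := ex_series_density N a e b Ce Cb (2 * Re w - 2) H ltac:(lra)).
  apply ex_series_dominated with (fun i => 2 * (a (S i) * Rpower (INR (S i)) (- (2 * Re w - 2)))
    + (Cmod (term_main a i w) + Cmod (w - 2)%C * Cmod (term_error N a i w))).
  - intros i; split; [apply Cmod_ge_0|]. rewrite row_value_split.
    eapply Rle_trans; [apply Cmod_triangle|]. apply Rplus_le_compat.
    + rewrite !Cmod_mult, Cmod_pw, !Cmod_R, Rabs_pos_eq, Rabs_pos_eq; try lra.
      2: apply (density_ge0 _ _ _ _ _ _ H).
      right. do 3 f_equal. destruct w; simpl. ring.
    + rewrite <- Cmod_mult. apply Cmod_triangle.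
  - apply (ex_series_plus (fun i => 2 * (a (S i) * Rpower (INR (S i)) (- (2 * Re w - 2))))).
    + now apply ex_series_Rscal.
    + apply (ex_series_plus (fun i => Cmod (term_main a i w))); [exact SK|]. now apply ex_series_Rscal.
Qed.

Lemma ctends_shift (u : nat -> C) (l : C) (k : nat) :
  ctends u l -> ctends (fun X => u (X - k)%nat) l.
Proof.
  rewrite !ctends_eps. intros H e He. destruct (H e He) as [M HM].
  exists (M + k)%nat. intros n Hn. apply HM. lia.
Qed.

(** At a real exponent the terms are nonnegative, so partial sums stay below the limit. *)
Lemma row_partial_le N a e b Ce Cb i s Y : regular_counts N a e b Ce Cb -> 2 < s ->
  rsum (seq 0 Y) (fun j => N (S i) (S i + j)%nat * Rpower (INR (S i + j)) (- s))
   <= Cmod (row_value N a i (RtoC s)) / (s - 2).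
Proof.
  intros H Hs. assert (T := row_tail N a e b Ce Cb i (RtoC s) H Hs).
  apply ctends_Re in T.
  assert (L : is_lim_seq (fun n => (s - 2) * rsum (seq 0 n)
     (fun j => N (S i) (S i + j)%nat * Rpower (INR (S i + j)) (- s))) (Re (row_value N a i (RtoC s)))).
  { eapply is_lim_seq_ext; [|exact T]. intros n. cbv beta.
    rewrite (csum_ext _ _ (fun j => RtoC ((s - 2) * (N (S i) (S i + j)%nat * Rpower (INR (S i + j)) (- s))))).
    - rewrite csum_RtoC, rsum_scal. reflexivity.
    - intros j _. rewrite pw_RtoC, !RtoC_mult, RtoC_minus. ring. }
  assert (B := is_lim_seq_incr_compare _ _ L).
  assert (HB : (s - 2) * rsum (seq 0 Y) (fun j => N (S i) (S i + j)%nat * Rpower (INR (S i + j)) (- s))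
     <= Cmod (row_value N a i (RtoC s))).
  { eapply Rle_trans; [apply B|].
    - intros n. rewrite rsum_seq_S.
      assert (P := Rpower_pos (INR (S i + n)) (- s)).
      assert (Q := counts_ge0 _ _ _ _ _ _ H (S i) (S i + n)%nat).
      apply Rmult_le_compat_l; [lra|].
      assert (0 <= N (S i) (S i + n)%nat * Rpower (INR (S i + n)) (- s)) by (apply Rmult_le_pos; lra). lra.
    - eapply Rle_trans; [apply Rle_abs|apply Re_le_Cmod]. }
  apply Rmult_le_reg_l with (s - 2); [lra|].
  replace ((s - 2) * (Cmod (row_value N a i (RtoC s)) / (s - 2)))
    with (Cmod (row_value N a i (RtoC s))) by (field; lra). exact HB.
Qed.

Definition box (N : nat -> nat -> R) (w : C) (X : nat) : C :=
  csum (seq 0 X) (fun i => csum (seq 0 X)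
    (fun j => RtoC (N (S i) (S j)) * (pw (INR (S i)) w * pw (INR (S j)) w))%C).

(** Dominated convergence over the rows: each row is bounded by its own value at the real
    exponent [Re w]. *)
Lemma box_limit N a e b Ce Cb w : regular_counts N a e b Ce Cb -> 2 < Re w ->
  ctends (box N w) (cleared N a b w / ((w - 2) * (w - 2)))%C.
Proof.
  intros H Hw. destruct (abs_convergent_terms N a e b Ce Cb w H ltac:(lra)) as [SK [SH SD]].
  assert (W2 : (w - 2)%C <> RtoC 0).
  { intros E. assert (E' : w = RtoC 2) by (replace w with (w - 2 + 2)%C by ring; rewrite E; ring).
    rewrite E' in Hw. simpl in Hw. lra. }
  set (u := (w - 2)%C) in *.
  set (c := fun X i => (pw (INR (S i)) w *
     csum (seq 0 (X - i)) (fun j => RtoC (N (S i) (S i + j)%nat) * pw (INR (S i + j)) w))%C).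
  set (c' := fun i => (/ u * (pw (INR (S i)) w * row_value N a i w))%C).
  set (be := fun i => Cmod (pw (INR (S i)) (RtoC (Re w)) * row_value N a i (RtoC (Re w)))%C * / (Re w - 2)).
  assert (Hbe : ex_series be).
  { apply (ex_series_scal_r (/ (Re w - 2))). now apply (ex_series_row N a e b Ce Cb). }
  assert (Hcb : forall X i, Cmod (c X i) <= be i).
  { intros X i. unfold c, be. rewrite !Cmod_mult, !Cmod_pw, Rmult_assoc.
    apply Rmult_le_compat_l; [left; apply Rpower_pos|].
    eapply Rle_trans; [apply Cmod_csum|].
    eapply Rle_trans; [|apply (row_partial_le N a e b Ce Cb i (Re w) (X - i) H Hw)].
    apply rsum_le. intros j _. rewrite Cmod_mult, Cmod_pw, Cmod_R, Rabs_pos_eq; [lra|].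
    apply (counts_ge0 _ _ _ _ _ _ H). }
  assert (Hcl : forall i, ctends (fun X => c X i) (c' i)).
  { intros i. unfold c, c'.
    assert (T := row_tail N a e b Ce Cb i w H Hw). fold u in T.
    replace (/ u * (pw (INR (S i)) w * row_value N a i w))%C
      with (pw (INR (S i)) w * (/ u * row_value N a i w))%C by ring.
    apply ctends_scal.
    apply (ctends_shift (fun Y => csum (seq 0 Y)
      (fun j => RtoC (N (S i) (S i + j)%nat) * pw (INR (S i + j)) w)%C) (/ u * row_value N a i w)%C i).
    eapply ctends_ext; [|apply (ctends_scal (/ u)%C _ _ T)].
    intros n. cbv beta. rewrite <- csum_scal. apply csum_ext. intros j _. field. exact W2. }
  assert (TT := tannery c c' be Hcb Hbe Hcl).
  (* the two Abel summations assemble into [cleared] *)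
  assert (Sc' : csums c' (CSeries c')).
  { apply CSeries_correct. eapply ex_series_dominated; [|exact Hbe].
    intros i; split; [apply Cmod_ge_0|]. apply (ctends_Cmod_le _ _ _ (Hcl i)). intros X; apply Hcb. }
  assert (Spol : csums (fun i => (2 * w + - RtoC 2 - 2) *
      (RtoC (a (1 + i)%nat) * pw (INR (1 + i)) (2 * w + - RtoC 2)))%C (polar_part a b (2 * w + - RtoC 2)%C)).
  { apply (dirichlet_tail 1 a (density_error a b) b Cb (3/2)); try lra; try lia.
    - destruct w; simpl in *; lra.
    - destruct w; simpl in *; lra.
    - apply density_error_0.
    - apply (density_sum _ _ _ _ _ _ H).
    - intros m Hm. now apply density_error_step. }
  assert (E1 : CSeries c' = (/ (u * u) * polar_part a b (2 * w + - RtoC 2)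
      + (/ u * CSeries (fun i => term_main a i w) + CSeries (fun i => term_error N a i w)))%C).
  { apply (csums_unique c'); [exact Sc'|].
    assert (Q := csums_plus _ _ _ _ (csums_scal (/ (u * u))%C _ _ Spol)
       (csums_plus _ _ _ _ (csums_scal (/ u)%C _ _ (CSeries_correct _ SK)) (CSeries_correct _ SH))).
    eapply csums_ext; [|exact Q]. intros i. cbv beta. unfold c'. rewrite row_value_split.
    change (1 + i)%nat with (S i).
    replace (2 * w + - RtoC 2 - 2)%C with (2 * u)%C by (unfold u; ring).
    fold u. field. exact W2. }
  eapply ctends_ext with (fun X => 2 * csum (seq 0 X) (c X) + (- RtoC 1) * csum (seq 0 X) (fun i => term_diag N i w))%C.
  { intros X. unfold box. rewrite csum_square_sym.
    2:{ intros i j. rewrite (counts_sym _ _ _ _ _ _ H (S i)). ring. }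
    assert (Ec : csum (seq 0 X) (c X) = csum (seq 0 X) (fun i => csum (seq 0 (X - i))
      (fun j => RtoC (N (S i) (S (i + j))) * (pw (INR (S i)) w * pw (INR (S (i + j))) w))%C)).
    { apply csum_ext. intros i _. unfold c. rewrite <- csum_scal. apply csum_ext.
      intros j _. change (S i + j)%nat with (S (i + j)). ring. }
    assert (Ed : csum (seq 0 X) (fun i => term_diag N i w) = csum (seq 0 X)
      (fun i => RtoC (N (S i) (S i)) * (pw (INR (S i)) w * pw (INR (S i)) w))%C).
    { apply csum_ext. intros i _. unfold term_diag.
      replace (2 * w + 0)%C with (w + w)%C by ring. now rewrite pw_plus. }
    rewrite Ec, Ed. ring. }
  replace (cleared N a b w / (u * u))%C with
    (2 * CSeries c' + (- RtoC 1) * CSeries (fun i => term_diag N i w))%C.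
  - apply ctends_plus; apply ctends_scal; [exact TT|]. now apply CSeries_correct.
  - rewrite E1. unfold cleared. fold u. field. exact W2.
Qed.

Lemma box_bounded N a e b Ce Cb s : regular_counts N a e b Ce Cb -> 2 < s ->
  exists M, forall X, rsum (seq 0 X) (fun i => rsum (seq 0 X)
    (fun j => N (S i) (S j) * (Rpower (INR (S i)) (- s) * Rpower (INR (S j)) (- s)))) <= M.
Proof.
  intros H Hs. assert (L := box_limit N a e b Ce Cb (RtoC s) H Hs).
  apply ctends_Re in L. set (M := Re _) in L. exists M.
  set (f := fun X => rsum (seq 0 X) (fun i => rsum (seq 0 X)
    (fun j => N (S i) (S j) * (Rpower (INR (S i)) (- s) * Rpower (INR (S j)) (- s))))).
  assert (L' : is_lim_seq f M).
  { eapply is_lim_seq_ext; [|exact L]. intros X. cbv beta. unfold box, f.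
    match goal with |- Re ?z = ?x => replace z with (RtoC x); [reflexivity|] end.
    rewrite <- csum_RtoC. apply csum_ext. intros i _.
    rewrite <- csum_RtoC. apply csum_ext. intros j _. rewrite !pw_RtoC, !RtoC_mult. reflexivity. }
  intros X. apply (is_lim_seq_incr_compare f M L').
  intros n. unfold f.
  assert (P : forall i j, 0 <= N (S i) (S j) * (Rpower (INR (S i)) (- s) * Rpower (INR (S j)) (- s))).
  { intros i j. apply Rmult_le_pos; [apply (counts_ge0 _ _ _ _ _ _ H)|].
    apply Rmult_le_pos; left; apply Rpower_pos. }
  rewrite (rsum_seq_S n (fun i => rsum (seq 0 (S n)) _)).
  assert (Q := rsum_nonneg (seq 0 (S n)) (fun j => N (S n) (S j) *
    (Rpower (INR (S n)) (- s) * Rpower (INR (S j)) (- s))) (fun j _ => P n j)).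
  match goal with |- _ <= ?A + _ => apply Rle_trans with A; [|lra] end.
  apply rsum_le. intros i _. rewrite rsum_seq_S. specialize (P i n). lra.
Qed.

(** * The zeta function and unordered sums *)

Definition zeta (w : C) : C := CSeries (fun i => pw (INR (S i)) w).

Lemma zeta_abs (w : C) : 1 < Re w -> ex_series (fun i => Cmod (pw (INR (S i)) w)).
Proof.
  intros Hw. eapply ex_series_dominated; [|apply (ex_series_Rpower (Re w) 1 Hw (le_n _))].
  intros i; split; [apply Cmod_ge_0|]. rewrite Cmod_pw. right; reflexivity.
Qed.

Lemma zeta_quad (w : C) : 1 < Re w -> quad zeta w.
Proof.
  intros Hw. set (r := (Re w - 1) / 4). set (k := Re w - 2 * r).
  assert (Hr : 0 < r) by (unfold r; lra).
  assert (Hk : 1 < k) by (unfold k, r; lra).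
  apply (jet_quad _ _ r (Series (fun i => 20 * Rpower (INR (1 + i)) (- k))) Hr).
  apply (jet_series (fun i => pw (INR (S i)))); [exact Hr| |].
  - intros i. change (1 + i)%nat with (S i). apply jet_pw; [apply INR_S_ge1|exact Hr|unfold k; lra].
  - apply ex_series_Rscal. now apply ex_series_Rpower.
Qed.

Lemma Rpower_74_le (n q : R) : 0 < n -> 0 < q -> 1 <= q ^ 4 * n ^ 7 -> Rpower n (- (7 / 4)) <= q.
Proof.
  intros Hn Hq H. apply Rnot_lt_le. intros Hlt.
  set (x := Rpower n (- (7 / 4))) in *.
  assert (E : x ^ 4 * n ^ 7 = 1).
  { unfold x. rewrite <- (Rpower_pow 4) by apply Rpower_pos.
    rewrite <- (Rpower_pow 7) by exact Hn. rewrite Rpower_mult, <- Rpower_plus.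
    replace (- (7 / 4) * INR 4 + INR 7) with 0 by (simpl; lra). now apply Rpower_O. }
  assert (q ^ 4 < x ^ 4).
  { assert (q ^ 2 < x ^ 2) by nra.
    replace (q ^ 4) with (q ^ 2 * q ^ 2) by ring. replace (x ^ 4) with (x ^ 2 * x ^ 2) by ring. nra. }
  nra.
Qed.

(** The terms from [n = 16] on are compared with an integral; the earlier ones have
    explicit rational bounds. *)
Lemma zeta_74_tail (N : nat) :
  rsum (seq 0 N) (fun i => Rpower (INR (2 + i)) (- (7 / 4))) <= 98 / 100.
Proof.
  apply Rle_trans with (rsum (seq 0 (14 + N)) (fun i => Rpower (INR (2 + i)) (- (7 / 4)))).
  { apply rsum_incl; [apply seq_NoDup| |intros; left; apply Rpower_pos].
    intros i. rewrite !in_seq. lia. }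
  rewrite seq_app, rsum_app.
  assert (T := Rpower_tail_sharp (7/4) 16 N ltac:(lra) ltac:(lia)).
  assert (E : rsum (seq (0 + 14) N) (fun i => Rpower (INR (2 + i)) (- (7 / 4))) =
              rsum (seq 0 N) (fun i => Rpower (INR (16 + i)) (- (7 / 4)))).
  { clear. change 16%nat with (2 + 14)%nat.
    generalize 14%nat. intros k. revert k. induction N as [|N IH]; intros k; [reflexivity|].
    rewrite !seq_S, !rsum_app, IH.
    reflexivity. }
  rewrite E. clear E.
  assert (P1 : Rpower (INR 16) (- (7 / 4)) <= 1 / 128).
  { apply Rpower_74_le; simpl; lra. }
  assert (P2 : Rpower (INR 16) (1 - 7 / 4) <= 1 / 8).
  { replace (INR 16) with (Rpower 2 4).
    - rewrite Rpower_mult. replace (4 * (1 - 7/4)) with (- (INR 3)) by (simpl; lra).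
      rewrite Rpower_Ropp, Rpower_pow by lra. simpl; lra.
    - replace 4 with (INR 4) by (simpl; lra). rewrite Rpower_pow by lra. simpl; lra. }
  assert (I : / (7 / 4 - 1) = 4 / 3) by field. rewrite I in T.
  assert (Q : rsum (seq 0 14) (fun i => Rpower (INR (2 + i)) (- (7 / 4))) <=
    298/1000 + 147/1000 + 89/1000 + 60/1000 + 44/1000 + 34/1000 + 27/1000 + 22/1000
     + 18/1000 + 16/1000 + 13/1000 + 12/1000 + 10/1000 + 9/1000).
  { unfold rsum. simpl map. simpl fold_right.
    assert (B : forall n q, (0 < n)%nat -> 0 < q -> 1 <= q ^ 4 * INR n ^ 7 ->
       Rpower (INR n) (- (7/4)) <= q).
    { intros n q Hn. apply Rpower_74_le. now apply lt_0_INR. }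
    assert (B2 := B 2%nat (298/1000) ltac:(lia) ltac:(lra) ltac:(simpl; lra)).
    assert (B3 := B 3%nat (147/1000) ltac:(lia) ltac:(lra) ltac:(simpl; lra)).
    assert (B4 := B 4%nat (89/1000) ltac:(lia) ltac:(lra) ltac:(simpl; lra)).
    assert (B5 := B 5%nat (60/1000) ltac:(lia) ltac:(lra) ltac:(simpl; lra)).
    assert (B6 := B 6%nat (44/1000) ltac:(lia) ltac:(lra) ltac:(simpl; lra)).
    assert (B7 := B 7%nat (34/1000) ltac:(lia) ltac:(lra) ltac:(simpl; lra)).
    assert (B8 := B 8%nat (27/1000) ltac:(lia) ltac:(lra) ltac:(simpl; lra)).
    assert (B9 := B 9%nat (22/1000) ltac:(lia) ltac:(lra) ltac:(simpl; lra)).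
    assert (B10 := B 10%nat (18/1000) ltac:(lia) ltac:(lra) ltac:(simpl; lra)).
    assert (B11 := B 11%nat (16/1000) ltac:(lia) ltac:(lra) ltac:(simpl; lra)).
    assert (B12 := B 12%nat (13/1000) ltac:(lia) ltac:(lra) ltac:(simpl; lra)).
    assert (B13 := B 13%nat (12/1000) ltac:(lia) ltac:(lra) ltac:(simpl; lra)).
    assert (B14 := B 14%nat (10/1000) ltac:(lia) ltac:(lra) ltac:(simpl; lra)).
    assert (B15 := B 15%nat (9/1000) ltac:(lia) ltac:(lra) ltac:(simpl; lra)).
    clear B. simpl INR in *. lra. }
  lra.
Qed.

(** The terms after the first add up to at most [98/100]. *)
Lemma zeta_lower (w : C) : 7 / 4 <= Re w -> 1 / 50 <= Cmod (zeta w).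
Proof.
  intros Hw.
  assert (Z := CSeries_correct _ (zeta_abs w ltac:(lra))). fold (zeta w) in Z.
  apply Rnot_lt_le. intros Hlt.
  assert (B : Cmod (zeta w - 1)%C <= 98 / 100).
  { apply (ctends_Cmod_le (fun X => csum (seq 0 (S X)) (fun i => pw (INR (S i)) w) - 1)%C).
    - apply ctends_plus; [|apply ctends_const].
      rewrite ctends_eps. unfold csums in Z. rewrite ctends_eps in Z.
      intros e He. destruct (Z e He) as [M HM]. exists M. intros n Hn. apply HM. lia.
    - intros X. simpl seq. rewrite <- seq_shift.
      change (csum (0%nat :: map S (seq 0 X)) (fun i => pw (INR (S i)) w))
        with (pw (INR 1) w + csum (map S (seq 0 X)) (fun i => pw (INR (S i)) w))%C.
      assert (E1 : pw (INR 1) w = RtoC 1).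
      { rewrite pw_exp. simpl INR. rewrite ln_1.
        replace (- (RtoC 0 * w))%C with (RtoC 0) by ring. apply Cexp_0. }
      rewrite E1, csum_map.
      replace (1 + csum (seq 0 X) (fun t => pw (INR (S (S t))) w) - 1)%C
        with (csum (seq 0 X) (fun t => pw (INR (S (S t))) w)) by ring.
      eapply Rle_trans; [apply Cmod_csum|].
      eapply Rle_trans; [|apply (zeta_74_tail X)].
      apply rsum_le. intros i _. rewrite Cmod_pw. change (2 + i)%nat with (S (S i)).
      apply Rle_Rpower; [apply INR_S_ge1|lra]. }
  assert (T := Cmod_triangle (zeta w)%C (- (zeta w - 1))%C).
  replace (zeta w + - (zeta w - 1))%C with (RtoC 1) in T by ring.
  rewrite Cmod_opp, Cmod_1 in T. lra.
Qed.

Lemma abs_summable_sub {T} (P Q : T -> Prop) (f : T -> C) :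
  (forall t, Q t -> P t) -> absolutely_summable P f -> absolutely_summable Q f.
Proof.
  intros H [M HM]. exists M. intros l [Hn Hl]. apply HM. split; [exact Hn|].
  eapply Forall_impl; [exact H|exact Hl].
Qed.

(** Some finite set almost attains the supremum of the absolute sums, and little mass is
    left outside it. *)
Lemma abs_summable_tail {T} (P : T -> Prop) (f : T -> C) (eps : R) :
  absolutely_summable P f -> 0 < eps ->
  exists l0, finite_subset P l0 /\
    forall l, finite_subset P l -> (forall t, In t l -> ~ In t l0) ->
      rsum l (fun t => Cmod (f t)) < eps.
Proof.
  intros [M HM] He.
  destruct (completeness (fun x => exists l, finite_subset P l /\ x = rsum l (fun t => Cmod (f t))))
    as [s [Hs1 Hs2]].
  - exists M. intros x [l [Hl ->]]. now apply HM.
  - exists 0, nil. split; [split; constructor|reflexivity].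
  - destruct (Classical_Prop.classic (exists l, finite_subset P l /\ s - eps < rsum l (fun t => Cmod (f t))))
      as [[l0 [Hl0 H0]]|Hno].
    + exists l0. split; [exact Hl0|]. intros l Hl Hd.
      assert (H1 : rsum (l0 ++ l) (fun t => Cmod (f t)) <= s).
      { apply Hs1. exists (l0 ++ l). split; [|reflexivity].
        destruct Hl0 as [N0 F0], Hl as [N1 F1]. split.
        - apply NoDup_app; auto. intros t Ht Ht'. exact (Hd t Ht' Ht).
        - now apply Forall_app. }
      rewrite rsum_app in H1. lra.
    + exfalso. assert (s <= s - eps); [|lra].
      apply Hs2. intros x [l [Hl ->]]. apply Rnot_lt_le. intros Hlt. apply Hno. eauto.
Qed.

Definition exhausts {T} (P : T -> Prop) (L : nat -> list T) : Prop :=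
  (forall X, finite_subset P (L X)) /\
  (forall t, P t -> exists X0, forall X, (X0 <= X)%nat -> In t (L X)).

Lemma exhausts_incl {T} (P : T -> Prop) (L : nat -> list T) (l : list T) :
  exhausts P L -> List.Forall P l -> exists X0, forall X, (X0 <= X)%nat -> incl l (L X).
Proof.
  intros [_ HL] Hl. induction Hl as [|t l Ht Hl [X1 IH]].
  - exists 0%nat. intros X _ t [].
  - destruct (HL t Ht) as [X2 H2]. exists (X1 + X2)%nat. intros X HX u [<-|Hu].
    + apply H2; lia.
    + apply (IH X); [lia|exact Hu].
Qed.

Lemma NoDup_app_disjoint {T} (l l' : list T) (t : T) :
  NoDup (l ++ l') -> In t l -> In t l' -> False.
Proof.
  intros H Hl Hl'. destruct (in_split t l' Hl') as [l1 [l2 ->]].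
  rewrite app_assoc in H. apply NoDup_remove_2 in H. apply H.
  apply in_or_app; left. apply in_or_app; now left.
Qed.

Lemma NoDup_flat_map {T U} (h : T -> list U) (l : list T) :
  NoDup l -> (forall t, In t l -> NoDup (h t)) ->
  (forall t t' u, In t l -> In t' l -> In u (h t) -> In u (h t') -> t = t') ->
  NoDup (flat_map h l).
Proof.
  induction 1 as [|a l Ha Hl IH]; intros H1 H2; [constructor|].
  simpl. apply NoDup_app.
  - apply H1; now left.
  - apply IH; [intros; apply H1; now right|].
    intros t t' u Ht Ht'. apply H2; now right.
  - intros u Hu Hu'. apply in_flat_map in Hu'. destruct Hu' as [t [Ht Hut]].
    apply Ha. rewrite (H2 a t u); auto; [now left|now right].
Qed.

Lemma NoDup_list_prod {T U} (l : list T) (l' : list U) :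
  NoDup l -> NoDup l' -> NoDup (list_prod l l').
Proof.
  intros Hl Hl'. induction Hl as [|a l Ha Hl IH]; [constructor|].
  simpl. apply NoDup_app; [|exact IH|].
  - apply NoDup_map_NoDup_ForallPairs; [|exact Hl'].
    intros x y _ _ E. congruence.
  - intros [x y] H1 H2. apply in_map_iff in H1. destruct H1 as [z [E _]].
    apply in_prod_iff in H2. inversion E; subst. tauto.
Qed.

(** Enlarging a finite set that already carries almost all of the absolute mass changes the
    sum little. *)
Lemma csum_enlarge {T} (P : T -> Prop) (f : T -> C) (l0 l1 l : list T) (eps : R) :
  (forall l, finite_subset P l -> (forall t, In t l -> ~ In t l0) ->
      rsum l (fun t => Cmod (f t)) < eps) ->
  finite_subset P l1 -> finite_subset P l -> incl l0 l1 -> incl l1 l ->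
  Cmod (csum l f - csum l1 f)%C < eps.
Proof.
  intros H [N1 F1] [N F] H01 H1.
  destruct (NoDup_incl_split l1 l N1 H1) as [r Hr].
  rewrite (csum_perm _ _ f Hr), csum_app.
  replace (csum l1 f + csum r f - csum l1 f)%C with (csum r f) by ring.
  eapply Rle_lt_trans; [apply Cmod_csum|]. apply H.
  - assert (Nr := Permutation_NoDup Hr N). assert (Fr := Permutation_Forall Hr F).
    split.
    + apply NoDup_app_remove_l in Nr. exact Nr.
    + now apply Forall_app in Fr.
  - intros t Ht Ht0. assert (Nr := Permutation_NoDup Hr N).
    apply (NoDup_app_disjoint l1 r t Nr); auto.
Qed.

Lemma has_sum_exhaust {T} (P : T -> Prop) (f : T -> C) (L : nat -> list T) (S : C) :
  absolutely_summable P f -> exhausts P L -> ctends (fun X => csum (L X) f) S ->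
  has_sum P f S.
Proof.
  intros Ha HL Hc eps He. rewrite ctends_eps in Hc.
  destruct (Hc (eps / 2)) as [N HN]; [lra|].
  destruct (abs_summable_tail P f (eps / 2) Ha) as [l0 [Hl0 Ht]]; [lra|].
  destruct (exhausts_incl P L l0 HL (proj2 Hl0)) as [X0 HX].
  set (X := (N + X0)%nat). exists (L X). split; [apply HL|].
  intros l Hl Hi. change (Cmod (csum l f - S)%C < eps).
  assert (Q1 := csum_enlarge P f l0 (L X) l (eps / 2) Ht (proj1 HL X) Hl
     (HX X ltac:(unfold X; lia)) Hi).
  assert (Q2 := HN X ltac:(unfold X; lia)).
  replace (csum l f - S)%C with ((csum l f - csum (L X) f) + (csum (L X) f - S))%C by ring.
  eapply Rle_lt_trans; [apply Cmod_triangle|]. lra.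
Qed.

Lemma has_sum_ctends {T} (P : T -> Prop) (f : T -> C) (L : nat -> list T) (S : C) :
  has_sum P f S -> exhausts P L -> ctends (fun X => csum (L X) f) S.
Proof.
  intros Hs HL. apply ctends_eps. intros e He. destruct (Hs e He) as [l0 [Hl0 H]].
  destruct (exhausts_incl P L l0 HL (proj2 Hl0)) as [X0 HX].
  exists X0. intros X HX0. apply (H (L X)); [apply HL|now apply HX].
Qed.

Lemma Cauchy_ctends (u : nat -> C) :
  (forall eps, 0 < eps -> exists N, forall n m, (N <= n)%nat -> (N <= m)%nat ->
     Cmod (u n - u m)%C < eps) -> exists S, ctends u S.
Proof.
  intros H.
  assert (A : forall p : C -> R, (forall z z', Rabs (p z - p z') <= Cmod (z - z')%C) ->
     exists l : R, is_lim_seq (fun n => p (u n)) l).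
  { intros p Hp.
    apply ex_lim_seq_cauchy_corr. intros eps. destruct (H eps (cond_pos eps)) as [N HN].
    exists N. intros n m Hn Hm. eapply Rle_lt_trans; [apply Hp|now apply HN]. }
  destruct (A Re) as [a Ha]. { intros z z'. apply (Re_le_Cmod (z - z')%C). }
  destruct (A Im) as [b Hb]. { intros z z'. apply (Im_le_Cmod (z - z')%C). }
  exists (a, b). now apply ctends_pair.
Qed.

Lemma abs_summable_ctends {T} (P : T -> Prop) (f : T -> C) (L : nat -> list T) :
  absolutely_summable P f -> exhausts P L -> exists S, ctends (fun X => csum (L X) f) S.
Proof.
  intros Ha HL. apply Cauchy_ctends. intros eps He.
  destruct (abs_summable_tail P f (eps / 2) Ha) as [l0 [Hl0 Ht]]; [lra|].
  destruct (exhausts_incl P L l0 HL (proj2 Hl0)) as [X0 HX].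
  exists X0. intros n m Hn Hm.
  assert (Q1 := csum_enlarge P f l0 l0 (L n) (eps / 2) Ht Hl0 (proj1 HL n) (incl_refl _) (HX n Hn)).
  assert (Q2 := csum_enlarge P f l0 l0 (L m) (eps / 2) Ht Hl0 (proj1 HL m) (incl_refl _) (HX m Hm)).
  replace (csum (L n) f - csum (L m) f)%C with
    ((csum (L n) f - csum l0 f) + - (csum (L m) f - csum l0 f))%C by ring.
  eapply Rle_lt_trans; [apply Cmod_triangle|]. rewrite Cmod_opp. lra.
Qed.

(** * Orthogonal pairs and their primitive parts *)

Definition zrange (n : nat) : list Z :=
  map (fun i => (Z.of_nat i - Z.of_nat n)%Z) (seq 0 (2 * n + 1)).

Lemma in_zrange (n : nat) (z : Z) : In z (zrange n) <-> (Z.abs z <= Z.of_nat n)%Z.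
Proof.
  unfold zrange. rewrite in_map_iff. split.
  - intros [i [<- Hi]]. apply in_seq in Hi. lia.
  - intros H. exists (Z.to_nat (z + Z.of_nat n)). rewrite in_seq. lia.
Qed.

Lemma NoDup_zrange (n : nat) : NoDup (zrange n).
Proof.
  apply NoDup_map_NoDup_ForallPairs; [|apply seq_NoDup].
  intros i j _ _ E. lia.
Qed.

Lemma length_zrange (n : nat) : length (zrange n) = (2 * n + 1)%nat.
Proof. unfold zrange. now rewrite length_map, length_seq. Qed.

Definition zbox (n : nat) : list vec3 :=
  list_prod (list_prod (zrange n) (zrange n)) (zrange n).

Lemma in_zbox (n : nat) (x : vec3) : In x (zbox n) <-> (vnorm x <= Z.of_nat n)%Z.
Proof.
  destruct x as [[x0 x1] x2]. unfold zbox, vec3. rewrite !in_prod_iff, !in_zrange.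
  unfold vnorm. lia.
Qed.

Lemma NoDup_zbox (n : nat) : NoDup (zbox n).
Proof. repeat apply NoDup_list_prod; apply NoDup_zrange. Qed.

Lemma vnorm_ge0 (x : vec3) : (0 <= vnorm x)%Z.
Proof. destruct x as [[x0 x1] x2]. unfold vnorm. lia. Qed.

Definition shell (n : nat) : list vec3 :=
  filter (fun x => Z.eqb (vnorm x) (Z.of_nat n)) (zbox n).

Lemma in_shell (n : nat) (x : vec3) : In x (shell n) <-> vnorm x = Z.of_nat n.
Proof. unfold shell. rewrite filter_In, in_zbox, Z.eqb_eq. lia. Qed.

Lemma NoDup_shell (n : nat) : NoDup (shell n).
Proof. apply NoDup_filter, NoDup_zbox. Qed.

(** Listed shell by shell, so that sums over it are sums over the norm. *)
Definition ball (n : nat) : list vec3 := flat_map (fun i => shell (S i)) (seq 0 n).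

Lemma in_ball (n : nat) (x : vec3) :
  In x (ball n) <-> (0 < vnorm x <= Z.of_nat n)%Z.
Proof.
  unfold ball. rewrite in_flat_map. split.
  - intros [i [Hi Hx]]. apply in_seq in Hi. apply in_shell in Hx. lia.
  - intros H. exists (Z.to_nat (vnorm x - 1)). rewrite in_seq, in_shell. lia.
Qed.

Lemma NoDup_ball (n : nat) : NoDup (ball n).
Proof.
  apply NoDup_flat_map; [apply seq_NoDup|intros; apply NoDup_shell|].
  intros i j x _ _ Hi Hj. apply in_shell in Hi, Hj. lia.
Qed.

Definition orth (x y : vec3) : R := if Z.eqb (dot x y) 0 then 1 else 0.

Lemma dot_comm (x y : vec3) : dot x y = dot y x.
Proof. destruct x as [[x0 x1] x2], y as [[y0 y1] y2]. unfold dot. ring. Qed.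

Lemma orth_comm (x y : vec3) : orth x y = orth y x.
Proof. unfold orth. now rewrite dot_comm. Qed.

Lemma orth_ge0 (x y : vec3) : 0 <= orth x y.
Proof. unfold orth. destruct (Z.eqb _ _); lra. Qed.

(** Real-valued, as it enters analytic sums. *)
Definition counts (n m : nat) : R :=
  rsum (shell n) (fun x => rsum (shell m) (orth x)).

Lemma counts_nonneg (n m : nat) : 0 <= counts n m.
Proof. repeat (apply rsum_nonneg; intros). apply orth_ge0. Qed.

Lemma counts_symmetric (n m : nat) : counts n m = counts m n.
Proof.
  unfold counts. rewrite rsum_swap. apply rsum_ext. intros y _. apply rsum_ext.
  intros x _. apply orth_comm.
Qed.

Definition nonzero_orthogonal (p : vec3 * vec3) : Prop :=
  (0 < vnorm (fst p))%Z /\ (0 < vnorm (snd p))%Z /\ dot (fst p) (snd p) = 0%Z.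

Definition pairs (X : nat) : list (vec3 * vec3) :=
  filter (fun p => Z.eqb (dot (fst p) (snd p)) 0) (list_prod (ball X) (ball X)).

Lemma in_pairs (X : nat) (p : vec3 * vec3) :
  In p (pairs X) <-> nonzero_orthogonal p /\
    (vnorm (fst p) <= Z.of_nat X)%Z /\ (vnorm (snd p) <= Z.of_nat X)%Z.
Proof.
  destruct p as [x y]. unfold pairs, nonzero_orthogonal. simpl.
  rewrite filter_In, in_prod_iff, !in_ball. simpl. rewrite Z.eqb_eq. tauto.
Qed.

Lemma exhausts_pairs : exhausts nonzero_orthogonal pairs.
Proof.
  split.
  - intros X. split.
    + apply NoDup_filter, NoDup_list_prod; apply NoDup_ball.
    + apply Forall_forall. intros p Hp. now apply in_pairs in Hp.
  - intros p Hp. exists (Z.to_nat (Z.max (vnorm (fst p)) (vnorm (snd p)))).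
    intros X HX. apply in_pairs. split; [exact Hp|]. lia.
Qed.

Lemma primitive_nonzero (x : vec3) : primitive x -> (0 < vnorm x)%Z.
Proof.
  destruct x as [[x0 x1] x2]. unfold primitive, vnorm. intros H.
  destruct (Z.eq_dec x0 0) as [->|]; [|lia]. destruct (Z.eq_dec x1 0) as [->|]; [|lia].
  destruct (Z.eq_dec x2 0) as [->|]; [|lia]. rewrite !Z.gcd_0_l in H. simpl in H. lia.
Qed.

Lemma primitive_orthogonal_nonzero p : primitive_orthogonal p -> nonzero_orthogonal p.
Proof.
  intros [H1 [H2 H3]]. repeat split; auto using primitive_nonzero.
Qed.

Definition primitiveb (x : vec3) : bool :=
  let '(x0, x1, x2) := x in Z.eqb (Z.gcd (Z.gcd x0 x1) x2) 1.

Lemma primitiveb_spec (x : vec3) : primitiveb x = true <-> primitive x.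
Proof. destruct x as [[x0 x1] x2]. apply Z.eqb_eq. Qed.

Definition primitive_pairs (X : nat) : list (vec3 * vec3) :=
  filter (fun p => andb (primitiveb (fst p)) (primitiveb (snd p))) (pairs X).

Lemma exhausts_primitive_pairs : exhausts primitive_orthogonal primitive_pairs.
Proof.
  split.
  - intros X. split.
    + apply NoDup_filter. apply exhausts_pairs.
    + apply Forall_forall. intros p Hp. apply filter_In in Hp. destruct Hp as [Hp Hb].
      apply in_pairs in Hp. apply andb_prop in Hb. rewrite !primitiveb_spec in Hb.
      destruct Hp as [[_ [_ Hd]] _]. repeat split; tauto.
  - intros p Hp. destruct (proj2 exhausts_pairs p (primitive_orthogonal_nonzero p Hp)) as [X0 H].
    exists X0. intros X HX. apply filter_In. split; [now apply H|].
    destruct Hp as [H1 [H2 _]]. rewrite <- primitiveb_spec in H1, H2. now rewrite H1, H2.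
Qed.

Lemma zeta_term_pw (s : C) (x y : vec3) : (0 < vnorm x)%Z -> (0 < vnorm y)%Z ->
  zeta_term s (x, y) = (pw (IZR (vnorm x)) (2 * s) * pw (IZR (vnorm y)) (2 * s))%C.
Proof.
  intros Hx Hy. unfold zeta_term. simpl fst; simpl snd.
  rewrite <- pw_mult by now apply IZR_lt. rewrite <- mult_IZR. reflexivity.
Qed.

Lemma csum_pairs (s : C) (X : nat) : csum (pairs X) (zeta_term s) = box counts (2 * s)%C X.
Proof.
  unfold pairs. rewrite csum_filter, csum_list_prod.
  unfold ball at 1. rewrite csum_flat_map. apply csum_ext. intros i _.
  transitivity (csum (shell (S i)) (fun x => csum (seq 0 X) (fun j => csum (shell (S j))
    (fun y => RtoC (orth x y) * (pw (INR (S i)) (2 * s) * pw (INR (S j)) (2 * s)))%C))).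
  - apply csum_ext. intros x Hx. unfold ball. rewrite csum_flat_map.
    apply csum_ext. intros j _. apply csum_ext. intros y Hy. simpl fst; simpl snd.
    unfold orth. destruct (Z.eqb (dot x y) 0); [|ring].
    apply in_shell in Hx, Hy. rewrite zeta_term_pw by lia.
    rewrite Hx, Hy, <- !INR_IZR_INZ. ring.
  - rewrite csum_swap. apply csum_ext. intros j _. unfold counts.
    rewrite <- csum_RtoC, (Cmult_comm (csum _ _)), <- csum_scal. apply csum_ext. intros x _.
    rewrite <- csum_RtoC, <- csum_scal. apply csum_ext. intros y _. ring.
Qed.

Lemma abs_summable_pairs a e b Ce Cb (s : C) :
  regular_counts counts a e b Ce Cb -> 1 < Re s ->
  absolutely_summable nonzero_orthogonal (zeta_term s).
Proof.
  intros H Hs.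
  destruct (box_bounded counts a e b Ce Cb (2 * Re s) H ltac:(lra)) as [M HM].
  exists M. intros l [Hn Hl].
  destruct (exhausts_incl _ _ l exhausts_pairs Hl) as [X HX].
  specialize (HX X (le_n _)).
  change (rsum l (fun t => Cmod (zeta_term s t)) <= M).
  eapply Rle_trans; [apply (rsum_incl l (pairs X)); auto; intros; apply Cmod_ge_0|].
  eapply Rle_trans; [|apply (HM X)]. right.
  assert (E : forall p, In p (pairs X) ->
     RtoC (Cmod (zeta_term s p)) = zeta_term (RtoC (Re s)) p).
  { intros [x y] Hp. apply in_pairs in Hp. destruct Hp as [[Hx [Hy _]] _]. simpl in Hx, Hy.
    rewrite !zeta_term_pw by assumption. rewrite Cmod_mult, !Cmod_pw, <- RtoC_mult, !pw_RtoC.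
    rewrite <- RtoC_mult. do 3 f_equal; destruct s; simpl; ring. }
  apply RtoC_inj. rewrite <- csum_RtoC, (csum_ext _ _ _ E), csum_pairs.
  unfold box. rewrite <- csum_RtoC. apply csum_ext. intros i _.
  rewrite <- csum_RtoC. apply csum_ext. intros j _.
  rewrite <- !RtoC_mult, !pw_RtoC, <- !RtoC_mult. reflexivity.
Qed.

Definition vscale (k : Z) (x : vec3) : vec3 :=
  let '(x0, x1, x2) := x in (k * x0, k * x1, k * x2)%Z.

Definition vgcd (x : vec3) : Z := let '(x0, x1, x2) := x in Z.gcd (Z.gcd x0 x1) x2.

Lemma vnorm_scale (k : Z) (x : vec3) : vnorm (vscale k x) = (Z.abs k * vnorm x)%Z.
Proof.
  destruct x as [[x0 x1] x2]. unfold vnorm, vscale. rewrite !Z.abs_mul.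
  rewrite !Z.mul_max_distr_nonneg_l by lia. reflexivity.
Qed.

Lemma dot_scale (k l : Z) (x y : vec3) : dot (vscale k x) (vscale l y) = (k * l * dot x y)%Z.
Proof. destruct x as [[x0 x1] x2], y as [[y0 y1] y2]. unfold dot, vscale. ring. Qed.

Lemma vgcd_scale (k : Z) (x : vec3) : (0 <= k)%Z -> vgcd (vscale k x) = (k * vgcd x)%Z.
Proof.
  intros Hk. destruct x as [[x0 x1] x2]. unfold vgcd, vscale.
  now rewrite !Z.gcd_mul_mono_l_nonneg.
Qed.

Lemma vscale_inj (k : Z) (x y : vec3) : (0 < k)%Z -> vscale k x = vscale k y -> x = y.
Proof.
  intros Hk. destruct x as [[x0 x1] x2], y as [[y0 y1] y2]. unfold vscale. intros E.
  injection E as E0 E1 E2. apply Z.mul_reg_l in E0, E1, E2; try lia. now subst.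
Qed.

Lemma primitive_part (x : vec3) : (0 < vnorm x)%Z ->
  exists k x', (0 < k)%Z /\ primitive x' /\ x = vscale k x'.
Proof.
  intros Hx. set (k := vgcd x).
  assert (Hk : (0 < k)%Z).
  { assert (Hk0 : (0 <= k)%Z) by (unfold k; destruct x as [[x0 x1] x2]; apply Z.gcd_nonneg).
    destruct (Z.eq_dec k 0) as [E|]; [|lia]. exfalso. unfold k in E.
    destruct x as [[x0 x1] x2]. unfold vgcd in E.
    assert (E2 := Z.gcd_eq_0_r _ _ E). assert (E1 := Z.gcd_eq_0_l _ _ E).
    assert (E3 := Z.gcd_eq_0_r _ _ E1). assert (E4 := Z.gcd_eq_0_l _ _ E1).
    subst. unfold vnorm in Hx. simpl in Hx. lia. }
  assert (Hd : exists x', x = vscale k x').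
  { unfold k. clear Hk k Hx. destruct x as [[x0 x1] x2]. unfold vgcd.
    assert (D1 := Z.gcd_divide_l (Z.gcd x0 x1) x2). assert (D2 := Z.gcd_divide_r (Z.gcd x0 x1) x2).
    assert (D3 := Z.divide_trans _ _ _ D1 (Z.gcd_divide_l x0 x1)).
    assert (D4 := Z.divide_trans _ _ _ D1 (Z.gcd_divide_r x0 x1)).
    set (g := Z.gcd (Z.gcd x0 x1) x2) in *. clearbody g.
    destruct D2 as [c2 E2], D3 as [c0 E0], D4 as [c1 E1].
    exists (c0, c1, c2). unfold vscale. rewrite E0, E1, E2. f_equal; [f_equal|]; ring. }
  destruct Hd as [x' E]. exists k, x'. split; [exact Hk|]. split; [|exact E].
  assert (Q : vgcd x = (k * vgcd x')%Z) by (rewrite E at 1; apply vgcd_scale; lia).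
  fold k in Q. destruct x' as [[x0 x1] x2]. unfold primitive. change (vgcd (x0, x1, x2) = 1%Z).
  nia.
Qed.

Lemma primitive_part_unique (k k' : Z) (x x' : vec3) :
  (0 < k)%Z -> (0 < k')%Z -> primitive x -> primitive x' ->
  vscale k x = vscale k' x' -> k = k' /\ x = x'.
Proof.
  intros Hk Hk' Hx Hx' E.
  assert (E1 : vgcd (vscale k x) = vgcd (vscale k' x')) by now rewrite E.
  rewrite !vgcd_scale in E1 by lia.
  assert (G : vgcd x = 1%Z) by (destruct x as [[x0 x1] x2]; exact Hx).
  assert (G' : vgcd x' = 1%Z) by (destruct x' as [[x0 x1] x2]; exact Hx').
  rewrite G, G' in E1. assert (k = k') by lia. subst k'. split; [reflexivity|].
  now apply (vscale_inj k).
Qed.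

Definition dilate (q : (nat * nat) * (vec3 * vec3)) : vec3 * vec3 :=
  let '((d, e), (x, y)) := q in
  (vscale (Z.of_nat (S d)) x, vscale (Z.of_nat (S e)) y).

Definition dilated_pairs (X : nat) : list (vec3 * vec3) :=
  map dilate (list_prod (list_prod (seq 0 X) (seq 0 X)) (primitive_pairs X)).

(** A nonzero vector is a positive multiple of a primitive one in exactly one way. *)
Lemma exhausts_dilated_pairs : exhausts nonzero_orthogonal dilated_pairs.
Proof.
  split.
  - intros X. split.
    + apply NoDup_map_NoDup_ForallPairs.
      * intros [[d e] [x y]] [[d' e'] [x' y']] H H' E.
        apply in_prod_iff in H, H'. destruct H as [_ H], H' as [_ H'].
        apply (proj1 (Forall_forall _ _) (proj2 (proj1 exhausts_primitive_pairs X))) in H, H'.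
        destruct H as [P1 [P2 _]], H' as [P1' [P2' _]]. simpl in P1, P2, P1', P2'.
        unfold dilate in E. injection E as E1 E2.
        apply primitive_part_unique in E1, E2; auto; try lia.
        destruct E1 as [E1 E3], E2 as [E2 E4]. subst.
        assert (d = d') by lia. assert (e = e') by lia. now subst.
      * repeat apply NoDup_list_prod; try apply seq_NoDup. apply exhausts_primitive_pairs.
    + apply Forall_forall. intros p Hp. apply in_map_iff in Hp.
      destruct Hp as [[[d e] [x y]] [<- H]]. apply in_prod_iff in H. destruct H as [_ H].
      apply (proj1 (Forall_forall _ _) (proj2 (proj1 exhausts_primitive_pairs X))) in H.
      apply primitive_orthogonal_nonzero in H. destruct H as [H1 [H2 H3]]. simpl in *.
      unfold nonzero_orthogonal. simpl fst; simpl snd. rewrite !vnorm_scale, dot_scale, H3. nia.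
  - intros [x y] [Hx [Hy Hd]]. simpl in Hx, Hy, Hd.
    destruct (primitive_part x Hx) as [k [x' [Hk [Px ->]]]].
    destruct (primitive_part y Hy) as [l [y' [Hl [Py ->]]]].
    assert (Hp : primitive_orthogonal (x', y')).
    { repeat split; auto. simpl. rewrite dot_scale in Hd. nia. }
    destruct (proj2 exhausts_primitive_pairs _ Hp) as [X0 H0].
    exists (X0 + Z.to_nat k + Z.to_nat l)%nat. intros X HX.
    apply in_map_iff. exists ((Z.to_nat (k - 1), Z.to_nat (l - 1)), (x', y')). split.
    + unfold dilate. f_equal; f_equal; lia.
    + rewrite !in_prod_iff, !in_seq. split; [lia|]. apply H0. lia.
Qed.

Lemma csum_dilated_pairs (s : C) (X : nat) :
  csum (dilated_pairs X) (zeta_term s) =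
  (csum (seq 0 X) (fun i => pw (INR (S i)) (2 * s)) *
   (csum (seq 0 X) (fun i => pw (INR (S i)) (2 * s)) *
    csum (primitive_pairs X) (zeta_term s)))%C.
Proof.
  unfold dilated_pairs. rewrite csum_map, !csum_list_prod.
  rewrite Cmult_comm, <- csum_scal. apply csum_ext. intros d _.
  rewrite (Cmult_comm _ (pw _ _)), (Cmult_comm (csum (seq 0 X) _)), Cmult_assoc, <- csum_scal.
  apply csum_ext. intros e _.
  rewrite <- Cmult_assoc, (Cmult_comm (csum _ _)), Cmult_assoc, <- csum_scal.
  apply csum_ext. intros [x y] H.
  apply (proj1 (Forall_forall _ _) (proj2 (proj1 exhausts_primitive_pairs X))) in H.
  apply primitive_orthogonal_nonzero in H. destruct H as [H1 [H2 _]]. simpl in H1, H2.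
  unfold dilate. rewrite !zeta_term_pw; try assumption; try (rewrite vnorm_scale; nia).
  rewrite !vnorm_scale, !mult_IZR, !Z.abs_eq, !pw_mult, <- !INR_IZR_INZ by
    (try lia; try apply IZR_lt; try lia). ring.
Qed.

(** Sorting nonzero pairs by their primitive parts multiplies the sum over primitive
    pairs by one zeta factor for each of the two vectors. *)
Lemma primitive_sum (s S : C) : 1 < Re s ->
  absolutely_summable nonzero_orthogonal (zeta_term s) ->
  has_sum nonzero_orthogonal (zeta_term s) S ->
  has_sum primitive_orthogonal (zeta_term s) (S / (zeta (2 * s) * zeta (2 * s)))%C.
Proof.
  intros Hs Ha HS.
  assert (Hp := abs_summable_sub _ _ _ primitive_orthogonal_nonzero Ha).
  apply (has_sum_exhaust _ _ primitive_pairs); [exact Hp|exact exhausts_primitive_pairs|].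
  destruct (abs_summable_ctends _ _ primitive_pairs Hp exhausts_primitive_pairs) as [P HP].
  assert (H2s : 2 < Re (2 * s)%C) by (destruct s; simpl in *; lra).
  assert (HZ : ctends (fun X => csum (seq 0 X) (fun i => pw (INR (Datatypes.S i)) (2 * s)%C)) (zeta (2 * s)%C)).
  { apply CSeries_correct. apply zeta_abs. lra. }
  assert (HL := has_sum_ctends _ _ _ _ HS exhausts_dilated_pairs).
  assert (HM : ctends (fun X => csum (dilated_pairs X) (zeta_term s))
     (zeta (2 * s) * (zeta (2 * s) * P))%C).
  { eapply ctends_ext; [intros X; symmetry; apply csum_dilated_pairs|].
    apply ctends_mult; [exact HZ|]. now apply ctends_mult. }
  assert (E := ctends_unique _ _ _ HL HM).
  assert (NZ : zeta (2 * s)%C <> RtoC 0).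
  { apply Cmod_gt_0. assert (Q := zeta_lower (2 * s)%C ltac:(lra)). lra. }
  replace (S / (zeta (2 * s) * zeta (2 * s)))%C with P; [exact HP|].
  rewrite E. field. exact NZ.
Qed.

(** * Reduced bases of plane lattices *)

Local Open Scope Z_scope.

Definition vadd (x y : vec3) : vec3 :=
  let '(x0, x1, x2) := x in let '(y0, y1, y2) := y in (x0 + y0, x1 + y1, x2 + y2).

Definition cross (x y : vec3) : vec3 :=
  let '(x0, x1, x2) := x in let '(y0, y1, y2) := y in
  (x1 * y2 - x2 * y1, x2 * y0 - x0 * y2, x0 * y1 - x1 * y0).

Definition vzero : vec3 := (0, 0, 0).

Ltac vec := repeat match goal with x : vec3 |- _ => destruct x as [[? ?] ?] end;
  unfold vadd, cross, vzero, vscale, dot in *.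

Ltac vring := vec; repeat match goal with |- (_, _) = (_, _) => apply f_equal2 end; ring.

Lemma vnorm_add (x y : vec3) : vnorm (vadd x y) <= vnorm x + vnorm y.
Proof.
  destruct x as [[x0 x1] x2], y as [[y0 y1] y2]. unfold vadd.
  set (X := vnorm (x0, x1, x2)). set (Y := vnorm (y0, y1, y2)).
  assert (HX : Z.abs x0 <= X /\ Z.abs x1 <= X /\ Z.abs x2 <= X) by (unfold X, vnorm; lia).
  assert (HY : Z.abs y0 <= Y /\ Z.abs y1 <= Y /\ Z.abs y2 <= Y) by (unfold Y, vnorm; lia).
  clearbody X Y. unfold vnorm. repeat apply Z.max_lub; lia.
Qed.

Lemma vnorm_eq0 (x : vec3) : vnorm x = 0 -> x = vzero.
Proof. vec. unfold vnorm. intros H. repeat (apply f_equal2); lia. Qed.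

Lemma vnorm_cross (x y : vec3) : vnorm (cross x y) <= 2 * vnorm x * vnorm y.
Proof.
  assert (B : forall a b c d X Y, Z.abs a <= X -> Z.abs b <= X -> Z.abs c <= Y -> Z.abs d <= Y ->
    Z.abs (a * c - b * d) <= 2 * X * Y).
  { intros a b c d X Y Ha Hb Hc Hd.
    assert (Z.abs (a * c) <= X * Y) by (rewrite Z.abs_mul; apply Z.mul_le_mono_nonneg; lia).
    assert (Z.abs (b * d) <= X * Y) by (rewrite Z.abs_mul; apply Z.mul_le_mono_nonneg; lia).
    lia. }
  destruct x as [[x0 x1] x2], y as [[y0 y1] y2]. unfold cross.
  set (X := vnorm (x0, x1, x2)). set (Y := vnorm (y0, y1, y2)).
  assert (HX : Z.abs x0 <= X /\ Z.abs x1 <= X /\ Z.abs x2 <= X) by (unfold X, vnorm; lia).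
  assert (HY : Z.abs y0 <= Y /\ Z.abs y1 <= Y /\ Z.abs y2 <= Y) by (unfold Y, vnorm; lia).
  clearbody X Y. destruct HX as [? [? ?]], HY as [? [? ?]]. unfold vnorm.
  repeat apply Z.max_lub; apply B; assumption.
Qed.

Lemma cross_cross (a b c : vec3) :
  cross a (cross b c) = vadd (vscale (dot a c) b) (vscale (- dot a b) c).
Proof. vring. Qed.

(** Expand the cross product of [t] with the vanishing cross product of [x] and [c]. *)
Lemma parallel (t x c : vec3) : dot t x = 1 -> cross x c = vzero -> c = vscale (dot t c) x.
Proof.
  intros Ht Q. assert (E := cross_cross t x c). rewrite Q, Ht in E.
  transitivity (vadd c (cross t vzero)); [clear; vring|].
  rewrite E. clear E Q Ht. generalize (dot t c). intros d. vring.
Qed.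

Lemma exists_min {T : Type} (mu : T -> nat) (P : T -> Prop) :
  (exists t, P t) -> exists t, P t /\ forall t', P t' -> (mu t <= mu t')%nat.
Proof.
  intros [t Ht].
  remember (mu t) as n eqn:E. revert t Ht E.
  induction n as [n IH] using lt_wf_ind. intros t Ht E.
  destruct (Classical_Prop.classic (exists t', P t' /\ (mu t' < n)%nat)) as [[t' [H1 H2]]|Hno].
  - exact (IH (mu t') H2 t' H1 eq_refl).
  - exists t. split; [exact Ht|]. intros t' H'. destruct (Nat.le_gt_cases (mu t) (mu t')) as [|L]; [assumption|].
    exfalso. apply Hno. exists t'. split; [exact H'|lia].
Qed.

Lemma exists_min_vnorm (P : vec3 -> Prop) :
  (exists x, P x) -> exists x, P x /\ forall y, P y -> vnorm x <= vnorm y.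
Proof.
  intros H. destruct (exists_min (fun x => Z.to_nat (vnorm x)) P H) as [x [Hx Hm]].
  exists x. split; [exact Hx|]. intros y Hy. specialize (Hm y Hy).
  assert (Q' := vnorm_ge0 y). lia.
Qed.

Definition shortest (x v : vec3) : Prop :=
  0 < vnorm v /\ dot x v = 0 /\ forall y, 0 < vnorm y -> dot x y = 0 -> vnorm v <= vnorm y.

Lemma shortest_exists (x : vec3) : exists v, shortest x v.
Proof.
  destruct (exists_min_vnorm (fun v => 0 < vnorm v /\ dot x v = 0)) as [v [[H1 H2] H3]].
  - destruct x as [[x0 x1] x2].
    destruct (Z.eq_dec x0 0) as [->|H0].
    + exists (1, 0, 0). unfold vnorm, dot. lia.
    + exists (- x1, x0, 0). unfold vnorm, dot. split; [lia|ring].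
  - exists v. repeat split; auto.
Qed.

Lemma shortest_primitive (x v : vec3) : shortest x v -> primitive v.
Proof.
  intros [H1 [H2 H3]]. destruct (primitive_part v H1) as [k [v' [Hk [Hp E]]]].
  assert (Hv' := primitive_nonzero v' Hp).
  assert (Hd : dot x v' = 0).
  { rewrite E in H2. clear - H2 Hk. vec. nia. }
  specialize (H3 v' Hv' Hd). rewrite E, vnorm_scale in H3.
  assert (k = 1) by nia. subst k. rewrite E.
  destruct v' as [[a b] c]. unfold vscale. unfold primitive in *.
  now rewrite !Z.mul_1_l.
Qed.

Lemma primitive_bezout (v : vec3) : primitive v -> exists u, dot u v = 1.
Proof.
  destruct v as [[a b] c]. unfold primitive. intros H.
  destruct (Z.gcd_bezout a b (Z.gcd a b) eq_refl) as [p [q E1]].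
  destruct (Z.gcd_bezout (Z.gcd a b) c 1 H) as [r [s E2]].
  exists (r * p, r * q, s). unfold dot. rewrite <- E2, <- E1. ring.
Qed.

Definition comb (v w : vec3) (i j : Z) : vec3 := vadd (vscale i v) (vscale j w).

Lemma round_quotient (i j : Z) : j <> 0 -> exists q, 2 * Z.abs (i - q * j) <= Z.abs j.
Proof.
  intros Hj.
  assert (P : forall j, 0 < j -> exists q, 2 * Z.abs (i - q * j) <= j).
  { clear. intros j Hj. exists ((2 * i + j) / (2 * j)).
    assert (D := Z.div_mod (2 * i + j) (2 * j) ltac:(lia)).
    assert (M := Z.mod_pos_bound (2 * i + j) (2 * j) ltac:(lia)).
    set (q := (2 * i + j) / (2 * j)) in *. nia. }
  destruct (Z.lt_trichotomy j 0) as [H|[H|H]]; [|lia|].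
  - destruct (P (- j)) as [q Hq]; [lia|]. exists (- q).
    replace (i - - q * j) with (i - q * - j) by ring. lia.
  - destruct (P j H) as [q Hq]. exists q. lia.
Qed.

(** In such a basis, norms of combinations are controlled by the coefficients, and the
    product of the lengths by the covolume, which is of order [|x|]. *)
Record reduced_basis (x v w : vec3) : Prop := {
  rb_shortest : shortest x v;
  rb_span : forall y, dot x y = 0 <-> exists i j, y = comb v w i j;
  rb_free : forall i j i' j', comb v w i j = comb v w i' j' -> i = i' /\ j = j';
  rb_le : vnorm v <= vnorm w;
  rb_row : forall i, vnorm w <= vnorm (comb v w i 1);
  rb_area : vnorm x <= 2 * vnorm v * vnorm w
}.

Lemma vscale_cancel (i j : Z) (x : vec3) : 0 < vnorm x -> vscale i x = vscale j x -> i = j.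
Proof.
  intros Hx E. destruct x as [[a b] c]. unfold vscale in E. unfold vnorm in Hx.
  injection E as A B D.
  assert (N : a <> 0 \/ b <> 0 \/ c <> 0) by lia.
  destruct N as [N|[N|N]]; [exact (Z.mul_reg_r _ _ _ N A)|exact (Z.mul_reg_r _ _ _ N B)|exact (Z.mul_reg_r _ _ _ N D)].
Qed.

(** The cross product with [v] reads off the second coefficient. *)
Lemma comb_free (x v w : vec3) : 0 < vnorm x -> 0 < vnorm v -> cross v w = vscale (-1) x ->
  forall i j i' j', comb v w i j = comb v w i' j' -> i = i' /\ j = j'.
Proof.
  intros Hx Hv Hc i j i' j' E.
  assert (Hx1 : 0 < vnorm (vscale (-1) x)) by (rewrite vnorm_scale; lia).
  assert (Hj : j = j').
  { apply (vscale_cancel _ _ (vscale (-1) x) Hx1). rewrite <- Hc.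
    transitivity (cross v (comb v w i j)); [unfold comb; clear; vring|].
    rewrite E. unfold comb; clear; vring. }
  split; [|exact Hj]. subst j'. apply (vscale_cancel _ _ v Hv).
  transitivity (vadd (comb v w i j) (vscale (- j) w)); [unfold comb; clear; vring|].
  rewrite E. unfold comb; clear; vring.
Qed.

(** If [u] has product one with [v], then the cross product of [u] and [x] completes [v] to a
    basis; translating it by multiples of [v] makes it shortest in its row. *)
Lemma reduced_basis_exists (x : vec3) : primitive x -> exists v w, reduced_basis x v w.
Proof.
  intros Hx. destruct (shortest_exists x) as [v Hv]. assert (Hv' := Hv).
  destruct Hv as [Hv0 [Hxv Hmin]].
  destruct (primitive_bezout x Hx) as [t Ht].
  destruct (primitive_bezout v (shortest_primitive x v Hv')) as [u Hu].
  set (w0 := cross u x).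
  assert (Hc0 : cross v w0 = vscale (-1) x).
  { unfold w0. rewrite cross_cross, (dot_comm v x), Hxv, (dot_comm v u), Hu. clear; vring. }
  assert (Hd0 : dot x w0 = 0) by (unfold w0; clear; vec; ring).
  assert (Hspan0 : forall y, dot x y = 0 -> exists i j, y = comb v w0 i j).
  { intros y Hy. set (c := cross v y).
    (* both [v] and [y] are orthogonal to the primitive vector [x] *)
    assert (E1 : c = vscale (dot t c) x).
    { assert (Q : cross x c = vzero).
      { unfold c. rewrite cross_cross, Hy, Hxv. clear; vring. }
      now apply parallel. }
    set (j := - dot t c).
    set (y' := vadd y (vscale (- j) w0)).
    assert (E2 : cross v y' = vzero).
    { transitivity (vadd (cross v y) (vscale (- j) (cross v w0))); [unfold y'; clear; vring|].
      rewrite Hc0. fold c. rewrite E1 at 1. unfold j. clear. vring. }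
    assert (E3 : y' = vscale (dot u y') v).
    { now apply parallel. }
    exists (dot u y'), j. unfold comb. rewrite <- E3. unfold y'. clear. vring. }
  destruct (exists_min_vnorm (fun y => exists i, y = comb v w0 i 1)) as [w [[a Ea] Hw]].
  { exists (comb v w0 0 1), 0. reflexivity. }
  assert (Hdw : dot x w = 0).
  { rewrite Ea. transitivity (a * dot x v + dot x w0); [unfold comb; clear; vec; ring|].
    rewrite Hxv, Hd0. ring. }
  assert (Hcw : cross v w = vscale (-1) x).
  { rewrite <- Hc0, Ea. unfold comb. clear; vring. }
  assert (Hfree := comb_free x v w (primitive_nonzero x Hx) Hv0 Hcw).
  assert (Hw0 : 0 < vnorm w).
  { assert (Q := vnorm_ge0 w). destruct (Z.eq_dec (vnorm w) 0) as [E|]; [|lia].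
    apply vnorm_eq0 in E. destruct (Hfree 0 1 0 0) as [_ Q2]; [|lia].
    unfold comb. rewrite E. clear; vring. }
  exists v, w. split.
  - exact Hv'.
  - intros y. split.
    + intros Hy. destruct (Hspan0 y Hy) as [i [j E]].
      exists (i - j * a), j. rewrite E, Ea. unfold comb. clear; vring.
    + intros [i [j E]]. rewrite E.
      transitivity (i * dot x v + j * dot x w); [unfold comb; clear; vec; ring|].
      rewrite Hxv, Hdw. ring.
  - exact Hfree.
  - apply Hmin; assumption.
  - intros i. apply Hw. exists (i + a). rewrite Ea. unfold comb. clear; vring.
  - replace (vnorm x) with (vnorm (cross v w)); [apply vnorm_cross|].
    rewrite Hcw, vnorm_scale. lia.
Qed.

(** Rounding [i / j] reduces row [j] to row one, where [w] is shortest. *)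
Lemma comb_lower (x v w : vec3) (i j : Z) : reduced_basis x v w ->
  Z.abs j * vnorm w <= 2 * vnorm (comb v w i j).
Proof.
  intros H. assert (V0 := vnorm_ge0 v).
  destruct (Z.eq_dec j 0) as [->|Hj].
  { assert (Q := vnorm_ge0 (comb v w i 0)). simpl Z.abs. lia. }
  destruct (round_quotient i j Hj) as [q Hq].
  assert (E : vscale j (comb v w q 1) = vadd (comb v w i j) (vscale (- (i - q * j)) v)).
  { unfold comb. clear; vring. }
  assert (T := vnorm_add (comb v w i j) (vscale (- (i - q * j)) v)).
  rewrite <- E, !vnorm_scale in T.
  assert (R := rb_row _ _ _ H q). assert (L := rb_le _ _ _ H).
  rewrite Z.abs_opp in T.
  assert (Z.abs j * vnorm w <= Z.abs j * vnorm (comb v w q 1)) by (apply Z.mul_le_mono_nonneg_l; lia).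
  assert (2 * Z.abs (i - q * j) * vnorm v <= Z.abs j * vnorm v) by (apply Z.mul_le_mono_nonneg_r; lia).
  assert (Z.abs j * vnorm v <= Z.abs j * vnorm w) by (apply Z.mul_le_mono_nonneg_l; lia).
  lia.
Qed.

Local Close Scope Z_scope.

(** * Rows of a plane lattice *)

Local Open Scope Z_scope.

Lemma abs_convex (a b m i1 i2 i : Z) : i1 <= i <= i2 ->
  Z.abs (i1 * a + b) <= m -> Z.abs (i2 * a + b) <= m -> Z.abs (i * a + b) <= m.
Proof.
  intros Hi H1 H2. destruct (Z.le_gt_cases 0 a).
  - assert (i1 * a <= i * a) by (apply Z.mul_le_mono_nonneg_r; lia).
    assert (i * a <= i2 * a) by (apply Z.mul_le_mono_nonneg_r; lia). lia.
  - assert (i * a <= i1 * a) by (apply Z.mul_le_mono_nonpos_r; lia).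
    assert (i2 * a <= i * a) by (apply Z.mul_le_mono_nonpos_r; lia). lia.
Qed.

(** The point [(i, j)] lies between convex combinations of points of row [j'] and of
    their mirror images in row [- j']. *)
Lemma abs_slide (a b m i1 i2 i j j' : Z) : 0 <= j <= j' -> 0 < j' ->
  (j' + j) * i1 - (j' - j) * i2 <= 2 * j' * i <= (j' + j) * i2 - (j' - j) * i1 ->
  Z.abs (i1 * a + j' * b) <= m -> Z.abs (i2 * a + j' * b) <= m ->
  Z.abs (i * a + j * b) <= m.
Proof.
  intros Hj Hj' [L1 L2] H1 H2.
  assert (B1 : Z.abs ((j' + j) * (i1 * a + j' * b) - (j' - j) * (i2 * a + j' * b)) <= 2 * j' * m).
  { assert (Z.abs ((j' + j) * (i1 * a + j' * b)) <= (j' + j) * m)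
      by (rewrite Z.abs_mul, (Z.abs_eq (j' + j)) by lia; apply Z.mul_le_mono_nonneg_l; lia).
    assert (Z.abs ((j' - j) * (i2 * a + j' * b)) <= (j' - j) * m)
      by (rewrite Z.abs_mul, (Z.abs_eq (j' - j)) by lia; apply Z.mul_le_mono_nonneg_l; lia).
    lia. }
  assert (B2 : Z.abs ((j' + j) * (i2 * a + j' * b) - (j' - j) * (i1 * a + j' * b)) <= 2 * j' * m).
  { assert (Z.abs ((j' + j) * (i2 * a + j' * b)) <= (j' + j) * m)
      by (rewrite Z.abs_mul, (Z.abs_eq (j' + j)) by lia; apply Z.mul_le_mono_nonneg_l; lia).
    assert (Z.abs ((j' - j) * (i1 * a + j' * b)) <= (j' - j) * m)
      by (rewrite Z.abs_mul, (Z.abs_eq (j' - j)) by lia; apply Z.mul_le_mono_nonneg_l; lia).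
    lia. }
  assert (B3 : Z.abs ((2 * j' * i) * a + 2 * j' * (j * b)) <= 2 * j' * m).
  { apply (abs_convex a (2 * j' * (j * b)) _ _ _ _ (conj L1 L2)).
    - replace (((j' + j) * i1 - (j' - j) * i2) * a + 2 * j' * (j * b)) with
        ((j' + j) * (i1 * a + j' * b) - (j' - j) * (i2 * a + j' * b)) by ring. exact B1.
    - replace (((j' + j) * i2 - (j' - j) * i1) * a + 2 * j' * (j * b)) with
        ((j' + j) * (i2 * a + j' * b) - (j' - j) * (i1 * a + j' * b)) by ring. exact B2. }
  replace (2 * j' * i * a + 2 * j' * (j * b)) with (2 * j' * (i * a + j * b)) in B3 by ring.
  rewrite Z.abs_mul, (Z.abs_eq (2 * j')) in B3 by lia.
  apply (Z.mul_le_mono_pos_l _ _ (2 * j')); lia.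
Qed.

Lemma vnorm_le (x0 x1 x2 m : Z) :
  vnorm (x0, x1, x2) <= m <-> Z.abs x0 <= m /\ Z.abs x1 <= m /\ Z.abs x2 <= m.
Proof. unfold vnorm. lia. Qed.

Lemma comb_convex (v w : vec3) (j m i1 i2 i : Z) : i1 <= i <= i2 ->
  vnorm (comb v w i1 j) <= m -> vnorm (comb v w i2 j) <= m -> vnorm (comb v w i j) <= m.
Proof.
  destruct v as [[v0 v1] v2], w as [[w0 w1] w2]. unfold comb, vadd, vscale.
  rewrite !vnorm_le. intros Hi [A0 [A1 A2]] [B0 [B1 B2]].
  repeat split; eapply abs_convex; eauto.
Qed.

Lemma comb_slide (v w : vec3) (m i1 i2 i j j' : Z) : 0 <= j <= j' -> 0 < j' ->
  (j' + j) * i1 - (j' - j) * i2 <= 2 * j' * i <= (j' + j) * i2 - (j' - j) * i1 ->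
  vnorm (comb v w i1 j') <= m -> vnorm (comb v w i2 j') <= m ->
  vnorm (comb v w i j) <= m.
Proof.
  destruct v as [[v0 v1] v2], w as [[w0 w1] w2]. unfold comb, vadd, vscale.
  rewrite !vnorm_le. intros Hj Hj' Hi [A0 [A1 A2]] [B0 [B1 B2]].
  repeat split; eapply abs_slide; eauto.
Qed.

Lemma comb_scale (v w : vec3) (k i j : Z) : comb v w (k * i) (k * j) = vscale k (comb v w i j).
Proof. unfold comb. vring. Qed.

Lemma comb_opp (v w : vec3) (i j : Z) : vnorm (comb v w (- i) (- j)) = vnorm (comb v w i j).
Proof.
  replace (comb v w (- i) (- j)) with (vscale (-1) (comb v w i j)).
  - rewrite vnorm_scale. lia.
  - unfold comb. vring.
Qed.

Definition rowcount (v w : vec3) (m : nat) (j : Z) : R :=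
  rsum (zrange (3 * m)) (fun i => if vnorm (comb v w i j) <=? Z.of_nat m then 1%R else 0%R).

Lemma rsum_one {T} (l : list T) : rsum l (fun _ => 1%R) = INR (length l).
Proof. rewrite rsum_const. ring. Qed.

Lemma rsum_interval (B : nat) (i1 i2 : Z) :
  - Z.of_nat B <= i1 -> i1 <= i2 -> i2 <= Z.of_nat B ->
  rsum (zrange B) (fun i => if (i1 <=? i) && (i <=? i2) then 1%R else 0%R)%bool = IZR (i2 - i1 + 1).
Proof.
  intros H1 H2 H3. rewrite <- (rsum_filter _ _ (fun _ => 1%R)), rsum_one.
  assert (P : Permutation (filter (fun i => (i1 <=? i) && (i <=? i2))%bool (zrange B))
                (map (fun k => i1 + Z.of_nat k) (seq 0 (Z.to_nat (i2 - i1 + 1))))).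
  { apply NoDup_Permutation.
    - apply NoDup_filter, NoDup_zrange.
    - apply NoDup_map_NoDup_ForallPairs; [|apply seq_NoDup]. intros a b _ _ E. lia.
    - intros i. rewrite filter_In, in_zrange, in_map_iff, Bool.andb_true_iff, !Z.leb_le. split.
      + intros H. exists (Z.to_nat (i - i1)). rewrite in_seq. lia.
      + intros [k [E Hk]]. apply in_seq in Hk. lia. }
  rewrite (Permutation_length P), length_map, length_seq, INR_IZR_INZ. f_equal. lia.
Qed.

Definition row_interval (v w : vec3) (m : nat) (j : Z) : Prop :=
  (rowcount v w m j = 0%R /\ forall i, ~ vnorm (comb v w i j) <= Z.of_nat m) \/
  (exists i1 i2, i1 <= i2 /\ (forall i, vnorm (comb v w i j) <= Z.of_nat m <-> i1 <= i <= i2) /\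
     rowcount v w m j = IZR (i2 - i1 + 1)).

Lemma coefficient_bound (x v w : vec3) (m : nat) (i j : Z) : reduced_basis x v w ->
  vnorm (comb v w i j) <= Z.of_nat m -> Z.abs i <= 3 * Z.of_nat m /\ Z.abs j <= 2 * Z.of_nat m.
Proof.
  intros H Hm. assert (L := comb_lower x v w i j H).
  destruct (rb_shortest _ _ _ H) as [V0 _]. assert (VW := rb_le _ _ _ H).
  split; [|nia].
  assert (E : vscale i v = vadd (comb v w i j) (vscale (- j) w)) by (unfold comb; clear; vring).
  assert (T := vnorm_add (comb v w i j) (vscale (- j) w)).
  rewrite <- E, !vnorm_scale, Z.abs_opp in T. nia.
Qed.

Lemma row_interval_holds (x v w : vec3) (m : nat) (j : Z) : reduced_basis x v w ->
  row_interval v w m j.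
Proof.
  intros H.
  assert (B : forall i, vnorm (comb v w i j) <= Z.of_nat m -> Z.abs i <= 3 * Z.of_nat m)
    by (intros i Hi; now apply (coefficient_bound x v w m i j H)).
  destruct (Classical_Prop.classic (exists i, vnorm (comb v w i j) <= Z.of_nat m)) as [He|Hno].
  - right.
    destruct (exists_min (fun i => Z.to_nat (i + 3 * Z.of_nat m)) _ He) as [i1 [H1 M1]].
    destruct (exists_min (fun i => Z.to_nat (3 * Z.of_nat m - i)) _ He) as [i2 [H2 M2]].
    assert (I : forall i, vnorm (comb v w i j) <= Z.of_nat m <-> i1 <= i <= i2).
    { intros i. split.
      - intros Hi. assert (B0 := B i Hi). specialize (M1 i Hi). specialize (M2 i Hi).
        assert (B2 := B i2 H2). lia.
      - intros Hi. now apply (comb_convex v w j _ i1 i2). }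
    exists i1, i2. assert (B1 := B i1 H1). assert (B2 := B i2 H2).
    assert (i1 <= i2) by (now apply I). repeat split; try (now apply I); try assumption.
    unfold rowcount. rewrite <- (rsum_interval (3 * m) i1 i2) by lia.
    apply rsum_ext. intros i _.
    destruct (vnorm (comb v w i j) <=? Z.of_nat m) eqn:E.
    + apply Z.leb_le, I in E. destruct E as [E1 E2]. apply Z.leb_le in E1, E2. now rewrite E1, E2.
    + destruct ((i1 <=? i) && (i <=? i2))%bool eqn:E'; [|reflexivity]. exfalso.
      apply Bool.andb_true_iff in E'. rewrite !Z.leb_le in E'. apply I in E'.
      apply Z.leb_gt in E. lia.
  - left. split.
    + apply rsum_zero. intros i _.
      destruct (vnorm (comb v w i j) <=? Z.of_nat m) eqn:E; [|reflexivity].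
      exfalso. apply Hno. exists i. now apply Z.leb_le.
    + intros i Hi. apply Hno. now exists i.
Qed.

Lemma rowcount_ge0 (v w : vec3) (m : nat) (j : Z) : (0 <= rowcount v w m j)%R.
Proof. apply rsum_nonneg. intros i _. destruct (_ <=? _); lra. Qed.

(** Every [k]-th point of row [k j] at radius [k m] comes from row [j] at radius [m]. *)
Lemma rowcount_scale (x v w : vec3) (m k : nat) (j : Z) : reduced_basis x v w -> (1 <= k)%nat ->
  (Rabs (rowcount v w (k * m) (Z.of_nat k * j) - INR k * rowcount v w m j) <= 2 * INR k)%R.
Proof.
  intros H Hk. assert (Hk1 : (1 <= INR k)%R) by (apply (le_INR 1); exact Hk).
  assert (S : forall i, vnorm (comb v w (Z.of_nat k * i) (Z.of_nat k * j)) <= Z.of_nat (k * m)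
                        <-> vnorm (comb v w i j) <= Z.of_nat m).
  { intros i. rewrite comb_scale, vnorm_scale, Z.abs_eq, Nat2Z.inj_mul by lia. nia. }
  rewrite INR_IZR_INZ in *. set (K := Z.of_nat k) in *.
  destruct (row_interval_holds x v w (k * m) (K * j) H) as [[E' N']|[a' [b' [L' [I' E']]]]];
  destruct (row_interval_holds x v w m j H) as [[E N]|[a [b [L [I E]]]]]; rewrite E, E'.
  - rewrite Rmult_0_r, Rminus_0_r, Rabs_R0. lra.
  - exfalso. apply (N' (K * a)). apply S, I. lia.
  - rewrite Rmult_0_r, Rminus_0_r, Rabs_pos_eq by (apply IZR_le; lia).
    rewrite <- mult_IZR. apply IZR_le.
    (* an interval without multiples of [K] is shorter than [K] *)
    assert (D := Z.div_mod b' K ltac:(lia)). assert (M := Z.mod_pos_bound b' K ltac:(lia)).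
    destruct (Z.le_gt_cases a' (K * (b' / K))) as [C|C]; [|lia].
    exfalso. apply (N (b' / K)). apply S, I'. lia.
  - rewrite <- mult_IZR, <- minus_IZR, <- abs_IZR, <- mult_IZR. apply IZR_le.
    assert (Ka : a' <= K * a <= b') by (apply I', S, I; lia).
    assert (Kb : a' <= K * b <= b') by (apply I', S, I; lia).
    assert (Kb1 : b' < K * (b + 1)).
    { destruct (Z.lt_ge_cases b' (K * (b + 1))) as [C|C]; [exact C|].
      assert (Q : a <= b + 1 <= b) by (apply I, S, I'; nia). lia. }
    assert (Ka1 : K * (a - 1) < a').
    { destruct (Z.lt_ge_cases (K * (a - 1)) a') as [C|C]; [exact C|].
      assert (Q : a <= a - 1 <= b) by (apply I, S, I'; nia). lia. }
    nia.
Qed.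

(** Sections of a symmetric convex body shrink away from the centre; counting integers
    costs at most one. *)
Lemma rowcount_decr (x v w : vec3) (m : nat) (j j' : Z) : reduced_basis x v w ->
  0 <= j <= j' -> (rowcount v w m j' <= rowcount v w m j + 1)%R.
Proof.
  intros H Hj. destruct (Z.eq_dec j' j) as [->|Hne]; [lra|].
  assert (P := rowcount_ge0 v w m j).
  destruct (row_interval_holds x v w m j' H) as [[E' N']|[a' [b' [L' [I' E']]]]]; rewrite E'; [lra|].
  assert (Ha : vnorm (comb v w a' j') <= Z.of_nat m) by (apply I'; lia).
  assert (Hb : vnorm (comb v w b' j') <= Z.of_nat m) by (apply I'; lia).
  (* least integer of the interpolated section *)
  set (lo := (j' + j) * a' - (j' - j) * b').
  set (q := - ((- lo) / (2 * j'))).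
  assert (D := Z.div_mod (- lo) (2 * j') ltac:(lia)).
  assert (M := Z.mod_pos_bound (- lo) (2 * j') ltac:(lia)).
  assert (Hin : forall i, q <= i <= q + (b' - a') - 1 -> vnorm (comb v w i j) <= Z.of_nat m).
  { intros i Hi. apply (comb_slide v w _ a' b' i j j'); try lia; try assumption.
    fold lo. nia. }
  destruct (row_interval_holds x v w m j H) as [[E N]|[a [b [L [I E]]]]]; rewrite E.
  - destruct (Z.eq_dec a' b') as [->|].
    + replace (b' - b' + 1) with 1 by ring. lra.
    + exfalso. apply (N q). apply Hin. lia.
  - rewrite <- plus_IZR. apply IZR_le. destruct (Z.eq_dec a' b') as [->|]; [lia|].
    assert (Q1 := proj1 (I q) (Hin q ltac:(lia))).
    assert (Q2 := proj1 (I (q + (b' - a') - 1)) (Hin (q + (b' - a') - 1) ltac:(lia))). lia.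
Qed.

Lemma rowcount_opp (v w : vec3) (m : nat) (j : Z) : rowcount v w m (- j) = rowcount v w m j.
Proof.
  unfold rowcount.
  assert (P : Permutation (zrange (3 * m)) (map Z.opp (zrange (3 * m)))).
  { apply NoDup_Permutation; [apply NoDup_zrange| |].
    - apply NoDup_map_NoDup_ForallPairs; [|apply NoDup_zrange]. intros a b _ _ E. lia.
    - intros i. rewrite in_map_iff, in_zrange. split.
      + intros Hi. exists (- i). rewrite in_zrange. lia.
      + intros [k [<- Hk]]. apply in_zrange in Hk. lia. }
  rewrite (rsum_perm _ _ _ P), rsum_map. apply rsum_ext. intros i _. now rewrite comb_opp.
Qed.

Lemma rowcount_far (x v w : vec3) (m : nat) (j : Z) : reduced_basis x v w ->
  2 * Z.of_nat m < Z.abs j * vnorm w -> rowcount v w m j = 0%R.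
Proof.
  intros H Hj. apply rsum_zero. intros i _.
  destruct (vnorm (comb v w i j) <=? Z.of_nat m) eqn:E; [|reflexivity].
  apply Z.leb_le in E. assert (L := comb_lower x v w i j H). lia.
Qed.

Lemma rowcount_centre (x v w : vec3) (m : nat) : reduced_basis x v w ->
  (rowcount v w m 0 <= 2 * (INR m / IZR (vnorm v)) + 1)%R.
Proof.
  intros H. destruct (rb_shortest _ _ _ H) as [V0 _].
  assert (V1 : (0 < IZR (vnorm v))%R) by (now apply IZR_lt).
  assert (E0 : forall i, vnorm (comb v w i 0) = Z.abs i * vnorm v).
  { intros i. rewrite <- vnorm_scale. f_equal. unfold comb. clear; vring. }
  assert (Q0 : (0 <= INR m / IZR (vnorm v))%R)
    by (apply Rmult_le_pos; [apply pos_INR|left; now apply Rinv_0_lt_compat]).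
  destruct (row_interval_holds x v w m 0 H) as [[E N]|[a [b [L [I E]]]]]; rewrite E; [lra|].
  assert (Ha := proj2 (I a) ltac:(lia)). assert (Hb := proj2 (I b) ltac:(lia)).
  rewrite E0 in Ha, Hb.
  assert (Q : (b - a) * vnorm v <= 2 * Z.of_nat m) by nia.
  rewrite plus_IZR. apply Rplus_le_compat_r.
  apply Rmult_le_reg_r with (IZR (vnorm v)); [exact V1|].
  replace (2 * (INR m / IZR (vnorm v)) * IZR (vnorm v))%R with (2 * INR m)%R by (field; lra).
  rewrite INR_IZR_INZ, <- !mult_IZR. now apply IZR_le.
Qed.

Local Close Scope Z_scope.

(** * Points of a plane lattice in a cube *)

Definition perp (x : vec3) (m : nat) : R := rsum (ball m) (orth x).

Lemma perp_ge0 (x : vec3) (m : nat) : 0 <= perp x m.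
Proof. apply rsum_nonneg. intros; apply orth_ge0. Qed.

Lemma zbox_ball (m : nat) : Permutation (zbox m) (vzero :: ball m).
Proof.
  apply NoDup_Permutation; [apply NoDup_zbox| |].
  - constructor; [|apply NoDup_ball]. rewrite in_ball. unfold vzero, vnorm. simpl. lia.
  - intros x. rewrite in_zbox. simpl. rewrite in_ball. split.
    + intros H. assert (Q := vnorm_ge0 x). destruct (Z.eq_dec (vnorm x) 0) as [E|].
      * left. symmetry. now apply vnorm_eq0.
      * right. lia.
    + intros [<-|H]; [|lia]. unfold vzero, vnorm. simpl. lia.
Qed.

Lemma perp_zbox (x : vec3) (m : nat) : rsum (zbox m) (orth x) = perp x m + 1.
Proof.
  rewrite (rsum_perm _ _ _ (zbox_ball m)).
  change (orth x vzero + rsum (ball m) (orth x) = perp x m + 1).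
  unfold perp, orth at 1. replace (dot x vzero) with 0%Z by (destruct x as [[a b] c]; unfold dot, vzero; ring).
  simpl. ring.
Qed.

Lemma perp_rows (x v w : vec3) (m J : nat) : reduced_basis x v w -> (2 * m <= J)%nat ->
  perp x m + 1 = rsum (zrange J) (rowcount v w m).
Proof.
  intros H HJ. rewrite <- perp_zbox. unfold orth. rewrite <- (rsum_filter _ _ (fun _ => 1)).
  transitivity (rsum (map (fun p => comb v w (fst p) (snd p))
    (filter (fun p => Z.leb (vnorm (comb v w (fst p) (snd p))) (Z.of_nat m))
       (list_prod (zrange (3 * m)) (zrange J)))) (fun _ => 1)).
  - apply rsum_perm. apply NoDup_Permutation.
    + apply NoDup_filter, NoDup_zbox.
    + apply NoDup_map_NoDup_ForallPairs.
      * intros [i j] [i' j'] _ _ E. apply (rb_free _ _ _ H) in E. simpl in E. destruct E. now subst.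
      * apply NoDup_filter, NoDup_list_prod; apply NoDup_zrange.
    + intros y. rewrite filter_In, in_zbox, Z.eqb_eq, in_map_iff. split.
      * intros [Hm Hd]. apply (rb_span _ _ _ H) in Hd. destruct Hd as [i [j E]].
        exists (i, j). split; [now symmetry|]. apply filter_In.
        rewrite in_prod_iff, !in_zrange, Z.leb_le. simpl. rewrite <- E.
        assert (B := coefficient_bound x v w m i j H ltac:(now rewrite <- E)). lia.
      * intros [[i j] [<- Hp]]. apply filter_In in Hp. destruct Hp as [_ Hp]. apply Z.leb_le in Hp.
        split; [exact Hp|]. apply (rb_span _ _ _ H). now exists i, j.
  - rewrite rsum_map, rsum_filter, rsum_list_prod, rsum_swap. reflexivity.
Qed.

Lemma rsum_zrange_even (J : nat) (f : Z -> R) : (forall j, f (- j)%Z = f j) ->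
  rsum (zrange J) f = 2 * rsum (seq 0 (S J)) (fun j => f (Z.of_nat j)) - f 0%Z.
Proof.
  intros Hf.
  assert (P : Permutation (zrange J)
    (map Z.of_nat (seq 0 (S J)) ++ map (fun i => (- Z.of_nat (S i))%Z) (seq 0 J))).
  { apply NoDup_Permutation; [apply NoDup_zrange| |].
    - apply NoDup_app.
      + apply NoDup_map_NoDup_ForallPairs; [|apply seq_NoDup]. intros a b _ _ E. lia.
      + apply NoDup_map_NoDup_ForallPairs; [|apply seq_NoDup]. intros a b _ _ E. lia.
      + intros z Hz Hz'. apply in_map_iff in Hz, Hz'.
        destruct Hz as [a [E _]], Hz' as [b [E' _]]. lia.
    - intros z. rewrite in_zrange, in_app_iff, !in_map_iff. split.
      + intros Hz. destruct (Z.le_gt_cases 0 z).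
        * left. exists (Z.to_nat z). rewrite in_seq. lia.
        * right. exists (Z.to_nat (- z - 1)). rewrite in_seq. lia.
      + intros [[a [E Ha]]|[a [E Ha]]]; apply in_seq in Ha; lia. }
  rewrite (rsum_perm _ _ _ P), rsum_app, !rsum_map.
  rewrite (rsum_ext (seq 0 J) _ (fun i => f (Z.of_nat (S i)))) by (intros; apply Hf).
  rewrite (rsum_seq_Sl J (fun j => f (Z.of_nat j))). simpl (Z.of_nat 0). ring.
Qed.

Lemma rsum_seq_extend (n k : nat) (f : nat -> R) : (forall j, (n <= j)%nat -> f j = 0) ->
  rsum (seq 0 (n + k)) f = rsum (seq 0 n) f.
Proof.
  intros H. rewrite seq_app, rsum_app, (rsum_zero (seq (0 + n) k)); [ring|].
  intros j Hj. apply in_seq in Hj. apply H. lia.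
Qed.

Lemma rsum_seq_shift (a k : nat) (f : nat -> R) :
  rsum (seq a k) f = rsum (seq 0 k) (fun r => f (a + r)%nat).
Proof.
  revert a f. induction k as [|k IH]; intros a f; [reflexivity|].
  rewrite !seq_S, !rsum_app, IH. reflexivity.
Qed.

Lemma rsum_blocks (k r : nat) (f : nat -> R) :
  rsum (seq 0 (k * r)) f = rsum (seq 0 r) (fun j => rsum (seq 0 k) (fun i => f (k * j + i)%nat)).
Proof.
  induction r as [|r IH]; [now rewrite Nat.mul_0_r|].
  rewrite Nat.mul_succ_r, seq_app, rsum_app, IH, rsum_seq_S,
    (rsum_seq_shift (0 + k * r)). reflexivity.
Qed.

(** Rows of nonnegative index; the others are mirror images. *)
Definition half (v w : vec3) (m r : nat) : R :=
  rsum (seq 0 r) (fun j => rowcount v w m (Z.of_nat j)).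

Lemma perp_half (x v w : vec3) (m r : nat) : reduced_basis x v w -> (1 <= r)%nat ->
  (2 * Z.of_nat m < Z.of_nat r * vnorm w)%Z ->
  perp x m + 1 = 2 * half v w m r - rowcount v w m 0.
Proof.
  intros H Hr Hm. rewrite (perp_rows x v w m (2 * m + r) H) by lia.
  rewrite rsum_zrange_even by apply rowcount_opp.
  replace (S (2 * m + r)) with (r + (2 * m + 1))%nat by lia.
  rewrite rsum_seq_extend; [reflexivity|].
  intros j Hj. apply (rowcount_far x); [exact H|].
  destruct (rb_shortest _ _ _ H) as [V0 _]. nia.
Qed.

(** Row [k j + i] lies between rows [k j] and [k (j + 1)], which are dilates of rows [j] and
    [j + 1]. Passing from [j] to [j + 1] telescopes and costs only the central row. *)
Lemma half_scale (x v w : vec3) (m k r : nat) : reduced_basis x v w -> (1 <= k)%nat ->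
  (2 * Z.of_nat m < Z.of_nat r * vnorm w)%Z ->
  Rabs (half v w (k * m) (k * r) - INR k ^ 2 * half v w m r)
    <= INR k ^ 2 * (3 * INR r + rowcount v w m 0).
Proof.
  intros H Hk Hm. assert (Hk1 : 1 <= INR k) by (apply (le_INR 1); exact Hk).
  unfold half. rewrite rsum_blocks.
  set (c := fun j => rowcount v w m (Z.of_nat j)).
  set (D := fun j => rowcount v w (k * m) (Z.of_nat j)).
  assert (Hc0 : forall j, 0 <= c j) by (intros; apply rowcount_ge0).
  assert (Hs : forall j, Rabs (D (k * j)%nat - INR k * c j) <= 2 * INR k).
  { intros j. unfold D, c. rewrite Nat2Z.inj_mul. now apply (rowcount_scale x). }
  assert (Hd : forall i j, (i <= j)%nat -> D j <= D i + 1).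
  { intros i j Hij. apply (rowcount_decr x v w _ _ _ H). lia. }
  assert (Up : forall j, rsum (seq 0 k) (fun i => D (k * j + i)%nat) <= INR k ^ 2 * c j + 3 * INR k ^ 2).
  { intros j. apply Rle_trans with (rsum (seq 0 k) (fun _ => INR k * c j + 2 * INR k + 1)).
    - apply rsum_le. intros i _. assert (Q := Hd (k * j)%nat (k * j + i)%nat ltac:(lia)).
      specialize (Hs j). apply Rabs_le_between in Hs. lra.
    - rewrite rsum_const, length_seq. nra. }
  assert (Lo : forall j, INR k ^ 2 * c (S j) - 3 * INR k ^ 2 <= rsum (seq 0 k) (fun i => D (k * j + i)%nat)).
  { intros j. apply Rle_trans with (rsum (seq 0 k) (fun _ => INR k * c (S j) - 2 * INR k - 1)).
    - rewrite rsum_const, length_seq. nra.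
    - apply rsum_le. intros i Hi. apply in_seq in Hi.
      assert (Q := Hd (k * j + i)%nat (k * S j)%nat ltac:(nia)).
      specialize (Hs (S j)). apply Rabs_le_between in Hs. lra. }
  assert (Shift : rsum (seq 0 r) (fun j => c (S j)) = rsum (seq 0 r) c - c 0%nat).
  { assert (E1 := rsum_seq_S r c). rewrite rsum_seq_Sl in E1.
    assert (E2 : c r = 0); [|lra].
    apply (rowcount_far x); [exact H|]. rewrite Z.abs_eq by lia. exact Hm. }
  assert (U := rsum_le (seq 0 r) _ _ (fun j _ => Up j)).
  assert (L := rsum_le (seq 0 r) _ _ (fun j _ => Lo j)).
  rewrite rsum_plus, rsum_scal, rsum_const, length_seq in U.
  unfold Rminus in L. rewrite rsum_plus, rsum_scal, rsum_const, length_seq, Shift in L.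
  change (rowcount v w m 0) with (c 0%nat).
  specialize (Hc0 0%nat).
  assert (0 <= INR k ^ 2 * c 0%nat) by (apply Rmult_le_pos; nra).
  change (rsum (seq 0 r) (fun j => rsum (seq 0 k) (fun i => rowcount v w (k * m) (Z.of_nat (k * j + i)))))
    with (rsum (seq 0 r) (fun j => rsum (seq 0 k) (fun i => D (k * j + i)%nat))).
  set (S1 := rsum (seq 0 r) (fun j => rsum (seq 0 k) (fun i => D (k * j + i)%nat))) in *.
  change (rsum (seq 0 r) (fun t => c t)) with (rsum (seq 0 r) c) in *.
  set (S0 := rsum (seq 0 r) c) in *.
  apply Rabs_le. lra.
Qed.

(** From this index on, rows have no point at radius [m]. *)
Definition rows (w : vec3) (m : nat) : nat := (Z.to_nat (2 * Z.of_nat m / vnorm w) + 1)%nat.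

Lemma rows_spec (w : vec3) (m : nat) : (0 < vnorm w)%Z ->
  (2 * Z.of_nat m < Z.of_nat (rows w m) * vnorm w)%Z /\
  INR (rows w m) <= 2 * (INR m / IZR (vnorm w)) + 1.
Proof.
  intros Hw. unfold rows.
  assert (D := Z.div_mod (2 * Z.of_nat m) (vnorm w) ltac:(lia)).
  assert (M := Z.mod_pos_bound (2 * Z.of_nat m) (vnorm w) Hw).
  assert (Q : (0 <= 2 * Z.of_nat m / vnorm w)%Z) by (apply Z.div_pos; lia).
  set (q := (2 * Z.of_nat m / vnorm w)%Z) in *. split; [nia|].
  assert (W : 0 < IZR (vnorm w)) by now apply IZR_lt.
  rewrite !INR_IZR_INZ. replace (Z.of_nat (Z.to_nat q + 1)) with (q + 1)%Z by lia.
  rewrite plus_IZR. apply Rplus_le_compat_r.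
  apply Rmult_le_reg_r with (IZR (vnorm w)); [exact W|].
  replace (2 * (IZR (Z.of_nat m) / IZR (vnorm w)) * IZR (vnorm w)) with (2 * IZR (Z.of_nat m)) by (field; lra).
  rewrite <- !mult_IZR. apply IZR_le. nia.
Qed.

Lemma perp_short (x v : vec3) (m : nat) : shortest x v -> (Z.of_nat m < vnorm v)%Z -> perp x m = 0.
Proof.
  intros [_ [_ Hmin]] Hm. apply rsum_zero. intros y Hy. apply in_ball in Hy. unfold orth.
  destruct (Z.eqb (dot x y) 0) eqn:E; [|reflexivity]. apply Z.eqb_eq in E.
  specialize (Hmin y ltac:(lia) E). lia.
Qed.

Lemma perp_upper (x v w : vec3) (m : nat) : reduced_basis x v w ->
  perp x m + 1 <= 2 * INR (rows w m) * (rowcount v w m 0 + 1).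
Proof.
  intros H. destruct (rb_shortest _ _ _ H) as [V0 _]. assert (VW := rb_le _ _ _ H).
  destruct (rows_spec w m ltac:(lia)) as [R1 _].
  rewrite (perp_half x v w m (rows w m) H); [|unfold rows; lia|exact R1].
  assert (C0 := rowcount_ge0 v w m 0).
  assert (Q : half v w m (rows w m) <= INR (rows w m) * (rowcount v w m 0 + 1)).
  { unfold half. apply Rle_trans with (rsum (seq 0 (rows w m)) (fun _ => rowcount v w m 0 + 1)).
    - apply rsum_le. intros j _. apply (rowcount_decr x v w m 0 _ H). lia.
    - rewrite rsum_const, length_seq. lra. }
  lra.
Qed.

(** If [m < |v|] there is no point at radius [m], and the crude bound [(k m / |v|)^2] at radius
    [k m] is already of order [k^2 m / |v|]. Otherwise the rows are compared. *)
Lemma perp_scale_primitive (x v : vec3) (k m : nat) : primitive x -> shortest x v ->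
  (1 <= k)%nat -> (1 <= m)%nat ->
  Rabs (perp x (k * m) - INR k ^ 2 * perp x m) <= 31 * (INR k ^ 2 * (INR m / IZR (vnorm v))).
Proof.
  intros Hx Hv Hk Hm. destruct (reduced_basis_exists x Hx) as [v' [w H]].
  assert (Ev : vnorm v = vnorm v').
  { assert (Hv' := rb_shortest _ _ _ H). destruct Hv as [A1 [A2 A3]], Hv' as [B1 [B2 B3]].
    specialize (A3 v' B1 B2). specialize (B3 v A1 A2). lia. }
  rewrite Ev. clear Ev Hv v. rename v' into v.
  assert (Hv := rb_shortest _ _ _ H). destruct (rb_shortest _ _ _ H) as [V0 _].
  assert (VW := rb_le _ _ _ H).
  assert (V1 : 0 < IZR (vnorm v)) by now apply IZR_lt.
  assert (VW1 : IZR (vnorm v) <= IZR (vnorm w)) by now apply IZR_le.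
  assert (Hk1 : 1 <= INR k) by (apply (le_INR 1); exact Hk).
  assert (Hm1 : 1 <= INR m) by (apply (le_INR 1); exact Hm).
  set (t := INR m / IZR (vnorm v)).
  assert (T0 : 0 < t) by (apply Rmult_lt_0_compat; [lra|now apply Rinv_0_lt_compat]).
  assert (Tw : INR m / IZR (vnorm w) <= t).
  { unfold t, Rdiv. apply Rmult_le_compat_l; [lra|]. apply Rinv_le_contravar; lra. }
  assert (Tk : INR (k * m) / IZR (vnorm v) = INR k * t) by (rewrite mult_INR; unfold t; field; lra).
  assert (Tkw : INR (k * m) / IZR (vnorm w) <= INR k * t).
  { replace (INR (k * m) / IZR (vnorm w)) with (INR k * (INR m / IZR (vnorm w)))
      by (rewrite mult_INR; field; lra).
    apply Rmult_le_compat_l; lra. }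
  assert (Ckm := rowcount_centre x v w (k * m) H). rewrite Tk in Ckm.
  assert (Ckm0 := rowcount_ge0 v w (k * m) 0).
  assert (Cm := rowcount_centre x v w m H). fold t in Cm.
  destruct (Z.lt_ge_cases (Z.of_nat m) (vnorm v)) as [Hs|Hs].
  - rewrite (perp_short x v m Hv Hs), Rmult_0_r, Rminus_0_r, Rabs_pos_eq by apply perp_ge0.
    destruct (Z.lt_ge_cases (Z.of_nat (k * m)) (vnorm v)) as [Hs'|Hs'].
    + rewrite (perp_short x v _ Hv Hs'). nra.
    + assert (U := perp_upper x v w (k * m) H).
      destruct (rows_spec w (k * m) ltac:(lia)) as [_ R2].
      assert (Tge : 1 <= INR k * t).
      { rewrite <- Tk. apply Rmult_le_reg_r with (IZR (vnorm v)); [exact V1|].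
        replace (INR (k * m) / IZR (vnorm v) * IZR (vnorm v)) with (INR (k * m)) by (field; lra).
        rewrite Rmult_1_l, INR_IZR_INZ. now apply IZR_le. }
      assert (Tlt : t <= 1).
      { unfold t. apply Rmult_le_reg_r with (IZR (vnorm v)); [exact V1|].
        replace (INR m / IZR (vnorm v) * IZR (vnorm v)) with (INR m) by (field; lra).
        rewrite Rmult_1_l, INR_IZR_INZ. apply IZR_le. lia. }
      assert (U2 : 2 * INR (rows w (k * m)) * (rowcount v w (k * m) 0 + 1) <=
                   (2 * (3 * (INR k * t))) * (4 * (INR k * t))) by nra.
      assert (U3 : (INR k * t) * (INR k * t) <= INR k ^ 2 * t) by nra.
      assert (0 < INR k ^ 2 * t) by nra. lra.
  - assert (Tge : 1 <= t).
    { unfold t. apply Rmult_le_reg_r with (IZR (vnorm v)); [exact V1|].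
      replace (INR m / IZR (vnorm v) * IZR (vnorm v)) with (INR m) by (field; lra).
      rewrite Rmult_1_l, INR_IZR_INZ. now apply IZR_le. }
    destruct (rows_spec w m ltac:(lia)) as [R1 R2].
    set (r := rows w m) in *.
    assert (Hr : (1 <= r)%nat) by (unfold r, rows; lia).
    assert (P1 := perp_half x v w m r H Hr R1).
    assert (P2 := perp_half x v w (k * m) (k * r) H ltac:(nia) ltac:(nia)).
    assert (HS := half_scale x v w m k r H Hk R1).
    apply Rabs_le_between in HS.
    replace (perp x (k * m)) with (2 * half v w (k * m) (k * r) - rowcount v w (k * m) 0 - 1) by lra.
    replace (perp x m) with (2 * half v w m r - rowcount v w m 0 - 1) by lra.
    apply Rabs_le. split; nra.
Qed.

Lemma shortest_scale (k : Z) (x v : vec3) : (0 < k)%Z -> shortest (vscale k x) v -> shortest x v.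
Proof.
  intros Hk [H1 [H2 H3]].
  assert (E : forall y, dot (vscale k x) y = (k * dot x y)%Z).
  { intros y. destruct x as [[a b] c], y as [[a' b'] c']. unfold dot, vscale. ring. }
  rewrite E in H2. split; [exact H1|]. split; [nia|].
  intros y Hy Hd. apply H3; [exact Hy|]. rewrite E, Hd. ring.
Qed.

Lemma perp_vscale (k : Z) (x : vec3) (m : nat) : (0 < k)%Z -> perp (vscale k x) m = perp x m.
Proof.
  intros Hk. apply rsum_ext. intros y _. unfold orth.
  replace (dot (vscale k x) y) with (k * dot x y)%Z
    by (destruct x as [[a b] c], y as [[a' b'] c']; unfold dot, vscale; ring).
  destruct (Z.eqb (dot x y) 0) eqn:E.
  - apply Z.eqb_eq in E. now rewrite E, Z.mul_0_r.
  - apply Z.eqb_neq in E. assert (E' : (k * dot x y <> 0)%Z) by nia. apply Z.eqb_neq in E'. now rewrite E'.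
Qed.

Lemma perp_scale (x v : vec3) (k m : nat) : (0 < vnorm x)%Z -> shortest x v ->
  (1 <= k)%nat -> (1 <= m)%nat ->
  Rabs (perp x (k * m) - INR k ^ 2 * perp x m) <= 31 * (INR k ^ 2 * (INR m / IZR (vnorm v))).
Proof.
  intros Hx Hv Hk Hm. destruct (primitive_part x Hx) as [g [x' [Hg [Hp E]]]]. subst x.
  rewrite !perp_vscale by exact Hg. apply perp_scale_primitive; auto.
  now apply (shortest_scale g).
Qed.

(** The plane lattice orthogonal to a primitive [x] has covolume of order [|x|]. *)
Lemma perp_le (x : vec3) (m : nat) : primitive x -> (vnorm x <= Z.of_nat m)%Z ->
  perp x m <= 40 * (INR m ^ 2 / IZR (vnorm x)).
Proof.
  intros Hx Hm. assert (X0 := primitive_nonzero x Hx).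
  destruct (reduced_basis_exists x Hx) as [v [w H]].
  assert (Hv := rb_shortest _ _ _ H). destruct (rb_shortest _ _ _ H) as [V0 _].
  assert (AR := rb_area _ _ _ H).
  assert (V1 : 0 < IZR (vnorm v)) by now apply IZR_lt.
  assert (W1 : 0 < IZR (vnorm w)) by (apply IZR_lt; lia).
  assert (X1 : 0 < IZR (vnorm x)) by now apply IZR_lt.
  assert (M0 := pos_INR m).
  assert (Pos : 0 <= INR m ^ 2 / IZR (vnorm x)).
  { apply Rmult_le_pos; [nra|left; now apply Rinv_0_lt_compat]. }
  destruct (Z.lt_ge_cases (Z.of_nat m) (vnorm v)) as [Hs|Hs].
  { rewrite (perp_short x v m Hv Hs). lra. }
  assert (U := perp_upper x v w m H).
  destruct (rows_spec w m ltac:(lia)) as [_ R2].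
  assert (Cm := rowcount_centre x v w m H). assert (Cm0 := rowcount_ge0 v w m 0).
  set (t := INR m / IZR (vnorm v)) in *. set (u := INR m / IZR (vnorm w)) in *.
  assert (T1 : 1 <= t).
  { unfold t. apply Rmult_le_reg_r with (IZR (vnorm v)); [exact V1|].
    replace (INR m / IZR (vnorm v) * IZR (vnorm v)) with (INR m) by (field; lra).
    rewrite Rmult_1_l, INR_IZR_INZ. now apply IZR_le. }
  assert (U0 : 0 <= u) by (apply Rmult_le_pos; [lra|left; now apply Rinv_0_lt_compat]).
  assert (B1 : u * t <= 2 * (INR m ^ 2 / IZR (vnorm x))).
  { replace (u * t) with (INR m ^ 2 * / (IZR (vnorm v) * IZR (vnorm w))) by (unfold u, t; field; lra).
    replace (2 * (INR m ^ 2 / IZR (vnorm x))) with (INR m ^ 2 * / (IZR (vnorm x) / 2)) by (field; lra).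
    apply Rmult_le_compat_l; [nra|]. apply Rinv_le_contravar; [lra|].
    rewrite <- mult_IZR. apply IZR_le in AR. rewrite !mult_IZR in *. lra. }
  assert (B2 : t <= INR m ^ 2 / IZR (vnorm x)).
  { unfold t. apply Rle_trans with (INR m * 1).
    - apply Rmult_le_compat_l; [lra|]. rewrite <- Rinv_1. apply Rinv_le_contravar; [lra|].
      apply IZR_le. lia.
    - apply Rmult_le_reg_r with (IZR (vnorm x)); [exact X1|].
      replace (INR m ^ 2 / IZR (vnorm x) * IZR (vnorm x)) with (INR m * INR m) by (field; lra).
      rewrite Rmult_1_r. apply Rmult_le_compat_l; [lra|]. rewrite INR_IZR_INZ. now apply IZR_le. }
  nra.
Qed.

(** Vectors with coordinates in [0..M] and equal product with [x] differ by vectors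
    orthogonal to [x]. *)
Lemma perp_pigeonhole (x : vec3) (n M : nat) : vnorm x = Z.of_nat n ->
  (INR M + 1) ^ 3 <= (perp x M + 1) * (6 * INR n * INR M + 1).
Proof.
  intros Hx.
  set (q := list_prod (list_prod (map Z.of_nat (seq 0 (S M))) (map Z.of_nat (seq 0 (S M))))
                      (map Z.of_nat (seq 0 (S M))) : list vec3).
  assert (NDr : NoDup (map Z.of_nat (seq 0 (S M)))).
  { apply NoDup_map_NoDup_ForallPairs; [|apply seq_NoDup]. intros a b _ _ E. lia. }
  assert (NDq : NoDup q) by (repeat apply NoDup_list_prod; exact NDr).
  assert (Inq : forall y0 y1 y2, In (y0, y1, y2) q ->
     (0 <= y0 <= Z.of_nat M /\ 0 <= y1 <= Z.of_nat M /\ 0 <= y2 <= Z.of_nat M)%Z).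
  { intros y0 y1 y2 Hq. unfold q, vec3 in Hq. rewrite !in_prod_iff, !in_map_iff in Hq.
    destruct Hq as [[[a [A1 A2]] [b [B1 B2]]] [c [C1 C2]]]. rewrite in_seq in *. lia. }
  assert (Lq : INR (length q) = (INR M + 1) ^ 3).
  { unfold q, vec3. rewrite !length_prod, !length_map, !length_seq, !mult_INR, S_INR. ring. }
  set (B := (3 * n * M)%nat).
  assert (Hval : forall y, In y q -> In (dot x y) (zrange B)).
  { intros [[y0 y1] y2] Hq. apply Inq in Hq. apply in_zrange.
    destruct x as [[x0 x1] x2]. unfold vnorm in Hx. unfold dot.
    assert (P : forall a b, (Z.abs a <= Z.of_nat n -> 0 <= b <= Z.of_nat M ->
       Z.abs (a * b) <= Z.of_nat n * Z.of_nat M)%Z).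
    { intros a b Ha Hb. rewrite Z.abs_mul. apply Z.mul_le_mono_nonneg; lia. }
    assert (P0 := P x0 y0 ltac:(lia) ltac:(lia)). assert (P1 := P x1 y1 ltac:(lia) ltac:(lia)).
    assert (P2 := P x2 y2 ltac:(lia) ltac:(lia)). unfold B. rewrite !Nat2Z.inj_mul. lia. }
  assert (Hfib : forall t, rsum q (fun y => if Z.eqb (dot x y) t then 1 else 0) <= perp x M + 1).
  { intros t. rewrite <- (rsum_filter _ _ (fun _ => 1)).
    destruct (filter (fun y => Z.eqb (dot x y) t) q) as [|y0 l] eqn:E.
    - assert (Q := perp_ge0 x M). unfold rsum; simpl; lra.
    - rewrite <- E. rewrite rsum_one.
      assert (Hy0 : In y0 q /\ dot x y0 = t).
      { assert (Q : In y0 (filter (fun y => Z.eqb (dot x y) t) q)) by (rewrite E; now left).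
        apply filter_In in Q. now rewrite Z.eqb_eq in Q. }
      rewrite <- perp_zbox. unfold orth. rewrite <- (rsum_filter _ _ (fun _ => 1)), rsum_one.
      apply le_INR.
      rewrite <- (length_map (fun y => vadd y (vscale (-1) y0)) (filter _ q)).
      apply NoDup_incl_length.
      + apply NoDup_map_NoDup_ForallPairs; [|now apply NoDup_filter].
        intros a b _ _ Eab. clear - Eab. destruct a as [[a0 a1] a2], b as [[b0 b1] b2], y0 as [[c0 c1] c2].
        unfold vadd, vscale in Eab. injection Eab as E0 E1 E2. repeat apply f_equal2; lia.
      + intros z Hz. apply in_map_iff in Hz. destruct Hz as [y [Ez Hy]]. apply filter_In in Hy.
        destruct Hy as [Hy Hd]. apply Z.eqb_eq in Hd. destruct Hy0 as [Hy0 Hd0].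
        apply filter_In. rewrite in_zbox, Z.eqb_eq. subst z. split.
        * destruct y as [[y1 y2] y3], y0 as [[c1 c2] c3]. apply Inq in Hy, Hy0.
          unfold vadd, vscale, vnorm. lia.
        * clear - Hd Hd0. destruct x as [[x0 x1] x2], y as [[y1 y2] y3], y0 as [[c1 c2] c3].
          unfold dot, vadd, vscale in *. lia. }
  assert (E : INR (length q) = rsum (zrange B) (fun t => rsum q (fun y => if Z.eqb (dot x y) t then 1 else 0))).
  { rewrite rsum_swap, <- rsum_one. apply rsum_ext. intros y Hy. specialize (Hval y Hy).
    destruct (in_split _ _ Hval) as [l1 [l2 El]].
    assert (ND := NoDup_zrange B). rewrite El in ND |- *. apply NoDup_remove_2 in ND.
    rewrite rsum_app. change (rsum (dot x y :: l2) (fun t => if Z.eqb (dot x y) t then 1 else 0))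
      with ((if Z.eqb (dot x y) (dot x y) then 1 else 0) + rsum l2 (fun t => if Z.eqb (dot x y) t then 1 else 0)).
    rewrite Z.eqb_refl, !rsum_zero; [ring| |];
      intros t Ht; (destruct (Z.eqb (dot x y) t) eqn:Et; [|reflexivity]); apply Z.eqb_eq in Et;
      exfalso; apply ND; apply in_or_app; subst t; auto. }
  rewrite <- Lq, E.
  eapply Rle_trans; [apply rsum_le; intros t _; apply Hfib|].
  rewrite rsum_const, length_zrange.
  replace (INR (2 * B + 1)) with (6 * INR n * INR M + 1)
    by (unfold B; rewrite plus_INR, !mult_INR; simpl; ring).
  right; ring.
Qed.

(** * Densities of orthogonal vectors *)

Lemma limit_from_rate (p : nat -> R) (d : nat -> R) :
  is_lim_seq d 0 -> (forall n m, (1 <= n)%nat -> (n <= m)%nat -> Rabs (p n - p m) <= d n) ->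
  exists a, forall n, (1 <= n)%nat -> Rabs (p n - a) <= d n.
Proof.
  intros Hd Hp.
  assert (E : ex_finite_lim_seq p).
  { apply ex_lim_seq_cauchy_corr. intros eps. rewrite is_lim_seq_eps in Hd.
    destruct (Hd eps (cond_pos eps)) as [N HN]. exists (S N).
    assert (W : forall n m, (S N <= n)%nat -> (n <= m)%nat -> Rabs (p n - p m) < eps).
    { intros n m Hn Hm. eapply Rle_lt_trans; [apply Hp; lia|].
      specialize (HN n ltac:(lia)). rewrite Rminus_0_r in HN.
      eapply Rle_lt_trans; [apply Rle_abs|exact HN]. }
    intros n m Hn Hm. destruct (Nat.le_ge_cases n m).
    - now apply W.
    - rewrite Rabs_minus_sym. now apply W. }
  destruct E as [a Ha]. exists a. intros n Hn.
  assert (L : is_lim_seq (fun m => Rabs (p n - p (n + m)%nat)) (Rabs (p n - a))).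
  { assert (L0 : is_lim_seq (fun m => p (n + m)%nat) a).
    { apply is_lim_seq_ext with (fun m => p (m + n)%nat); [intros; f_equal; lia|].
      now apply -> is_lim_seq_incr_n. }
    assert (L1 : is_lim_seq (fun m => p n - p (n + m)%nat) (p n - a)).
    { apply is_lim_seq_minus'; [apply is_lim_seq_const|exact L0]. }
    exact (is_lim_seq_abs _ _ L1). }
  apply (is_lim_seq_le (fun m => Rabs (p n - p (n + m)%nat)) (fun _ => d n) (Rabs (p n - a)) (d n)).
  - intros m. apply Hp; lia.
  - exact L.
  - apply is_lim_seq_const.
Qed.

Lemma is_lim_inv_INR (c : R) : is_lim_seq (fun n => c / INR n) 0.
Proof.
  replace (Finite 0) with (Rbar_mult c 0) by (simpl; f_equal; ring).
  apply is_lim_seq_scal_l.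
  apply (is_lim_seq_inv INR p_infty); [apply is_lim_seq_INR|discriminate].
Qed.

(** The quotients [f m / m^2] and [f n / n^2] are both close to the one at [m n]. *)
Lemma scaling_density (f : nat -> R) (e : R) : 0 <= e ->
  (forall k m, (1 <= k)%nat -> (1 <= m)%nat ->
     Rabs (f (k * m)%nat - INR k ^ 2 * f m) <= INR k ^ 2 * (INR m * e)) ->
  exists a, forall m, (1 <= m)%nat -> Rabs (f m - a * INR m ^ 2) <= e * INR m.
Proof.
  intros He Hf.
  set (p := fun m => f m / INR m ^ 2).
  assert (Hk : forall k m, (1 <= k)%nat -> (1 <= m)%nat -> Rabs (p (k * m)%nat - p m) <= e / INR m).
  { intros k m Hk Hm. assert (K1 := le_INR 1 k Hk). assert (M1 := le_INR 1 m Hm). simpl in K1, M1.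
    assert (P : 0 < INR k ^ 2 * INR m ^ 2) by (apply Rmult_lt_0_compat; nra).
    apply Rmult_le_reg_r with (INR k ^ 2 * INR m ^ 2); [exact P|].
    rewrite <- (Rabs_pos_eq (INR k ^ 2 * INR m ^ 2)) at 1 by lra.
    rewrite <- Rabs_mult. unfold p. rewrite mult_INR.
    replace ((f (k * m)%nat / (INR k * INR m) ^ 2 - f m / INR m ^ 2) * (INR k ^ 2 * INR m ^ 2))
      with (f (k * m)%nat - INR k ^ 2 * f m) by (field; lra).
    eapply Rle_trans; [now apply Hf|]. right. field. lra. }
  destruct (limit_from_rate p (fun n => (2 * e) / INR n)) as [a Ha].
  - apply is_lim_inv_INR.
  - intros n m Hn Hnm. assert (N1 := le_INR 1 n Hn). assert (M1 := le_INR n m Hnm). simpl in N1.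
    assert (Q1 := Hk n m ltac:(lia) ltac:(lia)). assert (Q2 := Hk m n ltac:(lia) ltac:(lia)).
    rewrite (Nat.mul_comm m n) in Q2.
    assert (Q3 : e / INR m <= e / INR n).
    { apply Rmult_le_compat_l; [exact He|]. apply Rinv_le_contravar; lra. }
    apply Rabs_le_between in Q1. apply Rabs_le_between in Q2.
    replace (2 * e / INR n) with (e / INR n + e / INR n) by (field; lra).
    apply Rabs_le. lra.
  - (* the multiples of [m] give the sharper constant *)
    exists a. intros m Hm. assert (M1 := le_INR 1 m Hm). simpl in M1.
    assert (L : Rabs (p m - a) <= e / INR m).
    { apply Rnot_lt_le. intros Hlt.
      assert (D := is_lim_inv_INR (2 * e)). rewrite is_lim_seq_eps in D.
      destruct (D (Rabs (p m - a) - e / INR m)) as [N HN]; [lra|].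
      specialize (HN (S N * m)%nat ltac:(nia)). rewrite Rminus_0_r in HN.
      assert (Q1 := Ha (S N * m)%nat ltac:(nia)).
      assert (Q2 := Hk (S N) m ltac:(lia) Hm).
      assert (Q3 := Rle_abs (2 * e / INR (S N * m))).
      assert (Q4 := Rabs_triang (p m - p (S N * m)%nat) (p (S N * m)%nat - a)).
      replace (p m - p (S N * m)%nat + (p (S N * m)%nat - a)) with (p m - a) in Q4 by ring.
      rewrite (Rabs_minus_sym (p m) (p (S N * m)%nat)) in Q4. cbv beta in *. lra. }
    assert (P : 0 < INR m ^ 2) by nra.
    apply Rmult_le_compat_r with (r := INR m ^ 2) in L; [|lra].
    rewrite <- (Rabs_pos_eq (INR m ^ 2)) in L at 1 by lra. rewrite <- Rabs_mult in L.
    unfold p in L.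
    replace ((f m / INR m ^ 2 - a) * INR m ^ 2) with (f m - a * INR m ^ 2) in L by (field; lra).
    replace (e / INR m * INR m ^ 2) with (e * INR m) in L by (field; lra). exact L.
Qed.

Lemma quadratic_coefficient_ge (f : nat -> R) (a c d e : R) :
  (forall m, (1 <= m)%nat -> Rabs (f m - a * INR m ^ 2) <= e * INR m) ->
  (forall m, (1 <= m)%nat -> c * INR m ^ 2 - d * INR m <= f m) -> c <= a.
Proof.
  intros Ha Hc. apply Rnot_lt_le. intros Hlt.
  destruct (INR_unbounded ((d + e) / (c - a))) as [m Hm].
  specialize (Ha (S m) ltac:(lia)). specialize (Hc (S m) ltac:(lia)).
  assert (Q := Rle_abs (f (S m) - a * INR (S m) ^ 2)).
  assert (M0 := INR_S_ge1 m).
  assert (Hm' : (d + e) / (c - a) < INR (S m)) by (rewrite S_INR; lra).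
  apply Rmult_lt_compat_r with (r := c - a) in Hm'; [|lra].
  replace ((d + e) / (c - a) * (c - a)) with (d + e) in Hm' by (field; lra).
  nra.
Qed.

(** The quotient [B n / n^2] changes by at most [3 D n^(-1/2)] under doubling;
    over all doublings the constant 12 reproduces itself because [12 / sqrt 2 + 3 <= 12]. *)
Lemma symmetric_density (B : nat -> R) (D : R) : 0 <= D ->
  (forall n m, (1 <= n)%nat -> (1 <= m)%nat ->
     Rabs (INR m ^ 2 * B n - INR n ^ 2 * B m) <=
       D * (INR m * (INR n ^ 2 * sqrt (INR n)) + INR n * (INR m ^ 2 * sqrt (INR m)))) ->
  exists b, forall n, (1 <= n)%nat -> Rabs (B n - b * INR n ^ 2) <= 12 * D * (INR n * sqrt (INR n)).
Proof.
  intros HD HB.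
  set (p := fun n => B n / INR n ^ 2).
  assert (Hs : forall n, (1 <= n)%nat -> 1 <= sqrt (INR n) /\ sqrt (INR n) * sqrt (INR n) = INR n).
  { intros n Hn. assert (N1 := le_INR 1 n Hn). simpl in N1. split.
    - rewrite <- sqrt_1 at 1. now apply sqrt_le_1_alt.
    - apply sqrt_sqrt. lra. }
  assert (S2 : 4 / 3 <= sqrt 2).
  { replace (4 / 3) with (sqrt ((4 / 3) * (4 / 3))) by (apply sqrt_square; lra).
    apply sqrt_le_1_alt. lra. }
  assert (Hpm : forall n m, (1 <= n)%nat -> (1 <= m)%nat ->
     Rabs (p n - p m) <= D * (sqrt (INR n) / INR m + sqrt (INR m) / INR n)).
  { intros n m Hn Hm. assert (N1 := le_INR 1 n Hn). assert (M1 := le_INR 1 m Hm). simpl in N1, M1.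
    assert (P : 0 < INR n ^ 2 * INR m ^ 2) by (apply Rmult_lt_0_compat; nra).
    apply Rmult_le_reg_r with (INR n ^ 2 * INR m ^ 2); [exact P|].
    rewrite <- (Rabs_pos_eq (INR n ^ 2 * INR m ^ 2)) at 1 by lra.
    rewrite <- Rabs_mult. unfold p.
    replace ((B n / INR n ^ 2 - B m / INR m ^ 2) * (INR n ^ 2 * INR m ^ 2))
      with (INR m ^ 2 * B n - INR n ^ 2 * B m) by (field; lra).
    eapply Rle_trans; [now apply HB|]. right. field. lra. }
  assert (Hdbl : forall n m, (1 <= n)%nat -> (n <= m)%nat -> (m <= 2 * n)%nat ->
     Rabs (p n - p m) <= 3 * D / sqrt (INR n)).
  { intros n m Hn Hnm Hm. eapply Rle_trans; [apply Hpm; lia|].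
    destruct (Hs n Hn) as [A1 A2]. destruct (Hs m ltac:(lia)) as [B1 B2].
    assert (N1 := le_INR 1 n Hn). simpl in N1. assert (NM := le_INR n m Hnm).
    assert (M2 := le_INR m (2 * n) Hm). rewrite mult_INR in M2. simpl in M2.
    set (a := sqrt (INR n)) in *. set (c := sqrt (INR m)) in *.
    assert (C2 : c <= 2 * a) by nra.
    replace (3 * D / a) with (D * (1 / a + 2 / a)) by (field; lra).
    apply Rmult_le_compat_l; [exact HD|]. apply Rplus_le_compat.
    - apply Rle_trans with (a / INR n).
      + apply Rmult_le_compat_l; [lra|]. apply Rinv_le_contravar; lra.
      + right. rewrite <- A2. field. lra.
    - apply Rle_trans with (2 * a / INR n).
      + apply Rmult_le_compat_r; [|exact C2]. left; apply Rinv_0_lt_compat; lra.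
      + right. rewrite <- A2. field. lra. }
  assert (Hall : forall n m, (1 <= n)%nat -> (n <= m)%nat -> Rabs (p n - p m) <= 12 * D / sqrt (INR n)).
  { intros n m. remember (m - n)%nat as k eqn:Ek. revert n m Ek.
    induction k as [k IH] using lt_wf_ind. intros n m Ek Hn Hnm.
    destruct (Hs n Hn) as [A1 A2].
    assert (I0 : 0 < / sqrt (INR n)) by (apply Rinv_0_lt_compat; lra).
    destruct (Nat.le_gt_cases m (2 * n)) as [Hm|Hm].
    - eapply Rle_trans; [now apply Hdbl|]. unfold Rdiv. apply Rmult_le_compat_r; lra.
    - assert (Q1 := Hdbl n (2 * n)%nat Hn ltac:(lia) ltac:(lia)).
      assert (Q2 := IH (m - 2 * n)%nat ltac:(lia) (2 * n)%nat m eq_refl ltac:(lia) ltac:(lia)).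
      assert (Q3 : 12 * D / sqrt (INR (2 * n)) <= 9 * D / sqrt (INR n)).
      { rewrite mult_INR, sqrt_mult by (simpl; try lra; apply pos_INR).
        replace (INR 2) with 2 by (simpl; lra).
        unfold Rdiv. rewrite Rinv_mult.
        assert (J : / sqrt 2 <= / (4 / 3)) by (apply Rinv_le_contravar; lra).
        replace (/ (4 / 3)) with (3 / 4) in J by field.
        rewrite <- Rmult_assoc. apply Rmult_le_compat_r; [lra|]. nra. }
      assert (Q4 := Rabs_triang (p n - p (2 * n)%nat) (p (2 * n)%nat - p m)).
      replace (p n - p (2 * n)%nat + (p (2 * n)%nat - p m)) with (p n - p m) in Q4 by ring.
      unfold Rdiv in *. lra. }
  destruct (limit_from_rate p (fun n => 12 * D / sqrt (INR n))) as [b Hb].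
  - replace (Finite 0) with (Rbar_mult (12 * D) 0) by (simpl; f_equal; ring).
    apply is_lim_seq_scal_l.
    apply (is_lim_seq_inv (fun n => sqrt (INR n)) p_infty); [|discriminate].
    apply (filterlim_comp _ _ _ INR sqrt _ (Rbar_locally p_infty)); [apply is_lim_seq_INR|].
    apply filterlim_sqrt_p.
  - exact Hall.
  - exists b. intros n Hn. specialize (Hb n Hn). assert (N1 := le_INR 1 n Hn). simpl in N1.
    destruct (Hs n Hn) as [A1 A2].
    apply Rmult_le_compat_r with (r := INR n ^ 2) in Hb; [|nra].
    rewrite <- (Rabs_pos_eq (INR n ^ 2)) in Hb at 1 by nra. rewrite <- Rabs_mult in Hb.
    unfold p in Hb.
    replace ((B n / INR n ^ 2 - b) * INR n ^ 2) with (B n - b * INR n ^ 2) in Hb by (field; lra).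
    replace (12 * D / sqrt (INR n) * INR n ^ 2) with (12 * D * (INR n * sqrt (INR n))) in Hb; [exact Hb|].
    apply Rmult_eq_reg_r with (sqrt (INR n)); [|lra].
    replace (12 * D * (INR n * sqrt (INR n)) * sqrt (INR n))
      with (12 * D * (INR n * (sqrt (INR n) * sqrt (INR n)))) by ring.
    rewrite A2. field. lra.
Qed.

Definition short (x : vec3) : vec3 := epsilon (inhabits vzero) (shortest x).

Lemma short_spec (x : vec3) : shortest x (short x).
Proof. unfold short. apply epsilon_spec, shortest_exists. Qed.

(** The constant is that of [perp_scale]. *)
Definition errors (n : nat) : R := rsum (shell n) (fun x => 31 / IZR (vnorm (short x))).

Lemma short_pos (x : vec3) : 0 < 31 / IZR (vnorm (short x)).
Proof.
  destruct (short_spec x) as [H _]. apply Rdiv_lt_0_compat; [lra|now apply IZR_lt].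
Qed.

Lemma errors_ge0 (n : nat) : 0 <= errors n.
Proof. apply rsum_nonneg. intros x _. left; apply short_pos. Qed.

Lemma counts_perp (n m : nat) :
  rsum (seq 0 m) (fun l => counts n (S l)) = rsum (shell n) (fun x => perp x m).
Proof.
  unfold counts. rewrite rsum_swap. apply rsum_ext. intros x _.
  unfold perp, ball. now rewrite rsum_flat_map.
Qed.

Lemma counts_scale (n k m : nat) : (1 <= n)%nat -> (1 <= k)%nat -> (1 <= m)%nat ->
  Rabs (rsum (shell n) (fun x => perp x (k * m)) - INR k ^ 2 * rsum (shell n) (fun x => perp x m))
   <= INR k ^ 2 * (INR m * errors n).
Proof.
  intros Hn Hk Hm.
  replace (rsum (shell n) (fun x => perp x (k * m)) - INR k ^ 2 * rsum (shell n) (fun x => perp x m))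
    with (rsum (shell n) (fun x => perp x (k * m) + (- INR k ^ 2) * perp x m))
    by (rewrite rsum_plus, rsum_scal; ring).
  eapply Rle_trans; [apply rsum_abs|].
  unfold errors. rewrite <- !rsum_scal. apply rsum_le. intros x Hx. apply in_shell in Hx.
  replace (perp x (k * m) + - INR k ^ 2 * perp x m) with (perp x (k * m) - INR k ^ 2 * perp x m) by ring.
  eapply Rle_trans; [apply (perp_scale x (short x)); auto using short_spec; lia|].
  right. unfold Rdiv. ring.
Qed.

Definition is_density (n : nat) (a : R) : Prop :=
  forall m, (1 <= m)%nat ->
    Rabs (rsum (shell n) (fun x => perp x m) - a * INR m ^ 2) <= errors n * INR m.

(** Row 0 contains only the zero vector and gets a default value. *)
Definition density (n : nat) : R :=
  match n with O => 0 | _ => epsilon (inhabits 0) (is_density n) end.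

Lemma density_spec (n : nat) : (1 <= n)%nat -> is_density n (density n).
Proof.
  intros Hn. destruct n as [|n]; [lia|]. apply (epsilon_spec (inhabits 0) (is_density (S n))).
  apply scaling_density; [apply errors_ge0|]. intros k m. apply counts_scale. lia.
Qed.

Lemma length_zbox (n : nat) : INR (length (zbox n)) = (2 * INR n + 1) ^ 3.
Proof.
  unfold zbox, vec3. rewrite !length_prod, !length_zrange, !mult_INR, plus_INR, mult_INR.
  simpl. ring.
Qed.

Lemma length_ball (n : nat) : INR (length (ball n)) = (2 * INR n + 1) ^ 3 - 1.
Proof.
  assert (E := Permutation_length (zbox_ball n)). apply (f_equal INR) in E.
  rewrite length_zbox in E. change (length (vzero :: ball n)) with (S (length (ball n))) in E.
  rewrite S_INR in E. lra.
Qed.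

Lemma length_shell (n : nat) : (1 <= n)%nat -> INR (length (shell n)) <= 26 * INR n ^ 2.
Proof.
  intros Hn. assert (N1 := le_INR 1 n Hn). simpl in N1.
  assert (L : (length (zbox (n - 1) ++ shell n) <= length (zbox n))%nat).
  { apply NoDup_incl_length.
    - apply NoDup_app; [apply NoDup_zbox|apply NoDup_shell|].
      intros x H1 H2. apply in_zbox in H1. apply in_shell in H2. lia.
    - intros x Hx. apply in_zbox. apply in_app_or in Hx. destruct Hx as [Hx|Hx].
      + apply in_zbox in Hx. lia.
      + apply in_shell in Hx. lia. }
  apply le_INR in L. rewrite length_app, plus_INR, !length_zbox, minus_INR in L by exact Hn.
  simpl INR in L. nra.
Qed.

Lemma perp_lower (x : vec3) (n m : nat) : vnorm x = Z.of_nat n -> (1 <= n)%nat -> (1 <= m)%nat ->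
  INR m ^ 2 / (6 * INR n) - 1 <= perp x m.
Proof.
  intros Hx Hn Hm. assert (N1 := le_INR 1 n Hn). assert (M1 := le_INR 1 m Hm). simpl in N1, M1.
  assert (P := perp_pigeonhole x n m Hx). assert (P0 := perp_ge0 x m).
  assert (Q3 : INR m ^ 2 / (6 * INR n) <= perp x m + 1); [|lra].
  apply Rmult_le_reg_r with (6 * INR n); [lra|].
  replace (INR m ^ 2 / (6 * INR n) * (6 * INR n)) with (INR m ^ 2) by (field; lra). nra.
Qed.

(** Pigeonhole gives each [x] of norm [n] a density of at least [1 / (6 n)]. *)
Lemma density_lower_bound (n : nat) : (1 <= n)%nat ->
  INR (length (shell n)) / (6 * INR n) <= density n.
Proof.
  intros Hn. assert (N1 := le_INR 1 n Hn). simpl in N1.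
  apply (quadratic_coefficient_ge _ _ _ (INR (length (shell n))) _ (density_spec n Hn)).
  intros m Hm. assert (M1 := le_INR 1 m Hm). simpl in M1.
  apply Rle_trans with (rsum (shell n) (fun _ => INR m ^ 2 / (6 * INR n) - 1)).
  - rewrite rsum_const. assert (L := pos_INR (length (shell n))).
    replace (INR (length (shell n)) / (6 * INR n) * INR m ^ 2)
      with (INR (length (shell n)) * (INR m ^ 2 / (6 * INR n))) by (field; lra). nra.
  - apply rsum_le. intros x Hx. apply in_shell in Hx. now apply perp_lower.
Qed.

Lemma density_nonneg (n : nat) : 0 <= density n.
Proof.
  destruct n as [|n]; [simpl; lra|].
  eapply Rle_trans; [|apply density_lower_bound; lia].
  apply Rmult_le_pos; [apply pos_INR|]. left. apply Rinv_0_lt_compat.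
  assert (Q := INR_S_ge1 n). lra.
Qed.

Lemma density_sum_lower (n : nat) : (1 <= n)%nat ->
  4 / 3 * INR n ^ 2 <= rsum (seq 0 n) (fun i => density (S i)).
Proof.
  intros Hn. assert (N1 := le_INR 1 n Hn). simpl in N1.
  apply Rle_trans with (rsum (seq 0 n) (fun i => / (6 * INR n) * INR (length (shell (S i))))).
  - rewrite rsum_scal.
    rewrite (rsum_ext _ _ (fun i => rsum (shell (S i)) (fun _ => 1))) by (intros; now rewrite rsum_one).
    rewrite <- rsum_flat_map. fold (ball n). rewrite rsum_one, length_ball.
    apply Rmult_le_reg_l with (6 * INR n); [lra|].
    replace (6 * INR n * (/ (6 * INR n) * ((2 * INR n + 1) ^ 3 - 1)))
      with ((2 * INR n + 1) ^ 3 - 1) by (field; lra). nra.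
  - apply rsum_le. intros i Hi. apply in_seq in Hi.
    eapply Rle_trans; [|apply density_lower_bound; lia].
    rewrite Rmult_comm. apply Rmult_le_compat_l; [apply pos_INR|].
    assert (Q := INR_S_ge1 i). apply Rinv_le_contravar; [lra|].
    assert (Q2 : INR (S i) <= INR n) by (apply le_INR; lia). lra.
Qed.

(** Below the length of [v] the pigeonhole count must be trivial. *)
Lemma shortest_le (x v : vec3) : (0 < vnorm x)%Z -> shortest x v ->
  (vnorm v * vnorm v <= 6 * vnorm x)%Z.
Proof.
  intros Hx Hv. assert (V0 := proj1 Hv).
  assert (P := perp_pigeonhole x (Z.to_nat (vnorm x)) (Z.to_nat (vnorm v - 1)) ltac:(lia)).
  rewrite (perp_short x v _ Hv) in P by lia.
  rewrite !INR_IZR_INZ, !Z2Nat.id in P by lia. rewrite minus_IZR in P.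
  assert (V1 : 1 <= IZR (vnorm v)) by (apply IZR_le; lia).
  assert (X1 : 1 <= IZR (vnorm x)) by (apply IZR_le; lia).
  apply le_IZR. rewrite !mult_IZR.
  set (a := IZR (vnorm v)) in *. set (c := IZR (vnorm x)) in *.
  apply Rmult_le_reg_r with a; [lra|].
  replace ((a - 1 + 1) ^ 3) with (a * a * a) in P by ring. nra.
Qed.

Lemma perp_mono (x : vec3) (m m' : nat) : (m <= m')%nat -> perp x m <= perp x m'.
Proof.
  intros H. apply rsum_incl; [apply NoDup_ball| |intros; apply orth_ge0].
  intros y. rewrite !in_ball. lia.
Qed.

(** Each [x] is charged to its shortest orthogonal vector [v], and the [x] charged to
    [v] lie on the plane lattice orthogonal to [v]. *)
Lemma errors_sum (X : nat) :
  rsum (seq 0 X) (fun i => errors (S i)) <= 3481920 * Rpower (INR (S X)) (5 / 2).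
Proof.
  destruct X as [|X0].
  { unfold rsum. simpl map. simpl fold_right. assert (P := Rpower_pos (INR 1) (5/2)). lra. }
  set (X := S X0). assert (X1 : 1 <= INR X) by apply INR_S_ge1.
  unfold errors. rewrite <- rsum_flat_map. fold (ball X).
  set (V := Nat.sqrt (6 * X)).
  assert (HV : (V * V <= 6 * X)%nat) by (destruct (Nat.sqrt_spec (6 * X) ltac:(lia)); assumption).
  assert (HV2 : (6 * X < S V * S V)%nat) by (destruct (Nat.sqrt_spec (6 * X) ltac:(lia)); assumption).
  assert (HV6 : (V <= 6 * X)%nat) by apply Nat.sqrt_le_lin.
  set (g := fun v => if primitiveb v then 31 / IZR (vnorm v) else 0).
  assert (Hg : forall v, In v (ball V) -> 0 <= g v).
  { intros v Hv. apply in_ball in Hv. unfold g. destruct (primitiveb v); [|lra].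
    left. apply Rdiv_lt_0_compat; [lra|]. apply IZR_lt; lia. }
  apply Rle_trans with (rsum (ball X) (fun x => rsum (ball V) (fun v => g v * orth v x))).
  { apply rsum_le. intros x Hx. apply in_ball in Hx.
    assert (Hs := short_spec x). set (v := short x) in *.
    assert (Hl := shortest_le x v ltac:(lia) Hs). assert (Hp := shortest_primitive x v Hs).
    destruct Hs as [V0 [Hd _]].
    apply Rle_trans with (rsum (v :: nil) (fun v => g v * orth v x)).
    - unfold rsum, g, orth; simpl. apply primitiveb_spec in Hp. rewrite Hp.
      rewrite dot_comm, Hd. simpl. lra.
    - apply rsum_incl.
      + constructor; [intros []|constructor].
      + intros u [<-|[]]. apply in_ball. split; [exact V0|]. nia.
      + intros u Hu. apply Rmult_le_pos; [now apply Hg|apply orth_ge0]. }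
  rewrite rsum_swap.
  apply Rle_trans with (rsum (ball V) (fun v => 44640 * INR X ^ 2 * / (IZR (vnorm v) ^ 2))).
  { apply rsum_le. intros v Hv. rewrite rsum_scal. fold (perp v X).
    assert (Hgv := Hg v Hv). unfold g in *. apply in_ball in Hv.
    assert (V1 : 0 < IZR (vnorm v)) by (apply IZR_lt; lia).
    assert (Pos : 0 <= 44640 * INR X ^ 2 * / IZR (vnorm v) ^ 2).
    { apply Rmult_le_pos; [nra|]. left. apply Rinv_0_lt_compat. nra. }
    destruct (primitiveb v) eqn:E; [|rewrite Rmult_0_l; exact Pos].
    apply primitiveb_spec in E.
    assert (Q1 := perp_mono v X (6 * X) ltac:(lia)).
    assert (Q2 := perp_le v (6 * X) E ltac:(lia)).
    rewrite mult_INR in Q2. simpl (INR 6) in Q2.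
    apply Rle_trans with (31 / IZR (vnorm v) * (40 * (((1 + 1 + 1 + 1 + 1 + 1) * INR X) ^ 2 / IZR (vnorm v)))).
    - apply Rmult_le_compat_l; [exact Hgv|]. lra.
    - right. field. lra. }
  rewrite rsum_scal. unfold ball. rewrite rsum_flat_map.
  assert (B : rsum (seq 0 V) (fun i => rsum (shell (S i)) (fun v => / IZR (vnorm v) ^ 2)) <= INR V * 26).
  { rewrite <- (length_seq V 0) at 2. rewrite <- rsum_const. apply rsum_le. intros i _.
    assert (I1 := INR_S_ge1 i).
    rewrite (rsum_ext _ _ (fun _ => / INR (S i) ^ 2)).
    - rewrite rsum_const. assert (L := length_shell (S i) ltac:(lia)).
      apply Rmult_le_reg_r with (INR (S i) ^ 2); [nra|].
      rewrite Rmult_assoc, Rinv_l by nra. lra.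
    - intros v Hv. apply in_shell in Hv. now rewrite Hv, <- INR_IZR_INZ. }
  assert (HVr : INR V <= 3 * Rpower (INR X) (/ 2)).
  { rewrite Rpower_sqrt by lra.
    assert (S1 : sqrt (INR X) * sqrt (INR X) = INR X) by (apply sqrt_sqrt; lra).
    assert (S0 := sqrt_pos (INR X)).
    apply le_INR in HV. rewrite !mult_INR in HV. simpl (INR 6) in HV. nra. }
  assert (R2 : Rpower (INR X) (5/2) <= Rpower (INR (S X)) (5 / 2)).
  { apply Rle_Rpower_l; [lra|]. rewrite (S_INR X). lra. }
  assert (R3 : Rpower (INR X) (5 / 2) = INR X ^ 2 * Rpower (INR X) (/ 2)).
  { replace (5 / 2) with (2 + / 2) by field. rewrite Rpower_plus, Rpower_2 by lra. reflexivity. }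
  assert (X2 : 0 <= INR X ^ 2) by nra.
  apply Rle_trans with (44640 * INR X ^ 2 * (3 * Rpower (INR X) (/ 2) * 26)).
  - apply Rmult_le_compat_l; [lra|]. lra.
  - assert (E : 44640 * INR X ^ 2 * (3 * Rpower (INR X) (/ 2) * 26) = 3481920 * (INR X ^ 2 * Rpower (INR X) (/ 2))) by ring.
    rewrite E, <- R3. lra.
Qed.

(** The number of pairs with norms at most [n] and [m] is approximated from its rows and from
    its columns; comparing the two determines the average of the densities. *)
Lemma counts_regular : exists b Ce Cb, 0 < b /\ regular_counts counts density errors b Ce Cb.
Proof.
  set (B := fun n => rsum (seq 0 n) (fun i => density (S i))).
  set (Q := fun n m => rsum (seq 0 n) (fun i => rsum (seq 0 m) (fun j => counts (S i) (S j)))).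
  assert (Qsym : forall n m, Q n m = Q m n).
  { intros n m. unfold Q. rewrite rsum_swap. apply rsum_ext. intros j _. apply rsum_ext.
    intros i _. apply counts_symmetric. }
  set (D := 27855360).
  assert (HQ : forall n m, (1 <= n)%nat -> (1 <= m)%nat ->
     Rabs (Q n m - B n * INR m ^ 2) <= D * (INR m * (INR n ^ 2 * sqrt (INR n)))).
  { intros n m Hn Hm. assert (N1 := le_INR 1 n Hn). assert (M1 := le_INR 1 m Hm). simpl in N1, M1.
    unfold Q, B.
    replace (rsum (seq 0 n) (fun i => rsum (seq 0 m) (fun j => counts (S i) (S j)))
       - rsum (seq 0 n) (fun i => density (S i)) * INR m ^ 2) with
      (rsum (seq 0 n) (fun i => rsum (seq 0 m) (fun j => counts (S i) (S j)) + (- INR m ^ 2) * density (S i)))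
      by (rewrite rsum_plus, rsum_scal; ring).
    eapply Rle_trans; [apply rsum_abs|].
    apply Rle_trans with (rsum (seq 0 n) (fun i => INR m * errors (S i))).
    - apply rsum_le. intros i _. rewrite counts_perp.
      assert (S1 := density_spec (S i) ltac:(lia) m Hm).
      replace (rsum (shell (S i)) (fun x => perp x m) + - INR m ^ 2 * density (S i))
        with (rsum (shell (S i)) (fun x => perp x m) - density (S i) * INR m ^ 2) by ring. lra.
    - rewrite rsum_scal.
      replace (D * (INR m * (INR n ^ 2 * sqrt (INR n)))) with (INR m * (D * (INR n ^ 2 * sqrt (INR n)))) by ring.
      apply Rmult_le_compat_l; [lra|]. eapply Rle_trans; [apply errors_sum|].
      assert (R1 : Rpower (INR (S n)) (5/2) <= 8 * Rpower (INR n) (5/2)).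
      { apply Rle_trans with (Rpower (2 * INR n) (5/2)).
        - apply Rle_Rpower_l; [lra|]. rewrite S_INR. lra.
        - rewrite <- Rpower_mult_distr by lra. apply Rmult_le_compat_r; [left; apply Rpower_pos|].
          apply Rle_trans with (Rpower 2 3); [apply Rle_Rpower; lra|].
          replace 3 with (INR 3) by (simpl; lra). rewrite Rpower_pow by lra. simpl; lra. }
      assert (R3 : Rpower (INR n) (5 / 2) = INR n ^ 2 * sqrt (INR n)).
      { replace (5 / 2) with (2 + / 2) by field. rewrite Rpower_plus, Rpower_2, Rpower_sqrt by lra. reflexivity. }
      rewrite R3 in R1. unfold D. lra. }
  destruct (symmetric_density B D) as [b Hb].
  { unfold D; lra. }
  { intros n m Hn Hm. assert (H1 := HQ n m Hn Hm). assert (H2 := HQ m n Hm Hn).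
    rewrite Qsym in H2. apply Rabs_le_between in H1. apply Rabs_le_between in H2.
    rewrite Rmult_plus_distr_l. apply Rabs_le. lra. }
  exists b, 3481920, (12 * D). split.
  - apply Rnot_le_lt. intros Hb0.
    destruct (INR_unbounded ((9 * D) * (9 * D))) as [n Hn].
    assert (N1 := INR_S_ge1 n).
    specialize (Hb (S n) ltac:(lia)). assert (L := density_sum_lower (S n) ltac:(lia)). fold (B (S n)) in L.
    assert (A := Rle_abs (B (S n) - b * INR (S n) ^ 2)).
    assert (S1 : sqrt (INR (S n)) * sqrt (INR (S n)) = INR (S n)) by (apply sqrt_sqrt; lra).
    assert (S0 := sqrt_pos (INR (S n))).
    assert (Hn' : (9 * D) * (9 * D) < INR (S n)) by (rewrite S_INR; lra).
    set (s := sqrt (INR (S n))) in *. rewrite <- S1 in *.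
    assert (D0 : 0 < D) by (unfold D; lra).
    assert (Hs : 9 * D < s) by nra.
    assert (s3 : 0 < s * s * s) by nra.
    nra.
  - split.
    + apply counts_nonneg.
    + apply counts_symmetric.
    + apply density_nonneg.
    + apply errors_ge0.
    + intros n m Hn. rewrite counts_perp. destruct m as [|m].
      * simpl INR. unfold perp, ball. simpl. rewrite rsum_zero by reflexivity.
        replace (0 - density n * (0 * (0 * 1))) with 0 by ring. rewrite Rabs_R0. lra.
      * apply density_spec; lia.
    + apply errors_sum.
    + intros X HX. specialize (Hb X HX). assert (X1 := le_INR 1 X HX). simpl in X1.
      replace (Rpower (INR X) (3 / 2)) with (INR X * sqrt (INR X)); [exact Hb|].
      replace (3 / 2) with (1 + / 2) by field.
      rewrite Rpower_plus, Rpower_1, Rpower_sqrt by lra. reflexivity.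
Qed.

(** * The continuation of the sum over primitive pairs *)

Lemma cleared_quad N a e b Ce Cb w : regular_counts N a e b Ce Cb -> 7 / 4 < Re w ->
  quad (cleared N a b) w.
Proof.
  intros H Hw.
  set (r := Rmin (1/2) ((Re w - 7/4) / 4)).
  assert (Hr0 : 0 < r) by (apply Rmin_pos; lra).
  assert (Hr1 : r <= 1/2) by apply Rmin_l.
  assert (Hr2 : r <= (Re w - 7/4) / 4) by apply Rmin_r.
  destruct (jet_cleared N a e b Ce Cb (Re w - 2 * r) r H ltac:(lra) ltac:(lra)) as [A [_ J]].
  apply (jet_quad _ _ r (A * (Cmod w + 3) ^ 3) Hr0). apply J. lra.
Qed.

(** [(s - 1)^2] times the continuation; the factor [4] comes from [2 s - 2 = 2 (s - 1)]. *)
Definition numerator (b : R) (s : C) : C :=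
  (cleared counts density b (2 * s + 0) * (/ zeta (2 * s + 0) * / zeta (2 * s + 0)) * / 4)%C.

Definition continuation (b : R) (s : C) : C := (numerator b s / (s - 1) ^ 2)%C.

Lemma Re_double (s : C) : Re (2 * s + 0)%C = 2 * Re s.
Proof. destruct s; simpl; ring. Qed.

Lemma RtoC_4_neq0 : RtoC 4 <> RtoC 0.
Proof. intros E. apply RtoC_inj in E. lra. Qed.

Lemma Cinv_neq0 (a : C) : a <> RtoC 0 -> (/ a)%C <> RtoC 0.
Proof.
  intros Ha E. assert (Q := Cinv_r a Ha). rewrite E, Cmult_0_r in Q. apply RtoC_inj in Q. lra.
Qed.

Lemma zeta_neq0 (w : C) : 7 / 4 <= Re w -> zeta w <> RtoC 0.
Proof. intros Hw. apply Cmod_gt_0. assert (Q := zeta_lower w Hw). lra. Qed.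

Lemma quad_const (a z0 : C) : quad (fun _ => a) z0.
Proof. apply (jet_quad _ _ 1 (Cmod a)); [lra|]. apply jet_const; lra. Qed.

Lemma numerator_quad e b Ce Cb s : regular_counts counts density e b Ce Cb -> 7 / 8 < Re s ->
  quad (numerator b) s.
Proof.
  intros H Hs. unfold numerator.
  assert (Hw : 7 / 4 < Re (2 * s + 0)%C) by (rewrite Re_double; lra).
  assert (QZ : quad (fun s => / zeta (2 * s + 0))%C s).
  { apply (quad_inv (fun s => zeta (2 * s + 0)%C)); [apply zeta_neq0; lra|].
    apply (quad_affine zeta (RtoC 2) (RtoC 0)). apply zeta_quad. lra. }
  apply quad_mult; [|apply quad_const]. apply quad_mult; [|now apply quad_mult].
  apply (quad_affine (cleared counts density b) (RtoC 2) (RtoC 0)).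
  now apply (cleared_quad _ _ e _ Ce Cb).
Qed.

Lemma continuation_quad e b Ce Cb s : regular_counts counts density e b Ce Cb ->
  7 / 8 < Re s -> s <> RtoC 1 -> quad (continuation b) s.
Proof.
  intros H Hs H1. unfold continuation, Cdiv.
  assert (N1 : (s - 1)%C <> RtoC 0).
  { intros E. apply H1. replace s with (s - 1 + 1)%C by ring. rewrite E. ring. }
  assert (QL : quad (fun z => z - 1)%C s).
  { apply (jet_quad _ _ 1 (Cmod s + 1 + Cmod (- RtoC 1)%C)); [lra|].
    apply jet_plus; [apply jet_id; lra|apply jet_const; lra]. }
  apply quad_mult; [now apply (numerator_quad e b Ce Cb)|].
  apply (quad_inv (fun z => ((z - 1) ^ 2)%C)).
  - simpl. repeat apply Cmult_neq_0; auto. intros E. apply RtoC_inj in E. lra.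
  - simpl. apply quad_mult; [exact QL|]. apply quad_mult; [exact QL|apply quad_const].
Qed.

Lemma continuation_sum e b Ce Cb s : regular_counts counts density e b Ce Cb -> 1 < Re s ->
  has_sum primitive_orthogonal (zeta_term s) (continuation b s).
Proof.
  intros H Hs.
  assert (H2s : 2 < Re (2 * s)%C) by (destruct s; simpl in *; lra).
  assert (Ha := abs_summable_pairs density e b Ce Cb s H Hs).
  assert (L := box_limit counts density e b Ce Cb (2 * s)%C H H2s).
  assert (HS : has_sum nonzero_orthogonal (zeta_term s)
     (cleared counts density b (2 * s) / ((2 * s - 2) * (2 * s - 2)))%C).
  { apply (has_sum_exhaust _ _ pairs); [exact Ha|exact exhausts_pairs|].
    eapply ctends_ext; [|exact L]. intros X. symmetry. apply csum_pairs. }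
  apply (primitive_sum s _ Hs Ha) in HS.
  assert (N1 : (s - 1)%C <> RtoC 0).
  { intros E. assert (E' : s = RtoC 1) by (replace s with (s - 1 + 1)%C by ring; rewrite E; ring).
    rewrite E' in Hs. simpl in Hs. lra. }
  replace (continuation b s) with
    (cleared counts density b (2 * s) / ((2 * s - 2) * (2 * s - 2)) / (zeta (2 * s) * zeta (2 * s)))%C;
    [exact HS|].
  assert (NZ := zeta_neq0 (2 * s)%C ltac:(lra)).
  unfold continuation, numerator. replace (2 * s + 0)%C with (2 * s)%C by ring.
  replace (2 * s - 2)%C with (2 * (s - 1))%C by ring.
  replace (RtoC 4) with (RtoC 2 * RtoC 2)%C by (rewrite <- RtoC_mult; f_equal; ring).
  simpl. field. repeat split; auto.
Qed.

(** Since [|s|] and [|s - 1|] are comparable, the third power of [|s|] in the bound for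
    [cleared] loses two powers to [(s - 1)^2]. *)
Lemma continuation_growth e b Ce Cb theta : regular_counts counts density e b Ce Cb -> 7 / 8 < theta ->
  exists K : R, forall s : C, theta <= Re s -> 1 <= Cmod (s - RtoC 1)%C ->
    Cmod (continuation b s) <= K * Cmod s.
Proof.
  intros H Ht. set (t := Rmin theta 1).
  assert (Ht1 : 7 / 8 < t) by (unfold t; apply Rmin_glb_lt; lra).
  assert (Ht2 : t <= 1) by apply Rmin_r. assert (Ht3 : t <= theta) by apply Rmin_l.
  set (r := (2 * t - 7 / 4) / 8).
  destruct (jet_cleared counts density e b Ce Cb (2 * t - 2 * r) r H) as [A [HA J]];
    [unfold r; lra|unfold r; lra|].
  exists (A * 540000). intros s Hs H1.
  assert (S0 : 7 / 8 < Cmod s).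
  { assert (Q1 := Re_le_Cmod s). assert (Q2 := Rle_abs (Re s)). lra. }
  set (x := Cmod s) in *. set (y := Cmod (s - RtoC 1)%C) in *.
  assert (XY : x <= 2 * y).
  { assert (T := Cmod_triangle (s - RtoC 1)%C (RtoC 1)). fold y in T.
    replace (s - RtoC 1 + RtoC 1)%C with s in T by ring. fold x in T. rewrite Cmod_1 in T. lra. }
  assert (Hw : 2 * t - 2 * r + 2 * r <= Re (2 * s + 0)%C) by (rewrite Re_double; lra).
  assert (B1 := proj1 (J _ Hw)).
  assert (E2 : Cmod (2 * s + 0)%C = 2 * x).
  { replace (2 * s + 0)%C with (2 * s)%C by ring.
    rewrite Cmod_mult, Cmod_R, Rabs_pos_eq by lra. reflexivity. }
  rewrite E2 in B1.
  assert (Z1 := zeta_lower (2 * s + 0)%C ltac:(rewrite Re_double; lra)).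
  assert (NZ := zeta_neq0 (2 * s + 0)%C ltac:(rewrite Re_double; lra)).
  assert (N1 : (s - 1)%C <> RtoC 0) by (apply Cmod_gt_0; fold y; lra).
  assert (E : Cmod (continuation b s) =
    Cmod (cleared counts density b (2 * s + 0)%C) *
     (/ Cmod (zeta (2 * s + 0)%C) * / Cmod (zeta (2 * s + 0)%C)) * / 4 * / (y * y)).
  { unfold continuation, numerator, Cdiv. simpl.
    rewrite !Cmod_mult, !Cmod_inv; auto using RtoC_4_neq0.
    - rewrite !Cmod_mult, !Cmod_R, Rabs_R1, (Rabs_pos_eq 4) by lra. fold y. rewrite Rmult_1_r. reflexivity.
    - repeat apply Cmult_neq_0; auto. intros E. apply RtoC_inj in E. lra. }
  rewrite E. set (Z := Cmod (zeta (2 * s + 0)%C)) in *.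
  assert (ZI : / Z <= 50).
  { replace 50 with (/ (1 / 50)) by field. apply Rinv_le_contravar; lra. }
  assert (ZI0 : 0 < / Z) by (apply Rinv_0_lt_compat; lra).
  assert (ZZ : / Z * / Z <= 2500) by nra.
  assert (B2 : A * (2 * x + 3) ^ 3 <= A * (6 * x) ^ 3).
  { apply Rmult_le_compat_l; [exact HA|]. apply pow_incr. lra. }
  assert (YI : 0 < / (y * y)) by (apply Rinv_0_lt_compat; nra).
  assert (XI : x ^ 2 * / (y * y) <= 4).
  { apply Rmult_le_reg_r with (y * y); [nra|]. rewrite Rmult_assoc, Rinv_l by nra. nra. }
  apply Rle_trans with (A * (6 * x) ^ 3 * 2500 * / 4 * / (y * y)).
  - apply Rmult_le_compat_r; [lra|]. apply Rmult_le_compat_r; [lra|].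
    apply Rmult_le_compat; [apply Cmod_ge_0|nra|lra|exact ZZ].
  - replace (A * (6 * x) ^ 3 * 2500 * / 4 * / (y * y)) with (A * 135000 * x * (x ^ 2 * / (y * y))) by (field; lra).
    apply Rle_trans with (A * 135000 * x * 4); [|right; ring].
    apply Rmult_le_compat_l; [|exact XI]. apply Rmult_le_pos; [lra|unfold x; apply Cmod_ge_0].
Qed.

Theorem mainTheorem6 :
  (forall s : C, 1 < Re s ->
     absolutely_summable primitive_orthogonal (zeta_term s)) /\
  exists F : C -> C,
    (forall s : C, 1 < Re s ->
       has_sum primitive_orthogonal (zeta_term s) (F s)) /\
    holomorphic_on (fun s => 7 / 8 < Re s /\ s <> RtoC 1) F /\
    has_pole F (RtoC 1) 2 /\
    (forall theta : R, 7 / 8 < theta ->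
       exists K : R, forall s : C,
         theta <= Re s -> 1 <= Cmod (s - RtoC 1)%C ->
         Cmod (F s) <= K * Cmod s).
Proof.
  destruct counts_regular as [b [Ce [Cb [Hb H]]]]. split.
  - intros s Hs. apply (abs_summable_sub nonzero_orthogonal).
    + exact primitive_orthogonal_nonzero.
    + exact (abs_summable_pairs _ _ _ _ _ s H Hs).
  - exists (continuation b). split; [|split; [|split]].
    + intros s Hs. exact (continuation_sum _ _ _ _ s H Hs).
    + intros s [Hs H1]. apply quad_ex_derive. exact (continuation_quad _ _ _ _ s H Hs H1).
    + exists (1 / 8), (numerator b). split; [lra|]. split; [|split].
      * intros z Hz. apply quad_ex_derive. apply (numerator_quad _ _ _ _ z H).
        assert (Q := Re_le_Cmod (z - RtoC 1)%C). destruct z as [x y]. simpl in *.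
        apply Rabs_le_between in Q. lra.
      * unfold numerator. replace (2 * RtoC 1 + 0)%C with (RtoC 2) by ring.
        rewrite cleared_at_pole.
        assert (NZ := zeta_neq0 (RtoC 2) ltac:(simpl; lra)).
        assert (NB : RtoC (4 * b) <> RtoC 0) by (intros E; apply RtoC_inj in E; lra).
        repeat apply Cmult_neq_0; auto using Cinv_neq0, RtoC_4_neq0.
      * reflexivity.
    + intros theta Ht. exact (continuation_growth _ _ _ _ theta H Ht).
Qed.
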